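(* Let $n,N\ge 1$, let $0<t_0<T<\infty$, and let $h\in C_0^\infty(\mathbb{R}^n)$. Consider the Cauchy problem for the variable coefficient wave equation $$\Big(\frac{2t}{N}\,\frac{\partial^2}{\partial t^2}-\Delta_{x,y}\Big)u=0,\qquad (t,x,y)\in[t_0,T]\times\mathbb{R}^n_x\times\mathbb{R}^N_y,\qquad u(T,x,y)=h(x),$$ where $\Delta_{x,y}=\sum_{i=1}^n\partial_{x_i}^2+\sum_{j=1}^N\partial_{y_j}^2$. Then for each $N$ there exists a solution $u=u^{(N)}(t,x,y)$ of this Cauchy problem which is radial in the $y$-coordinates, i.e. $u^{(N)}(t,x,y)=u^{(N)}(t,x,Ay)$ for all $A\in SO(N)$, such that the limit $$u(t,x):=\lim_{N\to\infty}u^{(N)}(t,x,y)\big|_{\{t=|y|^2/(2N)\}}$$ exists at all points of $[t_0,T]\times\mathbb{R}^n_x$. Moreover $u\in C^\infty([t_0,T]\times\mathbb{R}^n_x)$ and $u$ solves the backward heat equation $$\partial_t u+\Delta_x u=0,\qquad u(T,x)=h(x),\qquad (t,x)\in[t_0,T]\times\mathbb{R}^n_x.$$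
   Context: Here $\mathbb{R}^n_x\times\mathbb{R}^N_y$ carries the Euclidean metric $dx^2+dy^2$. The restriction $u^{(N)}|_{\{t=|y|^2/(2N)\}}$ means: since $u^{(N)}$ depends on $y$ only through $|y|$, one evaluates $u^{(N)}(t,x,y)$ at $|y|=\sqrt{2Nt}$, giving a function of $(t,x)$. *)

(* Defs.v *)
From Stdlib Require Import Reals.
From mathcomp Require Import ssreflect ssrfun ssrbool eqtype ssrnat seq choice
  fintype finfun bigop fingroup perm.
Open Scope R_scope.

Definition upd {I : eqType} (p : I -> R) (i : I) (s : R) : I -> R :=
  fun j => if j == i then s else p j.

(* g is the partial derivative of f in direction i, taken within the set D
   (one-sided at boundary points of D, the usual derivative at interior points). *)
Definition has_pderiv_in {I : eqType} (D : (I -> R) -> Prop)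
    (f g : (I -> R) -> R) (i : I) : Prop :=
  forall p, D p ->
    limit1_in (fun s => (f (upd p i s) - f p) / (s - p i))
              (fun s => D (upd p i s) /\ s <> p i) (g p) (p i).

Definition cont_in {I : finType} (D : (I -> R) -> Prop) (f : (I -> R) -> R) : Prop :=
  forall p, D p -> forall eps, 0 < eps -> exists del, 0 < del /\
    forall q, D q -> (forall i, Rabs (q i - p i) < del) -> Rabs (f q - f p) < eps.

Fixpoint Ck_in {I : finType} (D : (I -> R) -> Prop) (k : nat) (f : (I -> R) -> R)
  : Prop :=
  match k with
  | O => cont_in D f
  | S k' => cont_in D f /\ forall i, exists g, has_pderiv_in D f g i /\ Ck_in D k' g
  end.

Definition Cinf_in {I : finType} (D : (I -> R) -> Prop) (f : (I -> R) -> R) : Prop :=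
  forall k, Ck_in D k f.

Definition sumR {n : nat} (F : 'I_n -> R) : R := \big[Rplus/0]_(i < n) F i.

Definition smooth_compact {n : nat} (h : ('I_n -> R) -> R) : Prop :=
  Cinf_in (fun _ => True) h /\
  exists Rb, forall x, (exists i, Rb < Rabs (x i)) -> h x = 0.

Definition uncurry3 {n N : nat} (u : R -> ('I_n -> R) -> ('I_N -> R) -> R)
    (p : option ('I_n + 'I_N) -> R) : R :=
  u (p None) (fun i => p (Some (inl i))) (fun k => p (Some (inr k))).

Definition wave_solution {n N : nat} (t0 T : R) (h : ('I_n -> R) -> R)
    (u : R -> ('I_n -> R) -> ('I_N -> R) -> R) : Prop :=
  let U := uncurry3 u in
  let D := fun p : option ('I_n + 'I_N) -> R => t0 <= p None <= T in
  Ck_in D 2 U /\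
  (exists (Ut Utt : (option ('I_n + 'I_N) -> R) -> R)
          (Ux Uxx : 'I_n -> (option ('I_n + 'I_N) -> R) -> R)
          (Uy Uyy : 'I_N -> (option ('I_n + 'I_N) -> R) -> R),
     has_pderiv_in D U Ut None /\ has_pderiv_in D Ut Utt None /\
     (forall i, has_pderiv_in D U (Ux i) (Some (inl i)) /\
                has_pderiv_in D (Ux i) (Uxx i) (Some (inl i))) /\
     (forall k, has_pderiv_in D U (Uy k) (Some (inr k)) /\
                has_pderiv_in D (Uy k) (Uyy k) (Some (inr k))) /\
     (forall p, D p ->
        (2 * p None / INR N) * Utt p
        - (sumR (fun i => Uxx i p) + sumR (fun k => Uyy k p)) = 0)) /\
  (forall x y, u T x y = h x).

Definition orthogonal_mx {N : nat} (A : 'I_N -> 'I_N -> R) : Prop :=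
  forall i j, sumR (fun k => A k i * A k j) = if i == j then 1 else 0.

Definition det_mx {N : nat} (A : 'I_N -> 'I_N -> R) : R :=
  \big[Rplus/0]_(s : {perm 'I_N})
     ((-1) ^ (odd_perm s) * \big[Rmult/1]_(i < N) A i (s i)).

Definition mx_app {N : nat} (A : 'I_N -> 'I_N -> R) (y : 'I_N -> R) : 'I_N -> R :=
  fun i => sumR (fun j => A i j * y j).

Definition radial_y {n N : nat} (u : R -> ('I_n -> R) -> ('I_N -> R) -> R) : Prop :=
  forall A : 'I_N -> 'I_N -> R, orthogonal_mx A -> det_mx A = 1 ->
    forall t x y, u t x y = u t x (mx_app A y).

(* u^(N) restricted to {t = |y|^2/(2N)}: evaluate at y = sqrt(2Nt) e_1
   (by radiality any y with |y| = sqrt(2Nt) gives the same value). *)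
Definition on_paraboloid {n N : nat} (u : R -> ('I_n -> R) -> ('I_N -> R) -> R)
    (t : R) (x : 'I_n -> R) : R :=
  u t x (fun k : 'I_N => if nat_of_ord k == 0%N then sqrt (2 * INR N * t) else 0).

Definition uncurry2 {n : nat} (v : R -> ('I_n -> R) -> R) (p : option 'I_n -> R) : R :=
  v (p None) (fun i => p (Some i)).

Definition heat_solution {n : nat} (t0 T : R) (h : ('I_n -> R) -> R)
    (v : R -> ('I_n -> R) -> R) : Prop :=
  let V := uncurry2 v in
  let D := fun p : option 'I_n -> R => t0 <= p None <= T in
  Cinf_in D V /\
  (exists (Vt : (option 'I_n -> R) -> R) (Vx Vxx : 'I_n -> (option 'I_n -> R) -> R),
     has_pderiv_in D V Vt None /\
     (forall i, has_pderiv_in D V (Vx i) (Some i) /\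
                has_pderiv_in D (Vx i) (Vxx i) (Some i)) /\
     (forall p, D p -> Vt p + sumR (fun i => Vxx i p) = 0)) /\
  (forall x, v T x = h x).

(* Main.v *)
Require Import Defs.
From Stdlib Require Import Reals ZArith Lra Lia FunctionalExtensionality ClassicalEpsilon.
From HB Require Import structures.
From mathcomp Require Import ssreflect ssrfun ssrbool eqtype ssrnat seq choice
  div fintype finfun bigop fingroup perm.
From mathcomp Require Import zify.
From mathcomp.classical Require filter.
From Coquelicot Require Import Coquelicot.
Open Scope R_scope.

(* With lam = |xi|^2 and r = |y|^2/(2N), the product E(t) b_z(r) trig(xi.x) solves the wave equation as soon
   as (2t/N) E'' = -kappa E, z = lam - kappa and Delta_y b_z(r) = z b_z(r), where b_z(r) = sum_j beta_j (z r)^j/j!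
   with beta_j -> 1 as N -> oo, so that b_z(r) tends to exp (z r).  For kappa = 0 and E = 1 the product
   exp (- lam T) b_lam(r) therefore tends on the paraboloid r = t to the heat mode exp (- lam (T - t)), but at t = T
   it depends on y.  The trace is corrected by averages over circles in the variable kappa:

     exp (- lam T) b_lam - exp (- lam T) <E_kappa b_(lam - kappa)>_(|kappa| = d)
       + <E_kappa b_(lam - kappa)>_(|kappa - lam| = delta),   E_kappa(T) = 1,

   which equals 1 at t = T by the mean value property.  For kappa off the positive axis there is a solution E_kappa
   of size exp (- sqrt (N (|kappa| - Re kappa)) (sqrt T - sqrt t)), so for t < T the corrections vanish as N -> oo.
   The solutions for general h are superpositions in xi; the superposing functional is a generalized limit of
   discrete Fourier sums, bounded on families of polynomial growth in xi because h is smooth with compact support. *)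

(** * Generalized limits *)

(** The trace 1 at t = T belongs to kappa = lam, where b_0 = 1, and the unwanted trace b_lam to
    kappa = 0. Neither value of kappa comes with decay in time, so neither mode can be used as a
    correction. But b_(lam - kappa) is entire in kappa, hence its value at the centre of a circle is
    its average over the circle, and a circle is close to the positive axis only near sin = 0. The
    time factors are chosen one kappa and one xi at a time, without any continuity or measurability
    in these parameters. The superpositions are therefore not integrals but finitely additive
    functionals built from an ultrafilter. Linearity and a bound for each order of growth in xi are
    enough to differentiate under them, by Taylor estimates uniform in the parameters, and no
    convergence of the Fourier sums has to be shown beyond the one that recovers h. The price is the
    absence of dominated convergence: the smallness of an average of factors that do not decay near
    sin = 0 needs an explicit inequality, and each error must carry an explicit power of the weight
    of xi. *)

Lemma ultrafilter_nat : exists U : (nat -> Prop) -> Prop,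
  [/\ forall P Q, U P -> U Q -> U (fun n => P n /\ Q n),
      forall P Q : nat -> Prop, (forall n, P n -> Q n) -> U P -> U Q,
      ~ U (fun _ => False),
      forall P, U P \/ U (fun n => ~ P n) &
      forall m, U (fun n => (m <= n)%N)].
Proof.
have [U [UU sU]] := @filter.ultraFilterLemma nat _ filter.eventually_filter.
have UP := @filter.ultra_proper _ _ UU.
have UF := @filter.filter_filter _ _ UP.
have UI : forall P Q, U P -> U Q -> U (fun n => P n /\ Q n) by move=> P Q; exact: filter.filterI.
have US : forall P Q : nat -> Prop, (forall n, P n -> Q n) -> U P -> U Q
  by move=> P Q; exact: filter.filterS.
exists U; split=> //.
- exact: filter.filter_not_empty.
- move=> P; case: (classic (U (fun n => ~ P n))) => [|nU]; [by right|left].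
  (* [G] is the filter generated by [U] and [P]. It is proper because the complement of [P] is not
     in [U], so maximality forces [G = U]. *)
  pose G := fun B : nat -> Prop => exists A, U A /\ forall n, A n -> P n -> B n.
  suff <- : G = U by exists (fun=> True); split=> //; exact: filter.filterT.
  apply: (@filter.max_filter _ _ UU G).
  + split.
    * move=> [A [UA h]]; apply: nU; apply: US UA => n An Pn; exact: (h n An Pn).
    * split.
      - by exists (fun=> True); split=> //; exact: filter.filterT.
      - move=> A B [A' [UA hA]] [B' [UB hB]].
        exists (fun n => A' n /\ B' n); split; first exact: UI.
        by move=> n [a b] p; split; [exact: hA|exact: hB].
      - by move=> A B sAB [A' [UA hA]]; exists A'; split=> // n a p; apply/sAB/hA.
  + by move=> A UA; exists A.
- by move=> m; apply: sU; exists m.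
Qed.

Section Ultralimit.
Variable U : (nat -> Prop) -> Prop.
Hypothesis UI : forall P Q, U P -> U Q -> U (fun n => P n /\ Q n).
Hypothesis US : forall P Q : nat -> Prop, (forall n, P n -> Q n) -> U P -> U Q.
Hypothesis U0 : ~ U (fun _ => False).
Hypothesis UC : forall P, U P \/ U (fun n => ~ P n).
Hypothesis Um : forall m, U (fun n => (m <= n)%N).

(** The limit is the supremum of the levels [y] with [y <= a n] on a set of [U]. That a higher level
    fails on a set of [U] uses that [U] decides every set. *)
Lemma ultralimit_ex (a : nat -> R) A m : (forall n, (m <= n)%N -> Rabs (a n) <= A) ->
  exists l, forall eps, 0 < eps -> U (fun n => Rabs (a n - l) < eps).
Proof.
move=> hA.
pose E y := U (fun n => y <= a n).
have [l [ub lb]] : {l | is_lub E l}.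
  apply: completeness.
    exists A => y Ey; apply: Rnot_lt_le => lt; apply: U0.
    apply: US (UI _ _ Ey (Um m)) => n [h1 h2].
    by have := hA n h2; split_Rabs; lra.
  exists (- A); apply: US (Um m) => n /hA; split_Rabs; lra.
exists l => eps e0.
have h1 : U (fun n => l - eps/2 <= a n).
  have [y [Ey ly]] : exists y, E y /\ l - eps/2 <= y.
    apply: NNPP => H; have : l <= l - eps/2; last by lra.
    apply: lb => y Ey; apply: Rnot_lt_le => lt; apply: H; exists y; split=> //; lra.
  by apply: US Ey => n; lra.
have h2 : U (fun n => ~ (l + eps/2 <= a n)).
  case: (UC (fun n => l + eps/2 <= a n)) => // Ey.
  by have := ub _ Ey; lra.
apply: US (UI _ _ h1 h2) => n [p1 p2]; apply: Rabs_def1; lra.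
Qed.
End Ultralimit.

(** [epsilon] makes [Lim] total; on eventually bounded sequences the chosen value is the unique
    ultralimit, whence linearity there. The sandwich property on tails makes [Lim] agree with every
    ordinary limit. *)
Lemma generalized_limit : exists Lim : (nat -> R) -> R,
  (forall a b c A B m, (forall n, (m <= n)%N -> Rabs (a n) <= A) ->
     (forall n, (m <= n)%N -> Rabs (b n) <= B) ->
     Lim (fun n => a n + c * b n) = Lim a + c * Lim b) /\
  (forall a x y m, (forall n, (m <= n)%N -> x <= a n <= y) -> x <= Lim a <= y).
Proof.
have [U [UI US U0 UC Um]] := ultrafilter_nat.
pose near a l := forall eps, 0 < eps -> U (fun n => Rabs (a n - l) < eps).
have ex_near a A m : (forall n, (m <= n)%N -> Rabs (a n) <= A) -> exists l, near a l.
  exact: ultralimit_ex UI US U0 UC Um a A m.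
have uniq a l l' : near a l -> near a l' -> l = l'.
  move=> h h'; apply: NNPP => ne.
  have e0 : 0 < Rabs (l - l') / 2 by have := Rabs_pos_lt (l - l'); lra.
  apply: U0; apply: US (UI _ _ (h _ e0) (h' _ e0)) => n [].
  by split_Rabs; lra.
exists (fun a => epsilon (inhabits 0) (near a)).
have spec a A m : (forall n, (m <= n)%N -> Rabs (a n) <= A) ->
    near a (epsilon (inhabits 0) (near a)).
  by move=> h; apply: epsilon_spec; exact: ex_near h.
split.
- move=> a b c A B m hA hB.
  apply: (uniq (fun n => a n + c * b n)).
    apply: (spec _ (A + Rabs c * B) m) => n hn.
    apply: Rle_trans (Rabs_triang _ _) _; rewrite Rabs_mult.
    apply: Rplus_le_compat; first exact: hA.
    by apply: Rmult_le_compat_l; [exact: Rabs_pos|exact: hB].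
  move=> eps e0.
  have e1 : 0 < eps / (2 * (1 + Rabs c)).
    by apply: Rdiv_lt_0_compat => //; have := Rabs_pos c; lra.
  have e2 : 0 < eps / 2 by lra.
  apply: US (UI _ _ (spec _ _ _ hA _ e2) (spec _ _ _ hB _ e1)) => n [].
  set l := epsilon _ _; set l' := epsilon _ _ => h1 h2.
  have -> : a n + c * b n - (l + c * l') = (a n - l) + c * (b n - l') by ring.
  apply: Rle_lt_trans (Rabs_triang _ _) _; rewrite Rabs_mult.
  have : Rabs c * Rabs (b n - l') <= Rabs c * (eps / (2 * (1 + Rabs c))).
    by apply: Rmult_le_compat_l; [exact: Rabs_pos|lra].
  have : Rabs c * (eps / (2 * (1 + Rabs c))) <= eps / 2; last by lra.
  have c0 := Rabs_pos c.
  rewrite /Rdiv Rinv_mult.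
  have : Rabs c * / (1 + Rabs c) <= 1.
    apply: (Rmult_le_reg_r (1 + Rabs c)); first lra.
    rewrite Rmult_assoc Rinv_l; lra.
  nra.
- move=> a x y m h.
  have hA n : (m <= n)%N -> Rabs (a n) <= Rabs x + Rabs y.
    by move=> /h; split_Rabs; lra.
  have := spec _ _ _ hA; set l := epsilon _ _ => hl.
  split; apply: Rnot_lt_le => lt; apply: U0.
  + have e0 : 0 < x - l by lra.
    apply: US (UI _ _ (hl _ e0) (Um m)) => n [h1 /h h2]; move/Rabs_def2: h1; lra.
  + have e0 : 0 < l - y by lra.
    apply: US (UI _ _ (hl _ e0) (Um m)) => n [h1 /h h2]; move/Rabs_def2: h1; lra.
Qed.

(** * Superposition of families of functions on a slab *)

Lemma upd_same {I : eqType} (p : I -> R) i s : upd p i s i = s.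
Proof. by rewrite /upd eqxx. Qed.

Lemma upd_other {I : eqType} (p : I -> R) i j s : j != i -> upd p i s j = p j.
Proof. by rewrite /upd => /negbTE ->. Qed.

Lemma upd_id {I : eqType} (p : I -> R) i : upd p i (p i) = p.
Proof. by apply: functional_extensionality => j; rewrite /upd; case: eqP => // ->. Qed.

Lemma upd_upd {I : eqType} (p : I -> R) i s s' : upd (upd p i s) i s' = upd p i s'.
Proof. by apply: functional_extensionality => j; rewrite /upd; case: eqP. Qed.

(** The derivatives at [a] and [b] are one-sided, as on the boundary of the slab. Composing with the
    clamp [cl] onto [[a, b]] extends [f] by constants, and the usual mean value theorem then asks
    only for derivatives in the open interval and continuity at the ends. *)
Lemma mvt_in (a b : R) (f f' : R -> R) : a < b ->
  (forall c, a <= c <= b ->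
     limit1_in (fun s => (f s - f c) / (s - c)) (fun s => a <= s <= b /\ s <> c) (f' c) c) ->
  exists c, a <= c <= b /\ f b - f a = (b - a) * f' c.
Proof.
move=> ab H.
pose cl s := Rmax a (Rmin b s).
have cl_id s : a <= s <= b -> cl s = s.
  by move=> [h1 h2]; rewrite /cl Rmin_right // Rmax_right.
have cl_in s : a <= cl s <= b.
  by rewrite /cl; split; [exact: Rmax_l|apply: Rmax_lub; [lra|exact: Rmin_l]].
have cl_lip s c : a <= c <= b -> Rabs (cl s - c) <= Rabs (s - c).
  by rewrite /cl /Rmin => -[h1 h2]; case: Rle_dec => h3; rewrite /Rmax; case: Rle_dec => h4; split_Rabs; lra.
have Hcont c : a <= c <= b -> continuity_pt (fun s => f (cl s)) c.
  move=> hc eps e0.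
  have [al [al0 hal]] := H c hc 1 Rlt_0_1.
  (* Near [c] the difference quotients are at most [K] in absolute value, which gives continuity at
     [c], endpoints included. *)
  pose K := Rabs (f' c) + 1.
  have K0 : 0 < K by rewrite /K; have := Rabs_pos (f' c); lra.
  exists (Rmin al (eps / K)); split.
    by apply: Rmin_pos => //; apply: Rdiv_lt_0_compat.
  move=> s [_ hs]; rewrite /= /Rdist in hs *; rewrite (cl_id c hc).
  case: (Req_dec (cl s) c) => [->|ne]; first by rewrite Rminus_diag Rabs_R0.
  have l1 := cl_lip s c hc.
  have hd : Rabs (cl s - c) < al by apply: Rle_lt_trans l1 _; apply: Rlt_le_trans hs (Rmin_l _ _).
  have := hal (cl s) (conj (conj (cl_in s) ne) hd); rewrite /= /Rdist => hq.
  have -> : f (cl s) - f c = (f (cl s) - f c) / (cl s - c) * (cl s - c) by field; lra.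
  rewrite Rabs_mult.
  have q1 : Rabs ((f (cl s) - f c) / (cl s - c)) <= K.
    by rewrite /K; move: hq; set q := _ / _; split_Rabs; lra.
  have q2 : Rabs (cl s - c) < eps / K by apply: Rle_lt_trans l1 _; apply: Rlt_le_trans hs (Rmin_r _ _).
  apply: (Rle_lt_trans _ (K * Rabs (cl s - c))).
    by apply: Rmult_le_compat_r => //; exact: Rabs_pos.
  by rewrite -[X in _ < X](_ : K * (eps / K) = eps); [apply: Rmult_lt_compat_l|field; lra].
have [|c hc|c [hc e]] := MVT_gen (fun s => f (cl s)) a b f'.
- move=> c; rewrite Rmin_left ?Rmax_right; try lra.
  move=> -[h1 h2].
  apply: (proj2 (is_derive_Reals _ _ _)) => eps e0.
  have [al [al0 hal]] := H c (conj (Rlt_le _ _ h1) (Rlt_le _ _ h2)) eps e0.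
  have d0 : 0 < Rmin al (Rmin (c - a) (b - c)).
    by apply: Rmin_pos => //; apply: Rmin_pos; lra.
  exists (mkposreal _ d0) => h h0 /= hh.
  have hh1 : Rabs h < al := Rlt_le_trans _ _ _ hh (Rmin_l _ _).
  have hh2 : Rabs h < Rmin (c - a) (b - c) := Rlt_le_trans _ _ _ hh (Rmin_r _ _).
  have hh3 : Rabs h < c - a := Rlt_le_trans _ _ _ hh2 (Rmin_l _ _).
  have hh4 : Rabs h < b - c := Rlt_le_trans _ _ _ hh2 (Rmin_r _ _).
  have r1 : a <= c + h <= b by split_Rabs; lra.
  rewrite !cl_id //; try lra.
  have := hal (c + h); rewrite /= /Rdist.
  rewrite (_ : c + h - c = h); last ring.
  by apply; split => //; split=> //; lra.
- by move: hc; rewrite Rmin_left ?Rmax_right; try lra; exact: Hcont.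
- exists c; move: hc e; rewrite Rmin_left ?Rmax_right; try lra.
  move=> hc; rewrite !cl_id; lra.
Qed.

Lemma has_pderiv_of_derive {I : eqType} (D : (I -> R) -> Prop) (f g : (I -> R) -> R) i :
  (forall p, D p -> is_derive (fun s => f (upd p i s)) (p i) (g p)) -> has_pderiv_in D f g i.
Proof.
move=> H p Dp eps e0.
have [d hd] := proj1 (is_derive_Reals _ _ _) (H p Dp) eps e0.
exists d; split; first exact: cond_pos.
move=> s [[_ ne]]; rewrite /= /Rdist => hs.
have := hd (s - p i); rewrite (_ : p i + (s - p i) = s); last ring.
rewrite upd_id; apply => //; lra.
Qed.

Lemma pderiv_add {I : eqType} (D : (I -> R) -> Prop) (f f' g g' : (I -> R) -> R) i :
  has_pderiv_in D f f' i -> has_pderiv_in D g g' i ->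
  has_pderiv_in D (fun p => f p + g p) (fun p => f' p + g' p) i.
Proof.
move=> hf hg p Dp eps e0.
have [d [d0 hd]] := limit_plus _ _ _ _ _ _ (hf p Dp) (hg p Dp) eps e0.
exists d; split=> // s [[Ds ne] hs].
rewrite (_ : (_ + _ - _) / _ =
  (f (upd p i s) - f p) / (s - p i) + (g (upd p i s) - g p) / (s - p i)); last by field; lra.
exact: hd.
Qed.

Lemma pderiv_mul {I : eqType} (D : (I -> R) -> Prop) (f f' g g' : (I -> R) -> R) i :
  has_pderiv_in D f f' i -> has_pderiv_in D g g' i ->
  has_pderiv_in D (fun p => f p * g p) (fun p => f' p * g p + f p * g' p) i.
Proof.
move=> hf hg p Dp.
pose S := fun s => D (upd p i s) /\ s <> p i.
(* The moved value of [g] is written as [g p] plus the increment times the difference quotient, so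
   that its continuity comes from its differentiability. *)
have lg : limit1_in (fun s => g p + (s - p i) * ((g (upd p i s) - g p) / (s - p i))) S
    (g p + (p i - p i) * g' p) (p i).
  apply: limit_plus; first exact: (limit_free (fun=> g p) S (p i) (p i)).
  apply: limit_mul; last exact: hg.
  apply: limit_minus; first exact: lim_x.
  exact: (limit_free (fun=> p i) S (p i) (p i)).
have := limit_plus _ _ _ _ _ _ (limit_mul _ _ _ _ _ _ (hf p Dp) lg)
  (limit_mul _ _ _ _ _ _ (limit_free (fun=> f p) S (p i) (p i)) (hg p Dp)).
move=> H eps e0.
have [d [d0 hd]] := H eps e0; exists d; split=> // s [[Ds ne] hs].
have := hd s (conj (conj Ds ne) hs).
rewrite (_ : f' p * (g p + (p i - p i) * g' p) + f p * g' p = f' p * g p + f p * g' p); last ring.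
rewrite (_ : _ / _ * (_ + _) + _ =
  (f (upd p i s) * g (upd p i s) - f p * g p) / (s - p i)) //.
by field; lra.
Qed.

Lemma pderiv_const {I : eqType} (D : (I -> R) -> Prop) c (i : I) :
  has_pderiv_in D (fun=> c) (fun=> 0) i.
Proof. by apply: has_pderiv_of_derive => p _; apply: is_derive_const. Qed.

Lemma pderiv_mvt {I : eqType} (D : (I -> R) -> Prop) (f g : (I -> R) -> R) i p s :
  (forall c, Rmin (p i) s <= c <= Rmax (p i) s -> D (upd p i c)) -> has_pderiv_in D f g i ->
  exists c, Rmin (p i) s <= c <= Rmax (p i) s /\
    f (upd p i s) - f p = (s - p i) * g (upd p i c).
Proof.
move=> conv hf.
have lim c : Rmin (p i) s <= c <= Rmax (p i) s ->
  limit1_in (fun s => (f (upd p i s) - f (upd p i c)) / (s - c))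
   (fun s' => Rmin (p i) s <= s' <= Rmax (p i) s /\ s' <> c) (g (upd p i c)) c.
  move=> hc eps e0; have [d [d0 hd]] := hf _ (conv c hc) eps e0.
  exists d; split=> // s' [[hs' ne] hd'].
  have := hd s'; rewrite !upd_upd upd_same; apply; split=> //; split=> //; exact: conv.
case: (Rtotal_order (p i) s) => [lt|[eq|gt]].
- rewrite Rmin_left ?Rmax_right in conv lim *; try lra.
  have [c [hc e]] := mvt_in _ _ (fun s => f (upd p i s)) (fun s => g (upd p i s)) lt lim.
  by exists c; rewrite upd_id in e.
- exists s; rewrite -eq Rmin_left ?Rmax_left ?upd_id; lra.
- rewrite Rmin_right ?Rmax_left in conv lim *; try lra.
  have [c [hc e]] := mvt_in _ _ (fun s => f (upd p i s)) (fun s => g (upd p i s)) gt lim.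
  exists c; rewrite upd_id in e; split=> //.
  by apply: Ropp_eq_reg; rewrite Ropp_minus_distr e; ring.
Qed.

Lemma coords_bounded {I : finType} (p : I -> R) : exists Rb, 0 <= Rb /\ forall i, Rabs (p i) <= Rb.
Proof.
exists (\big[Rplus/0]_(i : I) Rabs (p i)).
have h (s : seq I) : 0 <= \big[Rplus/0]_(i <- s) Rabs (p i) /\
    (forall i, i \in s -> Rabs (p i) <= \big[Rplus/0]_(i <- s) Rabs (p i)).
  elim: s => [|j s [h1 h2]]; first by rewrite big_nil; split=> //; lra.
  rewrite big_cons; have := Rabs_pos (p j); split; first lra.
  by move=> i; rewrite in_cons => /orP [/eqP -> | /h2]; lra.
split; first exact: (h _).1.
by move=> i; apply: (h _).2; rewrite mem_index_enum.
Qed.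

(* A functional [L] on functions of [om] that is linear and bounded on functions of
   polynomial growth in the weight [w] commutes with partial derivatives of families. *)
Section Superposition.
Variables (Om : Type) (w : Om -> R).
Hypothesis w1 : forall om, 1 <= w om.

Definition tame (F : Om -> R) := exists q A, forall om, Rabs (F om) <= A * w om ^ q.

(** [C] depends on the growth order [q] alone; this uniformity in [F] replaces dominated convergence
    when a limit is taken under [L]. *)
Definition tame_functional (L : (Om -> R) -> R) :=
  (forall F G c, tame F -> tame G -> L (fun om => F om + c * G om) = L F + c * L G) /\
  (forall q, exists C, 0 <= C /\
     forall F A, (forall om, Rabs (F om) <= A * w om ^ q) -> Rabs (L F) <= C * A).

Lemma weight_pow_le q q' om : (q <= q')%N -> w om ^ q <= w om ^ q'.
Proof. by move=> h; apply: Rle_pow => //; lia. Qed.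

Lemma weight_pow_ge1 q om : 1 <= w om ^ q.
Proof. exact: pow_R1_Rle. Qed.

Lemma bound_weaken a A B q q' om : (q <= q')%N -> A <= B ->
  Rabs a <= A * w om ^ q -> Rabs a <= B * w om ^ q'.
Proof.
move=> hq AB h; have h1 := weight_pow_ge1 q om; have h2 := weight_pow_le q q' om hq.
have A0 : 0 <= A by apply: Rnot_lt_le => A0; have := Rabs_pos a; nra.
apply: Rle_trans h _; apply: Rmult_le_compat => //; lra.
Qed.

Lemma tame_bounded A (F : Om -> R) : (forall om, Rabs (F om) <= A) -> tame F.
Proof. by move=> h; exists 0%N, A => om; rewrite /= Rmult_1_r. Qed.

Lemma tame_add F G : tame F -> tame G -> tame (fun om => F om + G om).
Proof.
move=> [q [A hF]] [q' [B hG]]; exists (maxn q q'), (Rabs A + Rabs B) => om.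
apply: Rle_trans (Rabs_triang _ _) _; rewrite Rmult_plus_distr_r.
by apply: Rplus_le_compat; [apply: bound_weaken (hF om)|apply: bound_weaken (hG om)];
  rewrite ?leq_maxl ?leq_maxr //; exact: Rle_abs.
Qed.

Lemma tame_mul F G : tame F -> tame G -> tame (fun om => F om * G om).
Proof.
move=> [q [A hF]] [q' [B hG]]; exists (q + q')%N, (A * B) => om.
rewrite Rabs_mult pow_add (_ : A * B * _ = A * w om ^ q * (B * w om ^ q')); last ring.
by apply: Rmult_le_compat => //; exact: Rabs_pos.
Qed.

Section Families.
Variables (I : finType) (i0 : I) (t0 T : R).
Let D := fun p : I -> R => t0 <= p i0 <= T.
Implicit Types F G : Om -> (I -> R) -> R.

Definition loc_tame F := forall Rb, exists q A, forall om p, D p ->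
  (forall i, Rabs (p i) <= Rb) -> Rabs (F om p) <= A * w om ^ q.

(** The derivative is a family [G] chosen before [om], so that its bound on each box is a common
    power of the weight. *)
Fixpoint nice k F := loc_tame F /\ match k with
  | O => True
  | S k' => forall i, exists G, (forall om, has_pderiv_in D (F om) (G om) i) /\ nice k' G
  end.

Lemma nice_loc k F : nice k F -> loc_tame F.
Proof. by case: k => [|k] []. Qed.

Lemma nice_pred k F : nice k.+1 F -> nice k F.
Proof.
elim: k F => [|k IH] F [h1 h2]; split=> // i.
by have [G [h3 h4]] := h2 i; exists G; split=> //; exact: IH.
Qed.

Lemma loc_tame_add F G : loc_tame F -> loc_tame G -> loc_tame (fun om p => F om p + G om p).
Proof.
move=> hF hG Rb; have [q [A hA]] := hF Rb; have [q' [B hB]] := hG Rb.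
exists (maxn q q'), (Rabs A + Rabs B) => om p Dp hp.
apply: Rle_trans (Rabs_triang _ _) _; rewrite Rmult_plus_distr_r.
apply: Rplus_le_compat.
  by apply: bound_weaken (hA om p Dp hp); [exact: leq_maxl|exact: Rle_abs].
by apply: bound_weaken (hB om p Dp hp); [exact: leq_maxr|exact: Rle_abs].
Qed.

Lemma loc_tame_mul F G : loc_tame F -> loc_tame G -> loc_tame (fun om p => F om p * G om p).
Proof.
move=> hF hG Rb; have [q [A hA]] := hF Rb; have [q' [B hB]] := hG Rb.
exists (q + q')%N, (A * B) => om p Dp hp.
rewrite Rabs_mult pow_add (_ : A * B * _ = A * w om ^ q * (B * w om ^ q')); last ring.
by apply: Rmult_le_compat; [exact: Rabs_pos|exact: Rabs_pos|exact: hA|exact: hB].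
Qed.

Lemma nice_add k F G : nice k F -> nice k G -> nice k (fun om p => F om p + G om p).
Proof.
elim: k F G => [|k IH] F G [lF hF] [lG hG]; split=> //; try exact: loc_tame_add.
move=> i; have [F' [h1 h2]] := hF i; have [G' [h3 h4]] := hG i.
exists (fun om p => F' om p + G' om p); split; last exact: IH.
by move=> om; apply: pderiv_add.
Qed.

Lemma nice_mul k F G : nice k F -> nice k G -> nice k (fun om p => F om p * G om p).
Proof.
elim: k F G => [|k IH] F G nF nG; move: (nF) (nG) => [lF hF] [lG hG].
all: split=> //; try exact: loc_tame_mul.
move=> i; have [F' [h1 h2]] := hF i; have [G' [h3 h4]] := hG i.
exists (fun om p => F' om p * G om p + F om p * G' om p); split.
  by move=> om; apply: pderiv_mul.
by apply: nice_add; apply: IH => //; exact: nice_pred.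
Qed.

Lemma nice_const k (a : Om -> R) : tame a -> nice k (fun om _ => a om).
Proof.
elim: k a => [|k IH] a [q [A hA]]; split=> //.
- by move=> Rb; exists q, A => om p _ _.
- by move=> Rb; exists q, A => om p _ _.
- move=> i; exists (fun _ _ => 0); split; first by move=> om; exact: pderiv_const.
  by apply: IH; apply: (tame_bounded 0) => om; rewrite Rabs_R0; lra.
Qed.

Lemma slab_mvt f g i p s : has_pderiv_in D f g i -> D p -> D (upd p i s) ->
  exists c, Rmin (p i) s <= c <= Rmax (p i) s /\ D (upd p i c) /\
    f (upd p i s) - f p = (s - p i) * g (upd p i c).
Proof.
move=> hf Dp Ds.
have conv c : Rmin (p i) s <= c <= Rmax (p i) s -> D (upd p i c).
  rewrite /D /upd in Dp Ds *; case: eqP Ds => [e|//]; rewrite e in Dp.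
  by rewrite /Rmin /Rmax; case: Rle_dec; lra.
have [c [hc e]] := pderiv_mvt D f g i p s conv hf.
by exists c; split=> //; split=> //; exact: conv.
Qed.

Let box Rb (p : I -> R) := forall i, Rabs (p i) <= Rb.

Lemma box_upd Rb p i s c : box Rb p -> Rabs s <= Rb -> Rmin (p i) s <= c <= Rmax (p i) s ->
  box Rb (upd p i c).
Proof.
move=> bp bs hc j; rewrite /upd; case: eqP => // _; have := bp i.
by move: hc; rewrite /Rmin /Rmax; case: Rle_dec; split_Rabs; lra.
Qed.

Definition mix (s : seq I) (p q : I -> R) i := if i \in s then q i else p i.

(** The point [p] is moved to [p'] one coordinate at a time through [mix s p p'], with a mean value
    step along each axis. Every coordinate of an intermediate point comes from [p] or from [p'], so
    these points stay in the slab and in the box. *)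
Lemma family_lipschitz F Rb : nice 1 F -> exists q A, 0 <= A /\ forall om p p' del, D p -> D p' ->
  box Rb p -> box Rb p' -> (forall i, Rabs (p' i - p i) <= del) ->
  Rabs (F om p' - F om p) <= A * del * w om ^ q.
Proof.
move=> [_ hF].
have step (s : seq I) : exists q A, 0 <= A /\ forall om p p' del, D p -> D p' ->
  box Rb p -> box Rb p' -> (forall i, Rabs (p' i - p i) <= del) ->
  Rabs (F om (mix s p p') - F om p) <= A * del * w om ^ q.
  elim: s => [|i s [q [A [A0 hA]]]].
    exists 0%N, 0; split; first lra; move=> om p p' del _ _ _ _ _.
    by rewrite (_ : mix [::] p p' = p) // Rminus_diag Rabs_R0; lra.
  have [G [hG [lG _]]] := hF i.
  have [q' [B hB]] := lG Rb.
  exists (maxn q q'), (A + Rabs B); split; first by have := Rabs_pos B; lra.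
  move=> om p p' del Dp Dp' bp bp' hd.
  have Dm : D (mix s p p') by rewrite /D /mix; case: ifP.
  have bm : box Rb (mix s p p') by move=> j; rewrite /mix; case: ifP.
  have e : mix (i :: s) p p' = upd (mix s p p') i (p' i).
    by apply: functional_extensionality => j; rewrite /mix /upd in_cons; case: eqP => // ->.
  have Dm' : D (mix (i :: s) p p') by rewrite /D /mix; case: ifP.
  rewrite e in Dm' *.
  have [c [hc [Dc ec]]] := slab_mvt _ _ _ _ _ (hG om) Dm Dm'.
  have bc := box_upd _ _ _ _ _ bm (bp' i) hc.
  rewrite (_ : F om (upd (mix s p p') i (p' i)) - F om p =
    (F om (mix s p p') - F om p) + (p' i - mix s p p' i) * G om (upd (mix s p p') i c));
    last by rewrite -ec; ring.
  apply: Rle_trans (Rabs_triang _ _) _.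
  have d0 : 0 <= del := Rle_trans _ _ _ (Rabs_pos _) (hd i).
  have h1 := hA om p p' del Dp Dp' bp bp' hd.
  have h2 := hB om _ Dc bc.
  have h3 : Rabs (p' i - mix s p p' i) <= del.
    by rewrite /mix; case: ifP => // _; rewrite Rminus_diag Rabs_R0.
  rewrite Rabs_mult.
  have u1 := weight_pow_le q (maxn q q') om (leq_maxl _ _).
  have u2 := weight_pow_le q' (maxn q q') om (leq_maxr _ _).
  have u3 := Rle_abs B; have u4 := weight_pow_ge1 q' om; have u5 := weight_pow_ge1 q om.
  set W := w om ^ maxn q q' in u1 u2 *.
  have h2' : Rabs (G om (upd (mix s p p') i c)) <= Rabs B * W.
    by apply: Rle_trans h2 _; have := Rabs_pos B; nra.
  have h4 : A * del * w om ^ q <= A * del * W.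
    by apply: Rmult_le_compat_l => //; exact: Rmult_le_pos.
  have h5 : Rabs (p' i - mix s p p' i) * Rabs (G om (upd (mix s p p') i c)) <= del * (Rabs B * W).
    by apply: Rmult_le_compat => //; exact: Rabs_pos.
  nra.
have [q [A [A0 hA]]] := step (enum I).
exists q, A; split=> // om p p' del Dp Dp' bp bp' hd.
have := hA om p p' del Dp Dp' bp bp' hd.
by rewrite (_ : mix (enum I) p p' = p') //; apply: functional_extensionality => j; rewrite /mix mem_enum.
Qed.

Variable L : (Om -> R) -> R.
Hypothesis HL : tame_functional L.

Lemma tf_sub (F G : Om -> R) : tame F -> tame G -> L (fun om => F om - G om) = L F - L G.
Proof.
move=> tF tG; have := HL.1 F G (-1) tF tG.
rewrite (_ : (fun om => F om + -1 * G om) = (fun om => F om - G om)) => [->|]; first ring.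
by apply: functional_extensionality => om; ring.
Qed.

Lemma tf_scal (F : Om -> R) c : tame F -> L (fun om => c * F om) = c * L F.
Proof.
move=> tF.
have tZ : tame (fun=> 0) by apply: (tame_bounded 0) => om; rewrite Rabs_R0; lra.
have z : L (fun=> 0) = 0.
  have := HL.1 _ _ 1 tZ tZ; rewrite (_ : (fun om : Om => 0 + 1 * 0) = (fun=> 0)); first lra.
  by apply: functional_extensionality => om; ring.
have := HL.1 _ F c tZ tF; rewrite z (_ : (fun om => 0 + c * F om) = (fun om => c * F om)); first by move=> ->; ring.
by apply: functional_extensionality => om; ring.
Qed.

Lemma loc_tame_at F p : loc_tame F -> D p -> tame (fun om => F om p).
Proof.
move=> hF Dp.
have [Rb [_ hR]] := coords_bounded p.
by have [q [A h]] := hF Rb; exists q, A => om; apply: h.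
Qed.

Lemma superpose_cont F : nice 1 F -> cont_in D (fun p => L (fun om => F om p)).
Proof.
move=> hF p Dp eps e0.
have [Rb hR] := coords_bounded p.
have [q [A [A0 hA]]] := family_lipschitz F (Rb + 1) hF.
have [C [C0 hC]] := HL.2 q.
have CA : 0 <= C * A by exact: Rmult_le_pos.
have d0 : 0 < Rmin 1 (eps / (C * A + 1)).
  by apply: Rmin_pos; [lra|apply: Rdiv_lt_0_compat => //; lra].
exists (Rmin 1 (eps / (C * A + 1))); split=> // p' Dp' hd.
set d := Rmin _ _ in d0 hd.
have d1 : d <= 1 := Rmin_l _ _.
have d2 : d * (C * A + 1) <= eps.
  have h : d <= eps / (C * A + 1) := Rmin_r _ _.
  have := Rmult_le_compat_r (C * A + 1) _ _ _ h.
  by rewrite /Rdiv Rmult_assoc Rinv_l; lra.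
rewrite -tf_sub; try by apply: loc_tame_at => //; exact: nice_loc hF.
have := hC (fun om => F om p' - F om p) (A * d).
have X : forall om, Rabs (F om p' - F om p) <= A * d * w om ^ q.
  move=> om; apply: hA => //.
  - by move=> i; have := hR.2 i; lra.
  - by move=> i; have := hR.2 i; have := hd i; split_Rabs; lra.
  - by move=> i; apply: Rlt_le.
move=> /(_ X); nra.
Qed.

(** The second derivative [H] controls the Taylor remainder: the increment of [F] minus [h * G] is
    [O(h^2)] times a power of the weight, uniformly in [om]. Applying [L] and dividing by [h] leaves
    [O(h)]. *)
Lemma superpose_pderiv F G H i : loc_tame F -> loc_tame G -> loc_tame H ->
  (forall om, has_pderiv_in D (F om) (G om) i) -> (forall om, has_pderiv_in D (G om) (H om) i) ->
  has_pderiv_in D (fun p => L (fun om => F om p)) (fun p => L (fun om => G om p)) i.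
Proof.
move=> lF lG lH FG GH p Dp eps e0.
have [Rb [_ hR]] := coords_bounded p.
have [q [A0 hA0]] := lH (Rb + 1).
pose A := Rabs A0.
have A1 : 0 <= A := Rabs_pos _.
have hA om p' : D p' -> box (Rb + 1) p' -> Rabs (H om p') <= A * w om ^ q.
  move=> Dp' bp'; apply: Rle_trans (hA0 om p' Dp' bp') _.
  by apply: Rmult_le_compat_r; [have := weight_pow_ge1 q om; lra|exact: Rle_abs].
have [C [C0 hC]] := HL.2 q.
have CA : 0 <= C * A by exact: Rmult_le_pos.
have d0 : 0 < Rmin 1 (eps / (C * A + 1)).
  by apply: Rmin_pos; [lra|apply: Rdiv_lt_0_compat => //; lra].
exists (Rmin 1 (eps / (C * A + 1))); split=> // s [[Ds ne]]; rewrite /= /Rdist => hs.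
have s1 : Rabs (s - p i) < 1 := Rlt_le_trans _ _ _ hs (Rmin_l _ _).
have s2 : Rabs (s - p i) * (C * A + 1) < eps.
  have h : Rabs (s - p i) < eps / (C * A + 1) := Rlt_le_trans _ _ _ hs (Rmin_r _ _).
  have P : 0 < C * A + 1 by lra.
  have := Rmult_lt_compat_r (C * A + 1) _ _ P h.
  by rewrite /Rdiv Rmult_assoc Rinv_l; lra.
set h := s - p i in s1 s2 *.
have h0 : h <> 0 by rewrite /h; lra.
pose Q om := F om (upd p i s) - F om p - h * G om p.
have bb c : Rmin (p i) s <= c <= Rmax (p i) s -> box (Rb + 1) (upd p i c).
  apply: box_upd; first by move=> j; have := hR j; lra.
  by have := hR i; rewrite /h in s1; split_Rabs; lra.
have hQ om : Rabs (Q om) <= A * (h * h) * w om ^ q.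
  have [c [hc [Dc ec]]] := slab_mvt _ _ _ _ _ (FG om) Dp Ds.
  have [c' [hc' [Dc' ec']]] := slab_mvt _ _ _ _ _ (GH om) Dp Dc.
  have -> : Q om = h * ((c - p i) * H om (upd p i c')) by rewrite -ec' /Q ec /h; ring.
  have b' : box (Rb + 1) (upd p i c').
    apply: bb; move: hc hc'; rewrite /Rmin /Rmax.
    by do 2 case: Rle_dec; lra.
  have := hA om _ Dc' b'; set Z := H om _ => hZ.
  have hcp : Rabs (c - p i) <= Rabs h.
    by move: hc; rewrite /h /Rmin /Rmax; case: Rle_dec; split_Rabs; lra.
  rewrite !Rabs_mult.
  have e1 : h * h = Rabs h * Rabs h by rewrite -Rabs_mult Rabs_right //; apply: Rle_ge; exact: Rle_0_sqr.
  rewrite e1 (_ : A * _ * _ = Rabs h * (Rabs h * (A * w om ^ q))); last ring.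
  apply: Rmult_le_compat_l; first exact: Rabs_pos.
  by apply: Rmult_le_compat => //; exact: Rabs_pos.
have LQ := hC Q _ hQ.
have eQ : L Q = L (fun om => F om (upd p i s)) - L (fun om => F om p) - h * L (fun om => G om p).
  have tA : tame (fun om => F om (upd p i s)) by exact: loc_tame_at.
  have tB : tame (fun om => F om p) by exact: loc_tame_at.
  have tC : tame (fun om => G om p) by exact: loc_tame_at.
  have tH : tame (fun om => h * G om p).
    apply: tame_mul => //; apply: (tame_bounded (Rabs h)) => om; lra.
  rewrite /Q tf_sub //; first by rewrite tf_sub // tf_scal.
  have tM : tame (fun=> -1) by apply: (tame_bounded 1) => om; rewrite Rabs_Ropp Rabs_R1; lra.
  have [q1 [A2 hA2]] := tame_add _ _ tA (tame_mul _ _ tM tB).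
  by exists q1, A2 => om; have := hA2 om; rewrite (_ : _ + -1 * _ = F om (upd p i s) - F om p) //; ring.
rewrite eQ in LQ.
rewrite (_ : _ / h - _ = (L (fun om => F om (upd p i s)) - L (fun om => F om p) - h * L (fun om => G om p)) / h);
  last by field.
rewrite Rabs_div //.
have hp : 0 < Rabs h := Rabs_pos_lt _ h0.
apply: (Rmult_lt_reg_r (Rabs h)) => //.
rewrite /Rdiv Rmult_assoc Rinv_l ?Rmult_1_r; last lra.
apply: Rle_lt_trans LQ _.
have e1 : h * h = Rabs h * Rabs h by rewrite -Rabs_mult Rabs_right //; apply: Rle_ge; exact: Rle_0_sqr.
rewrite e1; nra.
Qed.

(** The induction keeps two orders in hand because [superpose_pderiv] asks at each step for a second
    derivative of the current family. *)
Lemma superpose_Ck k F : nice k.+2 F -> Ck_in D k (fun p => L (fun om => F om p)).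
Proof.
elim: k F => [|k IH] F hF.
  by apply: superpose_cont; exact: nice_pred.
split; first by apply: superpose_cont; do 2 apply: nice_pred; elim: k hF {IH} => // k IH h; apply: IH; exact: nice_pred.
move=> i; have [lF /(_ i) [G [FG nG]]] := hF.
exists (fun p => L (fun om => G om p)); split; last exact: IH.
have [lG /(_ i) [H [GH nH]]] := nG.
exact: (superpose_pderiv _ _ _ _ lF lG nH.1 FG GH).
Qed.

End Families.
End Superposition.

Arguments tame {Om} w F.
Arguments tame_functional {Om} w L.
Arguments loc_tame {Om} w {I} i0 t0 T F.
Arguments nice {Om} w {I} i0 t0 T k F.

(** * Discrete Fourier representation of test functions *)

HB.instance Definition _ := Monoid.isComLaw.Build R 0 Rplus
  (fun x y z => esym (Rplus_assoc x y z)) Rplus_comm Rplus_0_l.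
HB.instance Definition _ := Monoid.isComLaw.Build R 1 Rmult
  (fun x y z => esym (Rmult_assoc x y z)) Rmult_comm Rmult_1_l.
HB.instance Definition _ := Monoid.isMulLaw.Build R 0 Rmult Rmult_0_l Rmult_0_r.
HB.instance Definition _ := Monoid.isAddLaw.Build R Rmult Rplus
  (fun x y z => Rmult_plus_distr_r x y z) Rmult_plus_distr_l.

Notation "\rsum_ ( i : t ) F" := (\big[Rplus/0]_(i : t) F)
  (at level 41, F at level 41, i at level 50).

Lemma rsum_scal (J : finType) c (F : J -> R) : \rsum_(j : J) (c * F j) = c * \rsum_(j : J) F j.
Proof. by rewrite big_distrr. Qed.

Lemma rsum_le (J : finType) (F G : J -> R) : (forall j, F j <= G j) ->
  \rsum_(j : J) F j <= \rsum_(j : J) G j.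
Proof. by move=> h; elim/big_ind2: _ => // *; lra. Qed.

Lemma rsum_abs (J : finType) (F : J -> R) : Rabs (\rsum_(j : J) F j) <= \rsum_(j : J) Rabs (F j).
Proof.
elim/big_rec2: _ => [|j y x _ h]; first by rewrite Rabs_R0; lra.
by apply: Rle_trans (Rabs_triang _ _) _; lra.
Qed.

Lemma rsum_const (J : finType) c : \rsum_(j : J) c = INR #|J| * c.
Proof.
rewrite big_const; elim: #|J| => [|m IH]; first by rewrite /=; ring.
by rewrite iterS IH S_INR; ring.
Qed.

Lemma rprod_pos (J : finType) (F : J -> R) : (forall j, 0 < F j) -> 0 < \big[Rmult/1]_(j : J) F j.
Proof. by move=> h; elim/big_ind: _ => [|*|//]; [lra|exact: Rmult_lt_0_compat]. Qed.

Lemma rprod_le (J : finType) (F G : J -> R) : (forall j, 0 <= F j <= G j) ->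
  \big[Rmult/1]_(j : J) F j <= \big[Rmult/1]_(j : J) G j.
Proof.
move=> h; suff : 0 <= \big[Rmult/1]_(j : J) F j <= \big[Rmult/1]_(j : J) G j by lra.
elim/big_ind2: _ => [|a b c d|j _]; [lra| |exact: h].
by move=> h1 h2; split; [apply: Rmult_le_pos; lra|apply: Rmult_le_compat; lra].
Qed.

Lemma rprod_const (n : nat) c : \big[Rmult/1]_(i < n) c = c ^ n.
Proof.
rewrite big_const card_ord; elim: n => [|m IH] //=.
by rewrite -IH.
Qed.

Lemma rsum_ffun_prod (n M : nat) (g : 'I_M -> R) :
  \rsum_(j : {ffun 'I_n -> 'I_M}) \big[Rmult/1]_(i < n) g (j i) = (\rsum_(v : 'I_M) g v) ^ n.
Proof. by rewrite -rprod_const bigA_distr_bigA. Qed.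

(** Real Fourier modes: the boolean is part of the index of a mode, and differentiation flips it. *)
Definition trig (b : bool) (x : R) := if b then cos x else sin x.

Lemma trig_bound b x : Rabs (trig b x) <= 1.
Proof. by apply: Rabs_le; case: b; [exact: COS_bound|exact: SIN_bound]. Qed.

Lemma trig_period b x (k : Z) : trig b (x + 2 * PI * IZR k) = trig b x.
Proof.
have pos (y : R) (m : nat) : trig b (y + 2 * INR m * PI) = trig b y.
  by case: b => /=; [exact: cos_period|exact: sin_period].
case: (Z_le_dec 0 k) => hk.
  rewrite -(pos x (Z.to_nat k)) INR_IZR_INZ Z2Nat.id //.
  by congr trig; ring.
rewrite -(pos (x + 2 * PI * IZR k) (Z.to_nat (- k))) INR_IZR_INZ Z2Nat.id; last lia.
by rewrite opp_IZR; congr trig; ring.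
Qed.

(** [1 - cos] is twice the squared sine of half the angle, and a zero of that sine would make [d] a
    multiple of [M]. *)
Lemma cos_ne1 (d M : Z) : (0 < Z.abs d < M)%Z -> cos (2 * PI * IZR d / IZR M) <> 1.
Proof.
move=> hd e1.
have M1 : (0 < M)%Z by lia.
have M0 : 0 < IZR M by exact: IZR_lt.
have e2 : sin (PI * IZR d / IZR M) = 0.
  have := cos_2a_sin (PI * IZR d / IZR M).
  rewrite (_ : 2 * (PI * IZR d / IZR M) = 2 * PI * IZR d / IZR M) ?e1; last by field; lra.
  by nra.
have [k hk] := sin_eq_0_0 _ e2.
have : IZR d = IZR k * IZR M.
  apply: (Rmult_eq_reg_l (PI / IZR M)).
    have -> : PI / IZR M * IZR d = PI * IZR d / IZR M by field; lra.
    by rewrite hk; field; lra.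
  by apply: Rgt_not_eq; apply: Rdiv_lt_0_compat => //; exact: PI_RGT_0.
rewrite -mult_IZR => /eq_IZR e3.
move: hd; rewrite e3 Z.abs_mul (Z.abs_eq M); last lia.
case: (Z.eq_dec k 0) => [->|kn] [h1 h2]; first by rewrite Z.mul_0_l in h1; lia.
have := Z.mul_le_mono_nonneg_r 1 (Z.abs k) M; lia.
Qed.

Section Grid.
Variable n : nat.
Implicit Types x xi : 'I_n -> R.

Definition dot xi x := sumR (fun i => xi i * x i).

Variable M : nat.
Hypothesis M0 : (0 < M)%N.
Let J : Type := {ffun 'I_n -> 'I_M}.

(** The grid is treated as a discrete torus, so that translation by one mesh permutes the indices;
    [node_cshift] records what the wrap-around does to the nodes. *)
Definition cshift (i : 'I_n) (j : J) : J := [ffun k => if k == i then ordS (j k) else j k].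

Lemma cshift_inj i : injective (cshift i).
Proof.
move=> j j' /ffunP h; apply/ffunP => k.
by have := h k; rewrite !ffunE; case: eqP => // _; exact: ordS_inj.
Qed.

Lemma rsum_cshift i (G : J -> R) : \rsum_(j : J) G (cshift i j) = \rsum_(j : J) G j.
Proof.
rewrite [RHS](reindex (cshift i)) //.
by apply: onW_bij; apply: injF_bij; exact: cshift_inj.
Qed.

Definition node (c q : R) (j : J) : 'I_n -> R := fun i => c * (INR (j i) - q).

Lemma node_cshift c q i j :
  node c q (cshift i j) = upd (node c q j) i
    (if ((j i).+1 < M)%N then node c q j i + c else c * - q).
Proof.
apply: functional_extensionality => k; rewrite /node /upd ffunE; case: eqP => // ->.
rewrite /= ; case: ltnP => h.
  by rewrite modn_small // S_INR; ring.
have -> : (j i).+1 = M by have := ltn_ord (j i); lia.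
by rewrite modnn /=; ring.
Qed.

Lemma dot_upd xi x i s : dot (upd xi i s) x = dot xi x + (s - xi i) * x i.
Proof.
rewrite /dot /sumR (bigD1 i) //= [in RHS](bigD1 i) //= upd_same.
rewrite (eq_bigr (fun k => xi k * x k)); first ring.
by move=> k ki; rewrite upd_other.
Qed.

Lemma dotC xi x : dot xi x = dot x xi.
Proof. by apply: eq_bigr => i _; ring. Qed.

Lemma dot_sub xi x y : dot xi (fun i => x i - y i) = dot xi x - dot xi y.
Proof.
rewrite /dot /sumR (_ : _ - _ = \rsum_(i : 'I_n) (xi i * x i) + -1 * \rsum_(i : 'I_n) (xi i * y i)); last by ring.
by rewrite -rsum_scal -big_split; apply: eq_bigr => i _ /=; ring.
Qed.

End Grid.

(** The permutation [s] turns every summand by the angle [a] without changing the total, so the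
    vector of the cosine and sine sums is fixed by a rotation other than the identity. The
    determinant of the resulting system is [(1 - cos a)^2 + sin a ^2]. *)
Lemma character_sum0 (J : finType) (phi : J -> R) (s : J -> J) (a : R) : injective s ->
  (forall b j, trig b (phi (s j)) = trig b (phi j + a)) -> cos a <> 1 ->
  forall b, \rsum_(j : J) trig b (phi j) = 0.
Proof.
move=> sI hs ca.
have sh b : \rsum_(j : J) trig b (phi j + a) = \rsum_(j : J) trig b (phi j).
  rewrite [RHS](reindex s) /=; last exact: onW_bij (injF_bij sI).
  by apply: eq_bigr => j _; rewrite hs.
set C := \rsum_(j : J) trig true (phi j); set S := \rsum_(j : J) trig false (phi j).
have eC : C = cos a * C + - sin a * S.
  rewrite -[LHS](sh true) -!rsum_scal -big_split; apply: eq_bigr => j _ /=.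
  by rewrite cos_plus; ring.
have eS : S = cos a * S + sin a * C.
  rewrite -[LHS](sh false) -!rsum_scal -big_split; apply: eq_bigr => j _ /=.
  by rewrite sin_plus; ring.
have d0 : (1 - cos a) ^ 2 + sin a ^ 2 <> 0.
  have h : 0 < (1 - cos a) ^ 2 by apply: pow2_gt_0; lra.
  by have := pow2_ge_0 (sin a); lra.
case; apply: (Rmult_eq_reg_l ((1 - cos a) ^ 2 + sin a ^ 2)) => //; rewrite Rmult_0_r.
- rewrite -/C (_ : _ * C = (1 - cos a) * (C - cos a * C) + sin a * (sin a * C)); last ring.
  rewrite (_ : C - cos a * C = - sin a * S); last lra.
  by rewrite (_ : sin a * C = S - cos a * S); [ring|lra].
- rewrite -/S (_ : _ * S = (1 - cos a) * (S - cos a * S) + sin a * (sin a * S)); last ring.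
  rewrite (_ : S - cos a * S = sin a * C); last lra.
  by rewrite (_ : sin a * S = cos a * C - C); [ring|lra].
Qed.

Lemma circle_sum0 (M : nat) (k : nat) b : (0 < k < M)%N ->
  \rsum_(l : 'I_M) trig b (INR k * (2 * PI * INR l / INR M)) = 0.
Proof.
move=> hk; have M0 : 0 < INR M by apply: lt_0_INR; lia.
apply: (character_sum0 _ _ (@ordS M) (2 * PI * INR k / INR M)); first exact: ordS_inj.
- move=> {}b j; case: (ltnP j.+1 M) => h /=.
    by rewrite modn_small // S_INR; congr trig; field; lra.
  have e : j.+1 = M by have := ltn_ord j; lia.
  rewrite e modnn -(trig_period _ _ (Z.of_nat k)) -INR_IZR_INZ; congr trig.
  have eR : INR M = INR j + 1 by rewrite -S_INR e.
  by have := pos_INR j; rewrite eR /= => j0; field; lra.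
- rewrite !INR_IZR_INZ; apply: cos_ne1; lia.
Qed.

Section DFT.
Variables n K : nat.
Hypothesis K0 : (0 < K)%N.
Let M := (2 * (K * K))%N.
Let q := INR (K * K).
Let J : Type := {ffun 'I_n -> 'I_M}.
(** Space mesh [1 / K] and frequency mesh [PI / K], with [2 K^2] points per axis centred by
    [q = K^2]: the cubes are [[-K, K)] and [[- PI K, PI K)]. The product of the meshes is
    [2 PI / M], as a discrete Fourier transform on [M] points requires. *)
Definition xnode : J -> 'I_n -> R := node n M (/ INR K) q.
Definition xinode : J -> 'I_n -> R := node n M (PI / INR K) q.

Let KR : 0 < INR K.
Proof. by apply: lt_0_INR; lia. Qed.

Lemma dft_orthogonal (d : 'I_n -> Z) : (forall i, (Z.abs (d i) < Z.of_nat M)%Z) ->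
  \rsum_(l : J) cos (dot n (xinode l) (fun i => IZR (d i) / INR K)) =
  if [forall i, Z.eqb (d i) 0] then INR M ^ n else 0.
Proof.
move=> hd; case: ifPn => [/forallP z|].
  rewrite (eq_bigr (fun=> 1)).
    by rewrite rsum_const card_ffun !card_ord Rmult_1_r; elim: n => // m IH; rewrite expnS -multE mult_INR IH.
  move=> l _; rewrite -cos_0; congr cos; rewrite /dot /sumR big1 // => i _.
  by rewrite (proj1 (Z.eqb_eq _ _) (z i)); field; lra.
rewrite negb_forall => /existsP [i di].
have {}di : d i <> 0%Z by move=> e; rewrite e in di.
have qE : INR M = 2 * (INR K * INR K) by rewrite /M -multE !mult_INR.
apply: (character_sum0 _ (fun l => dot n (xinode l) (fun i => IZR (d i) / INR K)) (cshift n M i)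
  (2 * PI * IZR (d i) / IZR (Z.of_nat M)) _ _ _ true).
- exact: cshift_inj.
- move=> b l; rewrite /xinode node_cshift; last by rewrite /M !muln_gt0 K0.
  rewrite dot_upd -INR_IZR_INZ qE.
  case: ltnP => h.
    by congr trig; field; lra.
  (* Where the index wraps, the phase jumps in addition by [d i] full turns. *)
  rewrite -[RHS](trig_period _ _ (- d i)) opp_IZR; congr trig.
  have e : (l i).+1 = M by apply/eqP; rewrite eqn_leq h andbT; exact: ltn_ord.
  have el : INR (l i) = 2 * (INR K * INR K) - 1 by rewrite -qE; have := S_INR (l i); rewrite e; lra.
  by rewrite /node el /q -multE mult_INR; field; lra.
- apply: cos_ne1; split; [exact/Z.abs_pos|exact: hd].
Qed.
End DFT.

(** For [y = x / 2] in [[0, 2]] the Taylor bound gives [sin y >= y - y^3 / 6 >= y / 3]; with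
    [1 - cos x = 2 sin^2 y] the constant 9 results. *)
Lemma chord_lower x : Rabs x <= PI -> x ^ 2 <= 9 * (2 * (1 - cos x)).
Proof.
have pos y : 0 <= y <= PI -> y ^ 2 <= 9 * (2 * (1 - cos y)).
  move=> [y0 yP].
  have h : y / 2 / 3 <= sin (y / 2).
    have P4 := PI_4; have P0 := PI_RGT_0.
    have [h _] := sin_bound (y / 2) 0 ltac:(lra) ltac:(lra).
    apply: Rle_trans h; rewrite /sin_approx /sum_f_R0 /sin_term /=.
    set z := y / 2; have z0 : 0 <= z <= 2 by rewrite /z; lra.
    rewrite [X in _ <= X](_ : _ = z - z * (z * z) / 6); last by field.
    have : z * z <= 4 by nra.
    nra.
  have c := cos_2a_sin (y / 2); rewrite (_ : 2 * (y / 2) = y) in c; last field.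
  rewrite c; nra.
move=> hx; case: (Rle_dec 0 x) => x0.
  by apply: pos; split_Rabs; lra.
rewrite -cos_neg (_ : x ^ 2 = (- x) ^ 2); last ring.
by apply: pos; split_Rabs; lra.
Qed.

(** Comparison with an integral: [1 + u^2] grows at most by the factor 3 over a distance 1, so a
    term is at most [3 K] times an increment of the arctangent. The telescoping sum is at most
    [3 K PI <= 12 K], for any number of terms and any centre. *)
Lemma lorentz_sum (K m : nat) (q : R) : (0 < K)%N ->
  \rsum_(v : 'I_m) / (1 + ((INR v - q) / INR K) ^ 2) <= 12 * INR K.
Proof.
move=> K0; have KR : 1 <= INR K by rewrite -[1]/(INR 1); apply: le_INR; lia.
pose H (x : R) := atan ((x - q) / INR K).
have step x : / (1 + ((x - q) / INR K) ^ 2) <= 3 * INR K * (H (x + 1) - H x).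
  have dH y : is_derive H y (/ INR K * / (1 + ((y - q) / INR K) ^ 2)).
    rewrite /H; auto_derive => //.
    by rewrite Rmult_1_l.
  have [c [hc e]] : exists c, x <= c <= x + 1 /\ H (x + 1) - H x = / INR K * / (1 + ((c - q) / INR K) ^ 2).
    have [|c [hc e]] := MVT_gen H x (x + 1) _ (fun y _ => dH y).
    - move=> c0 _; apply: derivable_continuous_pt.
      by exists (/ INR K * / (1 + ((c0 - q) / INR K) ^ 2)); apply/is_derive_Reals.
    - by exists c; move: hc e; rewrite Rmin_left ?Rmax_right; lra.
  rewrite e.
  set u := (x - q) / INR K; set v := (c - q) / INR K.
  have uv : Rabs (v - u) <= 1.
    rewrite /u /v (_ : _ - _ = (c - x) / INR K); last by field; lra.
    rewrite Rabs_pos_eq; last by apply: Rdiv_le_0_compat; lra.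
    by apply: (Rmult_le_reg_r (INR K)); [lra|rewrite /Rdiv Rmult_assoc Rinv_l; lra].
  have hv : 1 + v ^ 2 <= 3 * (1 + u ^ 2) by have := pow_maj_Rabs _ _ 2 uv; have := pow2_ge_0 (v - 2 * u); clearbody u v; nra.
  have U : 0 < 1 + u ^ 2 by have := pow2_ge_0 u; lra.
  have V : 0 < 1 + v ^ 2 by have := pow2_ge_0 v; lra.
  move: (1 + u ^ 2) (1 + v ^ 2) U V hv => X Y U V hv.
  rewrite (_ : 3 * INR K * _ = 3 * / Y); last by field; lra.
  apply: (Rmult_le_reg_r X) => //; rewrite Rinv_l; last lra.
  apply: (Rmult_le_reg_r Y) => //.
  by rewrite (_ : 3 * / Y * X * Y = 3 * X) ?Rmult_1_l //; field; lra.
have tele : \rsum_(v : 'I_m) / (1 + ((INR v - q) / INR K) ^ 2) <= 3 * INR K * (H (INR m) - H 0).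
  elim: m => [|m IH]; first by rewrite big_ord0 /=; lra.
  rewrite big_ord_recr S_INR.
  by have /= := step (INR m); move: IH => /=; lra.
apply: Rle_trans tele _.
have [a1 a2] := atan_bound ((INR m - q) / INR K); have [b1 b2] := atan_bound ((0 - q) / INR K).
have := PI_4; rewrite /H; nra.
Qed.

(** * Smooth functions of compact support *)

Lemma pderiv_unique {I : eqType} (f g g' : (I -> R) -> R) i :
  has_pderiv_in (fun=> True) f g i -> has_pderiv_in (fun=> True) f g' i -> g = g'.
Proof.
move=> h h'; apply: functional_extensionality => p.
apply: (single_limit _ _ _ _ _ _ (h p Logic.I) (h' p Logic.I)).
move=> a a0; exists (p i + a / 2); split; first by split=> //; lra.
by rewrite /= /Rdist (_ : p i + a / 2 - p i = a / 2) ?Rabs_pos_eq; lra.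
Qed.

Lemma pderiv_outside {n : nat} (f g : ('I_n -> R) -> R) i B :
  has_pderiv_in (fun=> True) f g i ->
  (forall x, (exists i, B < Rabs (x i)) -> f x = 0) ->
  forall x, (exists i, B < Rabs (x i)) -> g x = 0.
Proof.
move=> h h0 x [j hj].
apply: cond_eq => eps e0; rewrite -/(Rdist (g x) 0) Rdist_sym.
have [d [d0 hd]] := h x Logic.I eps e0.
pose a := Rmin (d / 2) ((Rabs (x j) - B) / 2).
have a0 : 0 < a by apply: Rmin_pos; lra.
have a1 : a <= d / 2 := Rmin_l _ _.
have a2 : a <= (Rabs (x j) - B) / 2 := Rmin_r _ _.
have := hd (x i + a); rewrite /= (h0 x); last by exists j.
rewrite h0 ?Rminus_diag /Rdiv ?Rmult_0_l.
  apply; split; first by split=> //; lra.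
  by rewrite /Rdist (_ : x i + a - x i = a) ?Rabs_pos_eq; lra.
by exists j; rewrite /upd; case: eqP => [<-|//]; split_Rabs; lra.
Qed.

(** [Cinf_in] supplies a derivative for each order [k] separately; uniqueness identifies them, so
    that a single [g] is smooth to all orders. *)
Lemma smooth_compact_pderiv {n : nat} (f : ('I_n -> R) -> R) i : smooth_compact f ->
  exists g, has_pderiv_in (fun=> True) f g i /\ smooth_compact g.
Proof.
move=> [fs [B hB]].
have [_ /(_ i) [g [fg _]]] := fs 1%N.
exists g; split=> //; split; last by exists B; exact: pderiv_outside fg hB.
move=> k; have [_ /(_ i) [g' [fg' ck]]] := fs k.+1.
by rewrite (pderiv_unique _ _ _ _ fg fg').
Qed.

(** Compactness through the ultrafilter: points [x m] with [m < |f (x m)|] stay in a cube, hence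
    have a coordinatewise ultralimit [y], and continuity at [y] bounds [f] at points [x m] with [m]
    large. *)
Lemma smooth_compact_bounded {n : nat} (f : ('I_n -> R) -> R) : smooth_compact f ->
  exists C, 0 <= C /\ forall x, Rabs (f x) <= C.
Proof.
move=> [fs [B hB]].
suff [C hC] : exists C, forall x, Rabs (f x) <= C.
  by exists C; split=> //; apply: Rle_trans (hC (fun=> 0)); exact: Rabs_pos.
apply: NNPP => H.
have [U [UI US U0 UC Um]] := ultrafilter_nat.
have ex (m : nat) : exists x, INR m < Rabs (f x).
  apply: NNPP => h; apply: H; exists (INR m) => x; apply: Rnot_lt_le => lt; apply: h; by exists x.
have [x hx] : exists x : nat -> 'I_n -> R, forall m, INR m < Rabs (f (x m)).
  exists (fun m => proj1_sig (constructive_indefinite_description _ (ex m))) => m.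
  exact: (proj2_sig (constructive_indefinite_description _ (ex m))).
have xB m i : Rabs (x m i) <= B.
  apply: Rnot_lt_le => lt; have := hx m; rewrite hB ?Rabs_R0; last by exists i.
  by have := pos_INR m; lra.
have [y hy] : exists y : 'I_n -> R, forall i eps, 0 < eps -> U (fun m => Rabs (x m i - y i) < eps).
  have e i := ultralimit_ex U UI US U0 UC Um (fun m => x m i) B 0%N (fun m _ => xB m i).
  exists (fun i => proj1_sig (constructive_indefinite_description _ (e i))) => i.
  exact: (proj2_sig (constructive_indefinite_description _ (e i))).
have [d [d0 hd]] := fs 0%N y Logic.I 1 Rlt_0_1.
have near : U (fun m => forall i, Rabs (x m i - y i) < d).
  have h (s : seq 'I_n) : U (fun m => forall i, i \in s -> Rabs (x m i - y i) < d).
    elim: s => [|j s IH]; first by apply: US (Um 0%N).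
    apply: US (UI _ _ IH (hy j d d0)) => m [h1 h2] i.
    by rewrite in_cons => /orP [/eqP -> //|]; exact: h1.
  by apply: US (h (enum 'I_n)) => m h1 i; apply: h1; rewrite mem_enum.
apply: U0; have [m0 hm0] := nfloor_ex (Rabs (f y) + 1) ltac:(have := Rabs_pos (f y); lra).
apply: US (UI _ _ near (Um m0.+1)) => m [h1 h2].
have := hd (x m) Logic.I h1; have := hx m.
have : INR m0.+1 <= INR m by apply: le_INR; lia.
rewrite S_INR; split_Rabs; lra.
Qed.

(** * Second differences *)

Section Differences.
Variables (n K : nat).
Hypothesis K0 : (0 < K)%N.
Implicit Types f g : ('I_n -> R) -> R.

Let KR : 1 <= INR K.
Proof. by rewrite -[1]/(INR 1); apply: le_INR; lia. Qed.

Definition translate i a f x := f (upd x i (x i + a)).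

(* A difference version of 1 - d^2/dx_i^2: it multiplies the discrete Fourier coefficients by [1 + sig], and
   iterating it gives their decay. *)
Definition dop i f x := f x - INR K ^ 2 * (translate i (/ INR K) f x + translate i (- / INR K) f x - 2 * f x).

Definition dops (s : seq 'I_n) f := foldr dop f s.

Lemma translate_pderiv i j a f g : has_pderiv_in (fun=> True) f g i ->
  has_pderiv_in (fun=> True) (translate j a f) (translate j a g) i.
Proof.
move=> h p _ eps e0; rewrite /translate.
have [d [d0 hd]] := h (upd p j (p j + a)) Logic.I eps e0.
exists d; split=> // s [[_ ne]]; rewrite /= /Rdist => hs.
case: (altP (i =P j)) => [e|ij].
- rewrite -e in hd *; rewrite upd_same upd_upd.
  have := hd (s + a); rewrite upd_upd upd_same /= /Rdist.
  rewrite (_ : s + a - (p i + a) = s - p i); last ring.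
  by apply; split=> //; split=> //; lra.
- have := hd s; rewrite (upd_other p) // /= /Rdist.
  rewrite (upd_other p); last by rewrite eq_sym.
  rewrite (_ : upd (upd p j (p j + a)) i s = upd (upd p i s) j (p j + a)); last first.
    apply: functional_extensionality => k; rewrite /upd.
    by case: (altP (k =P i)) => // ->; rewrite (negbTE ij).
  by apply.
Qed.

Lemma dops_pderiv s i f g : has_pderiv_in (fun=> True) f g i ->
  has_pderiv_in (fun=> True) (dops s f) (dops s g) i.
Proof.
elim: s => [//|j s IH] /= /IH; set F := dops s f; set G := dops s g => h.
have c a := pderiv_const (fun=> True) a i.
have t a := translate_pderiv i j a F G h.
have := pderiv_add _ _ _ _ _ _ h (pderiv_mul _ _ _ _ _ _ (c (- INR K ^ 2))
  (pderiv_add _ _ _ _ _ _ (pderiv_add _ _ _ _ _ _ (t (/ INR K)) (t (- / INR K)))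
     (pderiv_mul _ _ _ _ _ _ (c (-2)) h))).
have -> : (fun p : 'I_n -> R => F p + - INR K ^ 2 * (translate j (/ INR K) F p + translate j (- / INR K) F p + -2 * F p)) = dop j F.
  by apply: functional_extensionality => p; rewrite /dop; ring.
move=> H; rewrite (_ : dop j G = (fun p : 'I_n -> R => G p + (0 * (translate j (/ INR K) F p + translate j (- / INR K) F p + -2 * F p) +
  - INR K ^ 2 * (translate j (/ INR K) G p + translate j (- / INR K) G p + (0 * F p + -2 * G p))))) //.
by apply: functional_extensionality => p; rewrite /dop; ring.
Qed.

Lemma second_difference i a f g h C x : 0 <= a ->
  has_pderiv_in (fun=> True) f g i -> has_pderiv_in (fun=> True) g h i ->
  (forall x, Rabs (h x) <= C) ->
  Rabs (translate i a f x + translate i (- a) f x - 2 * f x) <= 2 * C * a ^ 2.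
Proof.
move=> a0 fg gh hC; rewrite /translate.
have [c1 [h1 e1]] := pderiv_mvt _ _ _ _ x (x i + a) (fun _ _ => Logic.I) fg.
have [c2 [h2 e2]] := pderiv_mvt _ _ _ _ x (x i + - a) (fun _ _ => Logic.I) fg.
have [c3 [h3 e3]] := pderiv_mvt _ _ _ _ (upd x i c2) c1 (fun _ _ => Logic.I) gh.
rewrite !upd_upd upd_same in e3.
rewrite (_ : _ + _ - _ = a * ((c1 - c2) * h (upd x i c3))); last first.
  by rewrite -e3 Rmult_minus_distr_l; move: e1 e2; lra.
rewrite !Rabs_mult (Rabs_pos_eq a) //.
have h4 : Rabs (c1 - c2) <= 2 * a.
  by move: h1 h2; rewrite /Rmin /Rmax; do 2 case: Rle_dec; split_Rabs; lra.
rewrite (_ : 2 * C * a ^ 2 = a * (2 * a * C)); last ring.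
by apply: Rmult_le_compat_l => //; apply: Rmult_le_compat => //; exact: Rabs_pos.
Qed.

(** Each operator looks at most [1 / K <= 1] further, which enlarges the supporting cube by 1. *)
Lemma dops_outside s f B : (forall x, (exists i, B < Rabs (x i)) -> f x = 0) ->
  forall x, (exists i, B + INR (size s) < Rabs (x i)) -> dops s f x = 0.
Proof.
move=> hf; elim: s => [|j s IH] x [i hi]; first by apply: hf; exists i; move: hi; rewrite /=; lra.
have tr a : Rabs a <= 1 -> translate j a (dops s f) x = 0.
  move=> ha; apply: IH; exists i; rewrite [size _]/= S_INR in hi.
  by rewrite /upd; case: eqP => [<-|_]; split_Rabs; lra.
have i1 : Rabs (/ INR K) <= 1.
  rewrite Rabs_pos_eq; last by apply: Rlt_le; apply: Rinv_0_lt_compat; lra.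
  by rewrite -Rinv_1; apply: Rinv_le_contravar; lra.
rewrite /= /dop !tr ?Rabs_Ropp // IH; first ring.
by exists i; move: hi; rewrite [size _]/= S_INR; lra.
Qed.

End Differences.

(** The bound is uniform in the mesh: [dops s] commutes with differentiation, so the second
    derivative of [dops s f] is [dops s] of a test function and bounded by induction; the second
    difference is then [O(K^-2)], which compensates the factor [K^2]. *)
Lemma dops_bounded (n : nat) (s : seq 'I_n) f : smooth_compact f ->
  exists C, 0 <= C /\ forall K x, (0 < K)%N -> Rabs (dops n K s f x) <= C.
Proof.
elim: s f => [|i s IH] f hf.
  by have [C [C0 hC]] := smooth_compact_bounded _ hf; exists C; split=> // K x _; exact: hC.
have [g [fg hg]] := smooth_compact_pderiv _ i hf.
have [h [gh hh]] := smooth_compact_pderiv _ i hg.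
have [C1 [C10 hC1]] := IH f hf; have [C2 [C20 hC2]] := IH h hh.
exists (C1 + 2 * C2); split; first lra.
move=> K x K0; rewrite /= /dop.
have KR : 1 <= INR K by rewrite -[1]/(INR 1); apply: le_INR; lia.
have a0 : 0 <= / INR K by apply: Rlt_le; apply: Rinv_0_lt_compat; lra.
have h1 := hC1 K x K0.
have := second_difference n i (/ INR K) _ _ _ C2 x a0
  (dops_pderiv n K s i _ _ fg) (dops_pderiv n K s i _ _ gh) (fun x => hC2 K x K0).
set z := _ + _ - _ => h2.
apply: Rle_trans (Rabs_triang _ _) _; rewrite Rabs_Ropp Rabs_mult (Rabs_pos_eq (INR K ^ 2)); last by apply: pow2_ge_0.
have : INR K ^ 2 * Rabs z <= INR K ^ 2 * (2 * C2 * (/ INR K) ^ 2).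
  by apply: Rmult_le_compat_l => //; exact: pow2_ge_0.
rewrite (_ : INR K ^ 2 * (2 * C2 * (/ INR K) ^ 2) = 2 * C2); first lra.
by field; lra.
Qed.

(** * Discrete Fourier coefficients *)

Section DFTCoefficients.
Variables n K : nat.
Hypothesis K0 : (0 < K)%N.
Let M := (2 * (K * K))%N.
Let q := INR (K * K).
Let J : Type := {ffun 'I_n -> 'I_M}.
Let xn := xnode n K.
Let xin := xinode n K.

Let KR : 1 <= INR K.
Proof. by rewrite -[1]/(INR 1); apply: le_INR; lia. Qed.

Let ME : INR M = 2 * (INR K * INR K).
Proof. by rewrite /M -multE !mult_INR. Qed.

Let qE : INR (K * K) = INR K * INR K.
Proof. by rewrite -multE mult_INR. Qed.

Let M0 : (0 < M)%N.
Proof. by rewrite /M !muln_gt0 K0. Qed.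

(** Translation permutes the nodes except at the faces of the cube, where [F] vanishes both at the
    point that leaves and at the node that enters. *)
Lemma rsum_translate_up i (F : ('I_n -> R) -> R) :
  (forall x, INR K - 1 <= Rabs (x i) -> F x = 0) ->
  \rsum_(j : J) translate n i (/ INR K) F (xn j) = \rsum_(j : J) F (xn j).
Proof.
move=> h0; rewrite -[RHS](rsum_cshift n M i); apply: eq_bigr => j _.
rewrite /translate /xn /xnode node_cshift //; case: ltnP => hj //.
have e : (j i).+1 = (2 * (K * K))%N by apply/eqP; rewrite eqn_leq hj andbT; exact: ltn_ord.
have e' : INR (j i) + 1 = 2 * (INR K * INR K) by rewrite -S_INR e.
rewrite !h0 // upd_same.
- rewrite qE (_ : / INR K * - (INR K * INR K) = - INR K); last by field; lra.
  by rewrite Rabs_Ropp Rabs_pos_eq; lra.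
- rewrite /node qE (_ : _ + _ = INR K); first by rewrite Rabs_pos_eq; lra.
  by rewrite (_ : INR (j i) = 2 * (INR K * INR K) - 1); [field; lra|lra].
Qed.

Lemma rsum_translate_down i (F : ('I_n -> R) -> R) :
  (forall x, INR K - 1 <= Rabs (x i) -> F x = 0) ->
  \rsum_(j : J) translate n i (- / INR K) F (xn j) = \rsum_(j : J) F (xn j).
Proof.
move=> h0.
have ik : 0 < / INR K <= 1.
  split; first by apply: Rinv_0_lt_compat; lra.
  by rewrite -Rinv_1; apply: Rinv_le_contravar; lra.
rewrite -[LHS](rsum_cshift n M i); apply: eq_bigr => j _.
rewrite {1}/translate /xn /xnode node_cshift //; case: ltnP => hj //.
  rewrite upd_same upd_upd; congr F.
  have cancel (u v : R) : u + v + - v = u by ring.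
  by rewrite cancel upd_id.
have e : (j i).+1 = (2 * (K * K))%N by apply/eqP; rewrite eqn_leq hj andbT; exact: ltn_ord.
have e' : INR (j i) + 1 = 2 * (INR K * INR K) by rewrite -S_INR e.
rewrite !h0 // ?upd_same.
- rewrite /node qE (_ : _ * (_ - _) = INR K - / INR K); last first.
    by rewrite (_ : INR (j i) = 2 * (INR K * INR K) - 1); [field; lra|lra].
  by rewrite Rabs_pos_eq; lra.
- rewrite qE (_ : / INR K * - (INR K * INR K) = - INR K); last by field; lra.
  by split_Rabs; lra.
Qed.

Definition sig (xi : R) := 2 * INR K ^ 2 * (1 - cos (xi / INR K)).

(** Summation by parts. [G c] carries a shifted phase, chosen so that its translate has the
    unshifted one; adding the two directions produces [2 cos (xi i / K)], the symbol of the sum of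
    the two translations. *)
Lemma rsum_dop b i f xi : (forall x, INR K - 1 <= Rabs (x i) -> f x = 0) ->
  \rsum_(j : J) (dop n K i f (xn j) * trig b (dot n xi (xn j))) =
  (1 + sig (xi i)) * \rsum_(j : J) (f (xn j) * trig b (dot n xi (xn j))).
Proof.
move=> h0.
pose G c x := f x * trig b (dot n xi x + c * (xi i / INR K)).
have G0 c x : INR K - 1 <= Rabs (x i) -> G c x = 0.
  by move=> /h0; rewrite /G => ->; ring.
have up := rsum_translate_up i (G (-1)) (G0 (-1)).
have dn := rsum_translate_down i (G 1) (G0 1).
have dot_tr x a : dot n xi (upd x i (x i + a)) = dot n xi x + a * xi i.
  by rewrite dotC dot_upd dotC; ring.
have tE a x c : translate n i a (G c) x = translate n i a f x * trig b (dot n xi x + (a * xi i + c * (xi i / INR K))).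
  by rewrite /translate /G dot_tr Rplus_assoc.
rewrite (eq_bigr (fun j => f (xn j) * trig b (dot n xi (xn j)) +
   - INR K ^ 2 * (translate n i (/ INR K) (G (-1)) (xn j) + (translate n i (- / INR K) (G 1) (xn j)
   + -2 * (f (xn j) * trig b (dot n xi (xn j))))))); last first.
  move=> j _; rewrite !tE /dop.
  rewrite (_ : / INR K * xi i + -1 * (xi i / INR K) = 0); last by rewrite /Rdiv; ring.
  rewrite (_ : - / INR K * xi i + 1 * (xi i / INR K) = 0); last by rewrite /Rdiv; ring.
  by rewrite Rplus_0_r; ring.
rewrite big_split /= rsum_scal big_split /= big_split /= rsum_scal up dn.
have two : \rsum_(j : J) G (-1) (xn j) + \rsum_(j : J) G 1 (xn j) =
    2 * cos (xi i / INR K) * \rsum_(j : J) (f (xn j) * trig b (dot n xi (xn j))).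
  rewrite -rsum_scal -big_split /=; apply: eq_bigr => j _.
  rewrite /G (_ : -1 * _ = - (xi i / INR K)); last ring.
  rewrite Rmult_1_l; case: (b) => /=.
    by rewrite !cos_plus cos_neg sin_neg; ring.
  by rewrite !sin_plus cos_neg sin_neg; ring.
rewrite -Rplus_assoc two /sig.
have alg (A S a c : R) : A = S ->
  A + - (a * (a * 1)) * (2 * c * S + -2 * S) = (1 + 2 * a ^ 2 * (1 - c)) * S by move=> ->; ring.
exact: (alg _ _ _ _ (erefl _)).
Qed.

(** On the frequency cube [xi / K] stays in [[- PI, PI]], where the chord bound makes the discrete
    symbol comparable with [xi^2]. *)
Lemma sig_ge xi : Rabs xi <= PI * INR K -> 0 <= sig xi /\ 1 + xi ^ 2 <= 9 * (1 + sig xi).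
Proof.
move=> hx.
have c := COS_bound (xi / INR K).
have K2 : 0 < INR K ^ 2 by apply: pow_lt; lra.
have s0 : 0 <= sig xi by rewrite /sig; apply: Rmult_le_pos; lra.
split=> //.
have h : (xi / INR K) ^ 2 <= 9 * (2 * (1 - cos (xi / INR K))).
  apply: chord_lower; rewrite /Rdiv Rabs_mult Rabs_inv (Rabs_pos_eq (INR K)); last lra.
  by apply: (Rmult_le_reg_r (INR K)); [lra|rewrite Rmult_assoc Rinv_l; lra].
have := Rmult_le_compat_l (INR K ^ 2) _ _ ltac:(lra) h.
rewrite (_ : INR K ^ 2 * (xi / INR K) ^ 2 = xi ^ 2); last by field; lra.
by rewrite /sig; lra.
Qed.

Lemma rsum_dops b s f xi B : (forall x, (exists i, B < Rabs (x i)) -> f x = 0) ->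
  B + INR (size s) < INR K - 1 ->
  \rsum_(j : J) (dops n K s f (xn j) * trig b (dot n xi (xn j))) =
  \big[Rmult/1]_(i <- s) (1 + sig (xi i)) * \rsum_(j : J) (f (xn j) * trig b (dot n xi (xn j))).
Proof.
move=> h0; elim: s => [|i s IH] hs; first by rewrite big_nil Rmult_1_l.
rewrite [size _]/= S_INR in hs.
rewrite big_cons /= rsum_dop; first by rewrite IH ?Rmult_assoc //; lra.
move=> x hx; apply: (dops_outside n K K0 s f B h0); exists i; lra.
Qed.

Definition dft_coef (f : ('I_n -> R) -> R) b (l : J) :=
  / INR M ^ n * \rsum_(j : J) (f (xn j) * trig b (dot n (xin l) (xn j))).

(** The addition formula merges the cosine and sine parts into one sum depending on the difference
    of two nodes, and orthogonality keeps only [j = j0]. The identity is exact, but only at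
    nodes. *)
Lemma dft_inversion f j0 :
  f (xn j0) = \rsum_(l : J) (dft_coef f true l * cos (dot n (xin l) (xn j0))
                           + dft_coef f false l * sin (dot n (xin l) (xn j0))).
Proof.
have Mn : INR M ^ n <> 0.
  by apply: pow_nonzero; rewrite ME; have := Rmult_lt_0_compat (INR K) (INR K); lra.
rewrite (eq_bigr (fun l => / INR M ^ n * \rsum_(j : J) (f (xn j) * cos (dot n (xin l) (fun i => xn j0 i - xn j i))))); last first.
  move=> l _; rewrite /dft_coef !Rmult_assoc -Rmult_plus_distr_l; congr (_ * _).
  rewrite !(Rmult_comm (\big[_/_]_(_ : _) _)) -!rsum_scal -big_split; apply: eq_bigr => j _.
  by rewrite dot_sub cos_minus /=; ring.
rewrite rsum_scal exchange_big /=.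
rewrite (eq_bigr (fun j => f (xn j) * if j == j0 then INR M ^ n else 0)).
  rewrite (bigD1 j0) //= eqxx big1 ?Rplus_0_r; last by move=> j /negbTE ->; ring.
  by rewrite Rmult_comm Rmult_assoc Rinv_r ?Rmult_1_r.
move=> j _; rewrite rsum_scal; congr (_ * _).
rewrite (eq_bigr (fun l => cos (dot n (xin l) (fun i => IZR (Z.of_nat (j0 i) - Z.of_nat (j i)) / INR K)))); last first.
  move=> l _; congr cos; congr dot; apply: functional_extensionality => i.
  by rewrite minus_IZR -!INR_IZR_INZ /xn /xnode /node; field; lra.
rewrite dft_orthogonal //; last by move=> i; have := ltn_ord (j i); have := ltn_ord (j0 i); lia.
rewrite -/M; congr (if _ then _ else _).
apply/forallP/eqP => [h|-> i]; last by rewrite Z.sub_diag.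
apply/ffunP => i; apply: val_inj => /=.
by have := proj1 (Z.eqb_eq _ _) (h i); lia.
Qed.

End DFTCoefficients.

Lemma trig_lipschitz b x y : Rabs (trig b y - trig b x) <= Rabs (y - x).
Proof.
pose g z := if b then - sin z else cos z.
have dg z : is_derive (trig b) z (g z).
  by rewrite /g /trig; case: (b); auto_derive => //; ring.
have [|c [_ ->]] := MVT_gen (trig b) x y g (fun z _ => dg z).
  move=> z _; apply: derivable_continuous_pt; exists (g z); exact/is_derive_Reals.
rewrite Rabs_mult -[X in _ <= X]Rmult_1_l; apply: Rmult_le_compat_r; first exact: Rabs_pos.
by rewrite /g; case: (b); rewrite ?Rabs_Ropp; apply: Rabs_le; [exact: SIN_bound|exact: COS_bound].
Qed.

Lemma rprod_ge1 (J : finType) (F : J -> R) : (forall j, 1 <= F j) -> 1 <= \big[Rmult/1]_(j : J) F j.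
Proof. by move=> h; elim/big_ind: _ => [|*|//]; [lra|nra]. Qed.

(** A product rather than [1 + |xi|^2], so that sums over the frequency grid factor over the
    coordinates. *)
Definition weight {n : nat} (xi : 'I_n -> R) := \big[Rmult/1]_(i < n) (1 + xi i ^ 2).

Lemma weight_dot {n : nat} (xi : 'I_n -> R) : 1 + dot n xi xi <= weight xi.
Proof.
rewrite /weight /dot /sumR.
suff : 0 <= \rsum_(i : 'I_n) (xi i * xi i) /\
  1 + \rsum_(i : 'I_n) (xi i * xi i) <= \big[Rmult/1]_(i < n) (1 + xi i ^ 2) by lra.
elim/big_rec2: _ => [|i y x _ [h1 h2]]; first lra.
have := Rle_0_sqr (xi i); rewrite /Rsqr; set a := xi i * xi i => a0.
rewrite (_ : xi i ^ 2 = a); last by rewrite /a; ring.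
by split; nra.
Qed.

Lemma dot_self_ge0 {n : nat} (xi : 'I_n -> R) : 0 <= dot n xi xi.
Proof.
rewrite /dot /sumR; elim/big_ind: _ => [|*|i _]; [lra|lra|exact: Rle_0_sqr].
Qed.

Lemma weight_ge1 {n : nat} (xi : 'I_n -> R) : 1 <= weight xi.
Proof. by have := weight_dot xi; have := dot_self_ge0 xi; lra. Qed.

Lemma coord_sqr_le {n : nat} (xi : 'I_n -> R) i : xi i ^ 2 <= dot n xi xi.
Proof.
rewrite /dot /sumR (bigD1 i) //=; set S := (X in _ <= _ + X).
suff S0 : 0 <= S by rewrite Rmult_1_r; lra.
by rewrite /S; elim/big_ind: _ => [|*|j _]; [lra|lra|exact: Rle_0_sqr].
Qed.

Lemma coord_le_weight {n : nat} (xi : 'I_n -> R) i : Rabs (xi i) <= weight xi.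
Proof.
have h1 := weight_dot xi; have h2 := coord_sqr_le xi i; have h3 := pow2_ge_0 (Rabs (xi i) - 1).
by rewrite -(pow2_abs (xi i)) in h2; have := Rabs_pos (xi i); lra.
Qed.

(** * Decay and total mass of the coefficients *)

Section Decay.
Variables (n : nat) (f : ('I_n -> R) -> R).
Hypothesis hf : smooth_compact f.

Lemma rprod_flatten (g : 'I_n -> R) a :
  \big[Rmult/1]_(i <- flatten (nseq a (enum 'I_n))) g i = (\big[Rmult/1]_(i < n) g i) ^ a.
Proof.
elim: a => [|a IH] /=; first by rewrite big_nil.
by rewrite big_cat /= IH big_enum.
Qed.

(** With every coordinate repeated [a] times, [rsum_dops] multiplies the coefficient by the whole
    product to the power [a]. The nodes in the support are counted by a Lorentz weight, at most
    [(12 K)^n] up to a constant, and the normalization [(2 K^2)^n] leaves [(6 / K)^n]. *)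
Lemma dft_decay a : exists C K1, 0 <= C /\ forall K, (K1 <= K)%N -> (0 < K)%N ->
  forall b l, Rabs (dft_coef n K f b l) * (\big[Rmult/1]_(i < n) (1 + sig K (xinode n K l i))) ^ a
    <= C * (/ INR K) ^ n.
Proof.
have [_ [B0 hB0]] := hf.
pose s := flatten (nseq a (enum 'I_n)).
pose B := Rabs B0.
have hB x : (exists i, B < Rabs (x i)) -> f x = 0.
  by move=> [i hi]; apply: hB0; exists i; have := Rle_abs B0; rewrite -/B; lra.
have [C1 [C10 hC1]] := dops_bounded n s f hf.
pose B' := B + INR (size s).
have B'0 : 0 <= B' by rewrite /B'; have := Rabs_pos B0; have := pos_INR (size s); rewrite -/B; lra.
have [K1 hK1] := nfloor_ex (B' + 1) ltac:(lra).
(* From this [K] on, the support enlarged by all the difference operators avoids the zone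
   [K - 1 <= |x i|] where translations wrap around. *)
exists (C1 * ((1 + B' ^ 2) * 6) ^ n), K1.+2; split.
  by apply: Rmult_le_pos => //; apply: pow_le; have := pow2_ge_0 B'; lra.
move=> K hK K0 b l.
have KR : B' < INR K - 1.
  have : INR K1.+2 <= INR K by apply: le_INR; lia.
  by rewrite !S_INR; lra.
have KR1 : 1 <= INR K by lra.
have d := rsum_dops n K K0 b s f (xinode n K l) B hB KR.
rewrite rprod_flatten in d.
have ME : INR (2 * (K * K)) = 2 * (INR K * INR K) by rewrite -!multE !mult_INR.
set P := _ ^ a in d *.
have Ppos : 0 <= P.
  apply: pow_le; apply: Rlt_le; apply: rprod_pos => i.
  have := COS_bound (xinode n K l i / INR K) => -[_ c1].
  have : 0 <= sig K (xinode n K l i); last lra.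
  by rewrite /sig; apply: Rmult_le_pos; [have := pow2_ge_0 (INR K); lra|lra].
rewrite -{1}(Rabs_pos_eq P Ppos) -Rabs_mult /dft_coef Rmult_assoc [X in _ * X]Rmult_comm -d Rabs_mult.
have K2 : 0 < INR K * INR K by apply: Rmult_lt_0_compat; lra.
rewrite Rabs_pos_eq; last by apply: Rlt_le; apply: Rinv_0_lt_compat; apply: pow_lt; rewrite ME; lra.
have key : Rabs (\rsum_(j : {ffun 'I_n -> 'I_(2 * (K * K))})
    (dops n K s f (xnode n K j) * trig b (dot n (xinode n K l) (xnode n K j))))
    <= C1 * (1 + B' ^ 2) ^ n * (12 * INR K) ^ n.
  apply: Rle_trans (rsum_abs _ _) _.
  apply: (Rle_trans _ (\rsum_(j : {ffun 'I_n -> 'I_(2 * (K * K))})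
    (C1 * (1 + B' ^ 2) ^ n * \big[Rmult/1]_(i < n) (/ (1 + ((INR (j i) - INR (K * K)) / INR K) ^ 2))))).
    apply: rsum_le => j; rewrite Rabs_mult.
    have p0 (i : 'I_n) : 0 < / (1 + ((INR (j i) - INR (K * K)) / INR K) ^ 2).
      by apply: Rinv_0_lt_compat; have := pow2_ge_0 ((INR (j i) - INR (K * K)) / INR K); lra.
    have rhs0 : 0 <= C1 * (1 + B' ^ 2) ^ n * \big[Rmult/1]_(i < n) (/ (1 + ((INR (j i) - INR (K * K)) / INR K) ^ 2)).
      apply: Rmult_le_pos; last by apply: Rlt_le; apply: rprod_pos.
      by apply: Rmult_le_pos => //; apply: pow_le; have := pow2_ge_0 B'; lra.
    case: (classic (exists i, B + INR (size s) < Rabs (xnode n K j i))) => [out|inn].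
      by rewrite (dops_outside n K K0 s f B hB _ out) Rabs_R0 Rmult_0_l.
    apply: (Rle_trans _ C1).
      rewrite -[C1]Rmult_1_r; apply: Rmult_le_compat; try exact: Rabs_pos; [exact: hC1|exact: trig_bound].
    rewrite -[X in X <= _]Rmult_1_r Rmult_assoc; apply: Rmult_le_compat_l => //.
    rewrite -rprod_const -big_split /=; apply: rprod_ge1 => i.
    have hi : Rabs (xnode n K j i) <= B' by apply: Rnot_lt_le => lt; apply: inn; exists i.
    set z := (_ - _) / _.
    have e : xnode n K j i = z by rewrite /z /xnode /node /Rdiv Rmult_comm.
    rewrite e in hi.
    have h2 : z ^ 2 <= B' ^ 2 by rewrite -(pow2_abs z); apply: pow_incr; split=> //; exact: Rabs_pos.
    have z2 := pow2_ge_0 z.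
    by apply: (Rmult_le_reg_r (1 + z ^ 2)); [lra|rewrite Rmult_assoc Rinv_l; lra].
  rewrite rsum_scal; apply: Rmult_le_compat_l.
    by apply: Rmult_le_pos => //; apply: pow_le; have := pow2_ge_0 B'; lra.
  rewrite (rsum_ffun_prod n (2 * (K * K)) (fun v => / (1 + ((INR v - INR (K * K)) / INR K) ^ 2))).
  apply: pow_incr; split; last exact: lorentz_sum.
  by elim/big_ind: _ => [|*|v _]; [lra|lra|apply: Rlt_le; apply: Rinv_0_lt_compat; have := pow2_ge_0 ((INR v - INR (K * K)) / INR K); lra].
have Mi0 : 0 <= / INR (2 * (K * K)) ^ n.
  apply: Rlt_le; apply: Rinv_0_lt_compat; apply: pow_lt; rewrite ME; lra.
apply: Rle_trans (Rmult_le_compat_l _ _ _ Mi0 key) _.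
rewrite (_ : _ * (_ * _) = C1 * (/ INR (2 * (K * K)) ^ n * (1 + B' ^ 2) ^ n * (12 * INR K) ^ n)); last by ring.
rewrite [X in _ <= X]Rmult_assoc; apply: Rmult_le_compat_l => //.
rewrite -pow_inv -!Rpow_mult_distr; apply: Req_le; congr (_ ^ _).
by rewrite ME; field; lra.
Qed.

(** One power of the weight beyond [r] is spent on convergence: its inverse sums to [O(K^n)] over
    the frequency grid, which cancels the [K^-n] of [dft_decay]. *)
Lemma dft_mass r : exists C K1, 0 <= C /\ forall K, (K1 <= K)%N -> (0 < K)%N -> forall b,
  \rsum_(l : {ffun 'I_n -> 'I_(2 * (K * K))})
     (Rabs (dft_coef n K f b l) * weight (xinode n K l) ^ r) <= C.
Proof.
have [C [K1 [C0 hC]]] := dft_decay r.+1.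
exists (C * (9 ^ n) ^ r.+1 * 12 ^ n), K1; split.
  by apply: Rmult_le_pos; [apply: Rmult_le_pos => //|]; apply: pow_le; [apply: pow_le|]; lra.
move=> K hK K0 b.
have KR : 1 <= INR K by rewrite -[1]/(INR 1); apply: le_INR; lia.
have ME : INR (2 * (K * K)) = 2 * (INR K * INR K) by rewrite -!multE !mult_INR.
have PI0 := PI_RGT_0; have PI3 := PI2_3_2.
apply: (Rle_trans _ (\rsum_(l : {ffun 'I_n -> 'I_(2 * (K * K))})
    (C * (/ INR K) ^ n * (9 ^ n) ^ r.+1 *
      \big[Rmult/1]_(i < n) (/ (1 + ((INR (l i) - INR (K * K)) / INR K) ^ 2))))).
  apply: rsum_le => l.
  have xiE i : xinode n K l i = PI * ((INR (l i) - INR (K * K)) / INR K).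
    by rewrite /xinode /node /Rdiv Rmult_assoc (Rmult_comm (/ INR K)).
  have xib i : Rabs (xinode n K l i) <= PI * INR K.
    rewrite xiE Rabs_mult Rabs_pos_eq; last lra.
    apply: Rmult_le_compat_l; first lra.
    rewrite /Rdiv Rabs_mult Rabs_inv (Rabs_pos_eq (INR K)); last lra.
    apply: (Rmult_le_reg_r (INR K)); first lra.
    rewrite Rmult_assoc Rinv_l ?Rmult_1_r; last lra.
    have hl : INR (l i) <= INR (2 * (K * K)) by apply: le_INR; have := ltn_ord (l i); lia.
    have := pos_INR (l i); rewrite ME in hl.
    have -> : INR (K * K) = INR K * INR K by rewrite -multE mult_INR.
    by split_Rabs; lra.
  have h := hC K hK K0 b l.
  set S := \big[Rmult/1]_(i < n) (1 + sig K (xinode n K l i)) in h.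
  set W := weight (xinode n K l).
  have W1 : 1 <= W := weight_ge1 _.
  have S0 : 0 < S by apply: rprod_pos => i; have [] := sig_ge K K0 _ (xib i); lra.
  have WS : W <= 9 ^ n * S.
    rewrite /W /weight /S -rprod_const -big_split /=; apply: rprod_le => i.
    by have [h1 h2] := sig_ge K K0 _ (xib i); have := pow2_ge_0 (xinode n K l i); lra.
  have WS1 : W ^ r.+1 <= (9 ^ n) ^ r.+1 * S ^ r.+1.
    by rewrite -Rpow_mult_distr; apply: pow_incr; lra.
  have iW : / W <= \big[Rmult/1]_(i < n) (/ (1 + ((INR (l i) - INR (K * K)) / INR K) ^ 2)).
    rewrite (_ : / W = \big[Rmult/1]_(i < n) / (1 + xinode n K l i ^ 2)); last first.
      rewrite /W /weight; apply: (Rmult_eq_reg_l W); last lra.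
      rewrite Rinv_r; last by rewrite -/(weight _) -/W; lra.
      rewrite /W /weight -big_split big1 //= => i _.
      by rewrite Rinv_r //; have := pow2_ge_0 (xinode n K l i); lra.
    apply: rprod_le => i; rewrite xiE; set z := (_ - _) / _.
    have z2 := pow2_ge_0 z.
    have zz : z ^ 2 <= (PI * z) ^ 2 by rewrite Rpow_mult_distr; have : 1 <= PI ^ 2; nra.
    split; first by apply: Rlt_le; apply: Rinv_0_lt_compat; lra.
    by apply: Rinv_le_contravar; lra.
  set Z := \big[Rmult/1]_(i < n) _ in iW *.
  set c := Rabs _ in h *.
  have c0 : 0 <= c := Rabs_pos _.
  have e : c * W ^ r = c * W ^ r.+1 * / W by rewrite /=; field; lra.
  have iW0 : 0 < / W by apply: Rinv_0_lt_compat; lra.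
  rewrite e; apply: Rmult_le_compat => //; [|lra|].
    by apply: Rmult_le_pos => //; apply: pow_le; lra.
  apply: (Rle_trans _ (c * ((9 ^ n) ^ r.+1 * S ^ r.+1))); first exact: Rmult_le_compat_l.
  rewrite (_ : c * (_ * _) = (9 ^ n) ^ r.+1 * (c * S ^ r.+1)); last ring.
  rewrite [X in _ <= X]Rmult_comm; apply: Rmult_le_compat_l => //.
  by apply: pow_le; apply: pow_le; lra.
rewrite rsum_scal (rsum_ffun_prod n (2 * (K * K)) (fun v => / (1 + ((INR v - INR (K * K)) / INR K) ^ 2))).
set L := \rsum_(v : _) _.
have L0 : 0 <= L.
  by rewrite /L; elim/big_ind: _ => [|*|v _]; [lra|lra|apply: Rlt_le; apply: Rinv_0_lt_compat; have := pow2_ge_0 ((INR v - INR (K * K)) / INR K); lra].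
have L1 : L <= 12 * INR K by exact: lorentz_sum.
have Ln : L ^ n <= (12 * INR K) ^ n by apply: pow_incr.
have c0 : 0 <= C * (/ INR K) ^ n * (9 ^ n) ^ r.+1.
  apply: Rmult_le_pos; last by apply: pow_le; apply: pow_le; lra.
  by apply: Rmult_le_pos => //; apply: pow_le; apply: Rlt_le; apply: Rinv_0_lt_compat; lra.
apply: Rle_trans (Rmult_le_compat_l _ _ _ c0 Ln) _.
rewrite Rpow_mult_distr; apply: Req_le.
have -> : C * (/ INR K) ^ n * (9 ^ n) ^ r.+1 * (12 ^ n * INR K ^ n) =
  C * (9 ^ n) ^ r.+1 * 12 ^ n * ((/ INR K) ^ n * INR K ^ n) by ring.
by rewrite -Rpow_mult_distr Rinv_l ?pow1 ?Rmult_1_r //; lra.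
Qed.

End Decay.

Lemma nearest_node n K (x : 'I_n -> R) : (0 < K)%N -> (forall i, Rabs (x i) < INR K) ->
  exists j, forall i, Rabs (xnode n K j i - x i) <= / INR K.
Proof.
move=> K0 hx.
have KR : 1 <= INR K by rewrite -[1]/(INR 1); apply: le_INR; lia.
have qE : INR (K * K) = INR K * INR K by rewrite -multE mult_INR.
have ME : INR (2 * (K * K)) = 2 * (INR K * INR K) by rewrite -!multE !mult_INR.
have ex i : exists v : 'I_(2 * (K * K)), INR v <= INR K * x i + INR K * INR K < INR v + 1.
  have h := hx i.
  have [m hm] := nfloor_ex (INR K * x i + INR K * INR K) ltac:(move: h; split_Rabs; nra).
  have mM : (m < 2 * (K * K))%N.
    apply/ltP; apply: INR_lt; rewrite ME; move: h; split_Rabs; nra.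
  by exists (Ordinal mM).
pose c i := constructive_indefinite_description _ (ex i).
exists [ffun i => proj1_sig (c i)] => i.
have := proj2_sig (c i); rewrite /xnode /node ffunE qE; set v := INR _ => hv.
rewrite (_ : _ - _ = / INR K * (v - (INR K * x i + INR K * INR K))); last by field; lra.
have i0 : 0 < / INR K by apply: Rinv_0_lt_compat; lra.
rewrite Rabs_mult (Rabs_pos_eq (/ _)); last lra.
rewrite -[X in _ <= X]Rmult_1_r; apply: Rmult_le_compat_l; first lra.
by split_Rabs; lra.
Qed.

Lemma dot_bound n (xi d : 'I_n -> R) c : (forall i, Rabs (d i) <= c) ->
  Rabs (dot n xi d) <= INR n * c * weight xi.
Proof.
move=> h; apply: Rle_trans (rsum_abs _ _) _.
apply: (Rle_trans _ (\rsum_(i : 'I_n) (c * weight xi))).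
  apply: rsum_le => i; rewrite Rabs_mult Rmult_comm.
  apply: Rmult_le_compat; try exact: Rabs_pos; [exact: h|exact: coord_le_weight].
by rewrite rsum_const card_ord; lra.
Qed.

(* [L] is a generalized limit of the discrete Fourier sums on the grids of mesh 1 / K in the cube [-K, K)^n. *)
Theorem fourier_functional n (h : ('I_n -> R) -> R) : smooth_compact h ->
  exists L, tame_functional (fun om : ('I_n -> R) * bool => weight om.1) L /\
    forall x, L (fun om => trig om.2 (dot n om.1 x)) = h x.
Proof.
move=> hh.
have [Lim [Llin Lbd]] := generalized_limit.
pose S K (F : ('I_n -> R) * bool -> R) :=
  \rsum_(l : {ffun 'I_n -> 'I_(2 * (K * K))})
   (dft_coef n K h true l * F (xinode n K l, true) + dft_coef n K h false l * F (xinode n K l, false)).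
have Sbd r : exists C K1, 0 <= C /\ forall K, (K1 <= K)%N -> forall F A,
    (forall om, Rabs (F om) <= A * weight om.1 ^ r) -> Rabs (S K.+1 F) <= C * A.
  have [C [K1 [C0 hC]]] := dft_mass n h hh r.
  exists (2 * C), K1; split; first lra.
  move=> K hK F A hF.
  have A0 : 0 <= A.
    have := hF ((fun=> 0), true); have := Rabs_pos (F ((fun=> 0), true)).
    have := pow_lt (weight (n := n) (fun=> 0)) r ltac:(have := weight_ge1 (n := n) (fun=> 0); lra).
    by move=> /= p0 p1 p2; apply: Rnot_lt_le => ?; nra.
  have hb b := hC K.+1 (leqW hK) isT b.
  apply: Rle_trans (rsum_abs _ _) _.
  apply: (Rle_trans _ (\rsum_(l : {ffun 'I_n -> 'I_(2 * (K.+1 * K.+1))})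
     (A * (Rabs (dft_coef n K.+1 h true l) * weight (xinode n K.+1 l) ^ r) +
      A * (Rabs (dft_coef n K.+1 h false l) * weight (xinode n K.+1 l) ^ r)))).
    apply: rsum_le => l; apply: Rle_trans (Rabs_triang _ _) _.
    rewrite (Rabs_mult (dft_coef n K.+1 h true l)) (Rabs_mult (dft_coef n K.+1 h false l)).
    have t b : Rabs (dft_coef n K.+1 h b l) * Rabs (F (xinode n K.+1 l, b)) <=
       A * (Rabs (dft_coef n K.+1 h b l) * weight (xinode n K.+1 l) ^ r).
      rewrite (_ : A * (_ * _) = Rabs (dft_coef n K.+1 h b l) * (A * weight (xinode n K.+1 l) ^ r)); last ring.
      apply: Rmult_le_compat_l; first exact: Rabs_pos.
      exact: (hF (xinode n K.+1 l, b)).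
    by apply: Rplus_le_compat; exact: t.
  rewrite big_split /= !rsum_scal.
  have h1 := Rmult_le_compat_l A _ _ A0 (hb true).
  have h2 := Rmult_le_compat_l A _ _ A0 (hb false).
  by apply: Rle_trans (Rplus_le_compat _ _ _ _ h1 h2) _; lra.
exists (fun F => Lim (fun K => S K.+1 F)); split; first split.
- move=> F G c [r [A hF]] [r' [B hG]].
  have [C [K1 [C0 hC]]] := Sbd r; have [C' [K1' [C0' hC']]] := Sbd r'.
  rewrite -(Llin _ _ c (C * A) (C' * B) (maxn K1 K1')).
  + congr Lim; apply: functional_extensionality => K.
    by rewrite -rsum_scal -big_split; apply: eq_bigr => l _ /=; ring.
  + by move=> K hK; apply: hC => //; apply: leq_trans hK; exact: leq_maxl.
  + by move=> K hK; apply: hC' => //; apply: leq_trans hK; exact: leq_maxr.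
- move=> r; have [C [K1 [C0 hC]]] := Sbd r.
  exists C; split=> // F A hF; apply: Rabs_le.
  by apply: (Lbd _ _ _ K1) => K hK; have := hC K hK F A hF; split_Rabs; lra.
- move=> x.
  have [C [K1 [C0 hC]]] := Sbd 1%N.
  have near eps : 0 < eps -> exists m, forall K, (m <= K)%N ->
      h x - eps <= S K.+1 (fun om => trig om.2 (dot n om.1 x)) <= h x + eps.
    move=> e0.
    have [d [d0 hd]] := hh.1 0%N x Logic.I (eps / 2) ltac:(lra).
    pose bx := \rsum_(i : 'I_n) Rabs (x i).
    have hbx i : Rabs (x i) <= bx.
      rewrite /bx (bigD1 i) //=; set T := (X in _ <= _ + X).
      suff T0 : 0 <= T by lra.
      by rewrite /T; elim/big_ind: _ => [|*|j _]; [lra|lra|exact: Rabs_pos].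
    have bx0 : 0 <= bx by rewrite /bx; elim/big_ind: _ => [|*|j _]; [lra|lra|exact: Rabs_pos].
    pose Y := bx + / d + 2 * C * INR n / eps.
    have Y0 : 0 <= 2 * C * INR n / eps.
      apply: Rmult_le_pos; last by apply: Rlt_le; apply: Rinv_0_lt_compat.
      by apply: Rmult_le_pos; [lra|exact: pos_INR].
    have id0 : 0 < / d by apply: Rinv_0_lt_compat.
    have [m hm] := nfloor_ex Y ltac:(rewrite /Y; lra).
    exists (maxn m K1) => K hK.
    have KY : Y < INR K.+1.
      have : INR m <= INR K by apply: le_INR; apply/leP; apply: leq_trans hK; exact: leq_maxl.
      by rewrite S_INR; lra.
    have KR : 0 < INR K.+1 by rewrite /Y in KY; lra.
    have bxK : bx < INR K.+1 by rewrite /Y in KY; lra.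
    have [j0 hj0] := nearest_node n K.+1 x isT (fun i => Rle_lt_trans _ _ _ (hbx i) bxK).
    set z := xnode n K.+1 j0 in hj0.
    have Kd : / INR K.+1 < d.
      rewrite -(Rinv_inv d); apply: Rinv_lt_contravar; last by rewrite /Y in KY; lra.
      exact: Rmult_lt_0_compat.
    have hz : Rabs (h z - h x) < eps / 2.
      by apply: hd => // i; apply: Rle_lt_trans (hj0 i) Kd.
    have Sz : S K.+1 (fun om => trig om.2 (dot n om.1 z)) = h z.
      by rewrite [RHS](dft_inversion n K.+1 isT h j0).
    have diff : S K.+1 (fun om => trig om.2 (dot n om.1 x)) - h z =
        S K.+1 (fun om => trig om.2 (dot n om.1 x) - trig om.2 (dot n om.1 z)).
      rewrite -Sz (_ : forall a b, a - b = a + -1 * b); last by move=> *; ring.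
      by rewrite -rsum_scal -big_split; apply: eq_bigr => l _ /=; ring.
    have hb := hC K (leq_trans (leq_maxr _ _) hK) (fun om => trig om.2 (dot n om.1 x) - trig om.2 (dot n om.1 z)) (INR n * / INR K.+1).
    have {}hb : Rabs (S K.+1 (fun om => trig om.2 (dot n om.1 x) - trig om.2 (dot n om.1 z))) <= C * (INR n * / INR K.+1).
      apply: hb => om; rewrite pow_1; apply: Rle_trans (trig_lipschitz _ _ _) _.
      rewrite -dot_sub; apply: dot_bound => i.
      by rewrite -Rabs_Ropp Ropp_minus_distr.
    have fin : C * (INR n * / INR K.+1) <= eps / 2.
      apply: (Rmult_le_reg_r (INR K.+1)) => //.
      rewrite (_ : C * _ * _ = C * INR n); last by field; lra.
      have : 2 * C * INR n / eps * eps = 2 * C * INR n by field; lra.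
      have : 2 * C * INR n / eps <= INR K.+1 by rewrite /Y in KY; lra.
      by nra.
    by move: hb hz; rewrite -diff; split_Rabs; lra.
  apply: cond_eq => eps e0.
  have [m hm] := near (eps / 2) ltac:(lra).
  by have := Lbd _ _ _ m hm; split_Rabs; lra.
Qed.

(** * Averages over the circle *)

(** A finitely additive substitute for the Haar measure of the circle, usable on every bounded
    function however irregular. *)
Definition mean_functional (Th : (R -> R) -> R) :=
  (forall F G c A B, (forall x, Rabs (F x) <= A) -> (forall x, Rabs (G x) <= B) ->
     Th (fun x => F x + c * G x) = Th F + c * Th G) /\
  (forall F x y, (forall t, x <= F t <= y) -> x <= Th F <= y) /\
  (forall b k, (0 < k)%N -> Th (fun x => trig b (INR k * x)) = 0).

(** A generalized limit of averages over equally spaced angles: the average of [trig b (k x)] is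
    exactly 0 once there are more than [k] angles. *)
Lemma circle_functional : exists Th, mean_functional Th.
Proof.
have [Lim [Llin Lbd]] := generalized_limit.
pose S M (F : R -> R) := / INR M.+1 * \rsum_(l : 'I_M.+1) F (2 * PI * INR l / INR M.+1).
have MR M : 0 < INR M.+1 by apply: lt_0_INR; lia.
have Sbd M F x y : (forall t, x <= F t <= y) -> x <= S M F <= y.
  move=> h; rewrite /S.
  have e c : c = / INR M.+1 * \rsum_(l : 'I_M.+1) c.
    by rewrite rsum_const card_ord -Rmult_assoc Rinv_l ?Rmult_1_l //; have := MR M; lra.
  have i0 : 0 <= / INR M.+1 by apply: Rlt_le; apply: Rinv_0_lt_compat.
  by split; [rewrite {1}(e x)|rewrite {1}(e y)]; apply: Rmult_le_compat_l => //; apply: rsum_le => l; have := h (2 * PI * INR l / INR M.+1); lra.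
have Sabs M F A : (forall t, Rabs (F t) <= A) -> Rabs (S M F) <= A.
  by move=> h; apply: Rabs_le; apply: Sbd => t; have := h t; split_Rabs; lra.
exists (fun F => Lim (fun M => S M F)); split; last split.
- move=> F G c A B hF hG; rewrite -(Llin _ _ c A B 0%N).
  + congr Lim; apply: functional_extensionality => M.
    by rewrite /S big_split /= rsum_scal Rmult_plus_distr_l -!Rmult_assoc (Rmult_comm c).
  + by move=> M _; exact: Sabs.
  + by move=> M _; exact: Sabs.
- by move=> F x y h; apply: (Lbd _ _ _ 0%N) => M _; exact: Sbd.
- move=> b k k0.
  suff : 0 <= Lim (fun M => S M (fun x => trig b (INR k * x))) <= 0 by lra.
  apply: (Lbd _ _ _ k) => M hM; rewrite /S circle_sum0 ?Rmult_0_r; first lra.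
  by rewrite k0 ltnS.
Qed.

Section Mean.
Variable Th : (R -> R) -> R.
Hypothesis hTh : mean_functional Th.

Lemma mean_lin F G c A B : (forall x, Rabs (F x) <= A) -> (forall x, Rabs (G x) <= B) ->
  Th (fun x => F x + c * G x) = Th F + c * Th G.
Proof. exact: hTh.1. Qed.

Lemma mean_const c : Th (fun=> c) = c.
Proof. by have := hTh.2.1 (fun=> c) c c (fun=> conj (Rle_refl _) (Rle_refl _)); lra. Qed.

Lemma mean_scal F c A : (forall x, Rabs (F x) <= A) -> Th (fun x => c * F x) = c * Th F.
Proof.
move=> h; have := mean_lin (fun=> 0) F c 0 A ltac:(move=> *; rewrite Rabs_R0; lra) h.
rewrite mean_const Rplus_0_l => <-.
by congr Th; apply: functional_extensionality => x; ring.
Qed.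

Lemma mean_add F G A B : (forall x, Rabs (F x) <= A) -> (forall x, Rabs (G x) <= B) ->
  Th (fun x => F x + G x) = Th F + Th G.
Proof.
move=> hF hG; have := mean_lin F G 1 A B hF hG; rewrite Rmult_1_l => <-.
by congr Th; apply: functional_extensionality => x; ring.
Qed.

Lemma mean_le F G A B : (forall x, Rabs (F x) <= A) -> (forall x, Rabs (G x) <= B) ->
  (forall x, F x <= G x) -> Th F <= Th G.
Proof.
move=> hF hG h.
have := mean_lin G F (-1) B A hG hF.
have [h0 _] := hTh.2.1 (fun x => G x + -1 * F x) 0 (A + B) ltac:(move=> x; have := hF x; have := hG x; have := h x; split_Rabs; lra).
lra.
Qed.

Lemma mean_abs F A : (forall x, Rabs (F x) <= A) -> Rabs (Th F) <= A.
Proof.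
by move=> h; apply: Rabs_le; apply: hTh.2.1 => t; have := h t; split_Rabs; lra.
Qed.

Definition cis (x : R) : C := (cos x, sin x).

Lemma Cmod_cis x : Cmod (cis x) = 1.
Proof.
rewrite /Cmod /= !Rmult_1_r; have := sin2_cos2 x; rewrite /Rsqr => e.
by rewrite Rplus_comm e sqrt_1.
Qed.

Lemma cis_mul x y : (cis x * cis y)%C = cis (x + y).
Proof. by rewrite /cis /Cmult /= cos_plus sin_plus; congr (_, _); ring. Qed.

(** Splitting off one factor of the power either keeps the frequency or raises it by one, so the
    induction on [j] closes when it runs over all [k]; negative frequencies never occur. *)
Lemma mean_pow_cis (z0 d : R) j k :
  Th (fun x => Re ((RtoC z0 - RtoC d * cis x) ^ j * cis (INR k * x))) = if k == 0%N then z0 ^ j else 0.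
Proof.
have bd (j' k' : nat) x : Rabs (Re ((RtoC z0 - RtoC d * cis x) ^ j' * cis (INR k' * x))) <= (Rabs z0 + Rabs d) ^ j'.
  apply: Rle_trans (re_le_Cmod _) _; rewrite Cmod_mult Cmod_cis Rmult_1_r Cmod_pow.
  apply: pow_incr; split; first exact: Cmod_ge_0.
  apply: Rle_trans (Cmod_triangle _ _) _; rewrite Cmod_opp Cmod_mult Cmod_cis !Cmod_R; lra.
elim: j k => [|j IH] k.
  case: k => [|k] /=.
    rewrite (_ : (fun x => _) = fun=> 1); first exact: mean_const.
    by apply: functional_extensionality => x; rewrite Rmult_0_l cos_0; ring.
  rewrite -[RHS](hTh.2.2 true k.+1 isT); congr Th; apply: functional_extensionality => x.
  by change (Re (RtoC 1 * cis (INR k.+1 * x))%C = cos (INR k.+1 * x)); rewrite Cmult_1_l.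
rewrite (_ : (fun x => _) = (fun x => z0 * Re ((RtoC z0 - RtoC d * cis x) ^ j * cis (INR k * x)) +
   - d * Re ((RtoC z0 - RtoC d * cis x) ^ j * cis (INR k.+1 * x)))).
  rewrite (mean_lin _ _ _ (Rabs z0 * (Rabs z0 + Rabs d) ^ j) ((Rabs z0 + Rabs d) ^ j)).
  - rewrite (mean_scal _ _ ((Rabs z0 + Rabs d) ^ j)) // !IH /=; case: eqP => _ /=; ring.
  - move=> x; rewrite Rabs_mult; apply: Rmult_le_compat_l => //; exact: Rabs_pos.
  - by [].
apply: functional_extensionality => x.
rewrite Cpow_S S_INR Rmult_plus_distr_r Rmult_1_l -cis_mul.
set w := (_ ^ j)%C; set e := cis (INR k * x); set f := cis x.
by rewrite /=; ring.
Qed.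

Lemma mean_pow (z0 d : R) j : Th (fun x => Re ((RtoC z0 - RtoC d * cis x) ^ j)) = z0 ^ j.
Proof.
rewrite -[RHS](mean_pow_cis z0 d j 0); congr Th; apply: functional_extensionality => x.
have -> : cis (INR 0 * x) = RtoC 1 by rewrite /cis /= Rmult_0_l cos_0 sin_0.
by rewrite Cmult_1_r.
Qed.

(* The square of [csum p / p] has mean at most 1 / p and is close to 1 where [sin x] is small; away from these
   points [exp (- B |sin x|)] is itself small. *)
Fixpoint csum (p : nat) (x : R) := if p is p'.+1 then csum p' x + cos (2 * INR p' * x) else 0.

Lemma csum_bound p x : Rabs (csum p x) <= INR p.
Proof.
elim: p => [|p IH]; first by rewrite /= Rabs_R0; lra.
rewrite [csum _ _]/= S_INR; apply: Rle_trans (Rabs_triang _ _) _.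
by have := trig_bound true (2 * INR p * x); move=> /=; lra.
Qed.

Lemma mean_csum_cos p q : (p <= q)%N -> (0 < q)%N -> Th (fun x => csum p x * cos (2 * INR q * x)) = 0.
Proof.
elim: p => [|p IH] pq q0.
  rewrite (_ : (fun x => _) = fun=> 0); first exact: mean_const.
  by apply: functional_extensionality => x /=; ring.
have cb (k : nat) x : Rabs (cos (INR k * x)) <= 1 := trig_bound true _.
have e : INR (q - p) = INR q - INR p by rewrite minus_INR //; lia.
rewrite (_ : (fun x => _) = (fun x => csum p x * cos (2 * INR q * x) + / 2 *
   (cos (INR (2 * (q - p)) * x) + cos (INR (2 * (q + p)) * x)))).
  rewrite (mean_lin _ _ _ (INR p) 2).
  - rewrite IH //; last by lia.
    rewrite (mean_add _ _ 1 1) //.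
    have h1 := hTh.2.2 true (2 * (q - p))%N; have h2 := hTh.2.2 true (2 * (q + p))%N.
    by rewrite /trig in h1 h2; rewrite h1 ?h2; [ring|lia|lia].
  - move=> x; rewrite Rabs_mult -[X in _ <= X]Rmult_1_r.
    apply: Rmult_le_compat; try exact: Rabs_pos; first exact: csum_bound.
    exact: (trig_bound true).
  - move=> x; apply: Rle_trans (Rabs_triang _ _) _.
    by have := cb (2 * (q - p))%N x; have := cb (2 * (q + p))%N x; lra.
apply: functional_extensionality => x.
rewrite -!multE -!plusE !mult_INR e plus_INR [csum _ _]/=.
rewrite (_ : INR 2 * (INR q - INR p) * x = 2 * INR q * x - 2 * INR p * x); last by rewrite /=; ring.
rewrite (_ : INR 2 * (INR q + INR p) * x = 2 * INR q * x + 2 * INR p * x); last by rewrite /=; ring.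
by rewrite cos_minus cos_plus; field.
Qed.

(** Orthogonality: cross terms have mean 0, and each squared cosine has mean at most 1. *)
Lemma mean_csum_sqr p : Th (fun x => csum p x ^ 2) <= INR p.
Proof.
have sq p' x : Rabs (csum p' x ^ 2) <= INR p' ^ 2.
  by rewrite -RPow_abs; apply: pow_incr; split; [exact: Rabs_pos|exact: csum_bound].
elim: p => [|p IH].
  by rewrite (_ : (fun x => _) = fun=> 0) ?mean_const /=; [lra|apply: functional_extensionality => x /=; ring].
have cb x : Rabs (cos (2 * INR p * x)) <= 1 := trig_bound true _.
have cc x : Rabs (csum p x * cos (2 * INR p * x)) <= INR p.
  rewrite Rabs_mult -[X in _ <= X]Rmult_1_r.
  by apply: Rmult_le_compat; try exact: Rabs_pos; first exact: csum_bound.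
have c2 x : Rabs (cos (2 * INR p * x) ^ 2) <= 1.
  by rewrite -RPow_abs -(pow1 2); apply: pow_incr; split; [exact: Rabs_pos|exact: cb].
rewrite (_ : (fun x => _) = (fun x => (csum p x ^ 2 + 2 * (csum p x * cos (2 * INR p * x))) + cos (2 * INR p * x) ^ 2)).
  rewrite (mean_add _ _ (INR p ^ 2 + 2 * INR p) 1).
  - rewrite (mean_lin _ _ _ (INR p ^ 2) (INR p)) // S_INR.
    have -> : Th (fun x => csum p x * cos (2 * INR p * x)) = 0.
      case: (posnP p) => [->|p0]; last by apply: mean_csum_cos.
      rewrite (_ : (fun x => _) = fun=> 0); first exact: mean_const.
      by apply: functional_extensionality => x /=; ring.
    have := mean_le _ (fun=> 1) 1 1 c2 ltac:(move=> *; rewrite Rabs_R1; lra)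
      ltac:(move=> x; have := c2 x; split_Rabs; lra).
    by rewrite mean_const; lra.
  - move=> x; apply: Rle_trans (Rabs_triang _ _) _; rewrite Rabs_mult (Rabs_pos_eq 2); last lra.
    by have := sq p x; have := cc x; lra.
  - exact: c2.
by apply: functional_extensionality => x; rewrite [csum _ _]/=; ring.
Qed.

Lemma sin_mult_bound (j : nat) x : Rabs (sin (INR j * x)) <= INR j * Rabs (sin x).
Proof.
elim: j => [|j IH]; first by rewrite /= Rmult_0_l sin_0 Rabs_R0; lra.
rewrite S_INR Rmult_plus_distr_r Rmult_1_l sin_plus Rmult_plus_distr_r Rmult_1_l.
apply: Rle_trans (Rabs_triang _ _) _; rewrite !Rabs_mult.
have c1 : Rabs (cos x) <= 1 := trig_bound true x.
have c2 : Rabs (cos (INR j * x)) <= 1 := trig_bound true (INR j * x).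
have := Rabs_pos (sin (INR j * x)); have := Rabs_pos (sin x).
have := Rabs_pos (cos x); have := Rabs_pos (cos (INR j * x)); nra.
Qed.

(** [1 - cos (2 p x) = 2 sin^2 (p x) <= 2 p^2 sin^2 x]. The frequencies are even so that the sum
    peaks at every zero of the sine, not only at multiples of [2 PI]. *)
Lemma csum_near p x : INR p - csum p x <= 2 * INR p ^ 3 * (sin x) ^ 2.
Proof.
have s2 : 0 <= sin x ^ 2 := pow2_ge_0 _.
elim: p => [|p IH]; first by rewrite /=; nra.
rewrite [csum _ _]/= S_INR.
have p0 := pos_INR p.
have : 1 - cos (2 * INR p * x) <= 2 * INR p ^ 2 * sin x ^ 2.
  rewrite Rmult_assoc cos_2a_sin.
  have h := sin_mult_bound p x.
  have : sin (INR p * x) ^ 2 <= (INR p * Rabs (sin x)) ^ 2.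
    by rewrite -(pow2_abs (sin (INR p * x))); apply: pow_incr; split; [exact: Rabs_pos|].
  by rewrite Rpow_mult_distr pow2_abs; nra.
have : 0 <= sin x ^ 2 * (2 * ((INR p + 1) ^ 3 - INR p ^ 3 - INR p ^ 2)).
  by apply: Rmult_le_pos => //; nra.
lra.
Qed.

Lemma sqr_exp_neg y : 0 <= y -> y ^ 2 * exp (- y) <= 4.
Proof.
move=> y0.
have h : 1 + y / 2 <= exp (y / 2) by apply: exp_ineq1_le.
have h2 : exp y = exp (y / 2) * exp (y / 2) by rewrite -exp_plus; congr exp; field.
have h3 : y ^ 2 <= 4 * exp y by rewrite h2; nra.
rewrite exp_Ropp; have e0 := exp_pos y.
apply: (Rmult_le_reg_r (exp y)) => //.
by rewrite Rmult_assoc Rinv_l; lra.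
Qed.

(** With [g = csum p / p] the exponential [e] is split as [e (1 - g^2) + e g^2]. Since
    [1 - g^2 <= 4 p^2 sin^2 x] and [y^2 exp (- y) <= 4], the first part is at most [16 p^2 / B^2];
    the second is at most [g^2]. The bound is small when [p] is large and [B] is large compared with
    [p]. *)
Lemma mean_exp_sin B p : 0 < B -> (0 < p)%N ->
  Th (fun x => exp (- (B * Rabs (sin x)))) <= / INR p + 16 * INR p ^ 2 / B ^ 2.
Proof.
move=> B0 p0.
have pR : 1 <= INR p by rewrite -[1]/(INR 1); apply: le_INR; lia.
have B2 : 0 < B ^ 2 by apply: pow_lt.
have ip : 0 < / INR p ^ 2 by apply: Rinv_0_lt_compat; apply: pow_lt; lra.
have sq x : Rabs (csum p x ^ 2) <= INR p ^ 2.
  by rewrite -RPow_abs; apply: pow_incr; split; [exact: Rabs_pos|exact: csum_bound].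
have e1 x : exp (- (B * Rabs (sin x))) <= 1.
  rewrite -exp_0; case: (Rle_lt_or_eq_dec 0 (B * Rabs (sin x))) => [|h|<-].
  - by apply: Rmult_le_pos; [lra|exact: Rabs_pos].
  - by apply: Rlt_le; apply: exp_increasing; lra.
  - by rewrite Ropp_0; lra.
pose c := 16 * INR p ^ 2 / B ^ 2.
have c0 : 0 <= c by apply: Rmult_le_pos; [have := pow2_ge_0 (INR p); lra|apply: Rlt_le; exact: Rinv_0_lt_compat].
have key x : exp (- (B * Rabs (sin x))) <= c + / INR p ^ 2 * csum p x ^ 2.
  set e := exp _; have e0 : 0 < e := exp_pos _.
  have := e1 x; rewrite -/e => e_1.
  set g := csum p x / INR p.
  have -> : / INR p ^ 2 * csum p x ^ 2 = g ^ 2 by rewrite /g; field; lra.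
  have g1 : Rabs g <= 1.
    rewrite /g /Rdiv Rabs_mult Rabs_inv (Rabs_pos_eq (INR p)); last lra.
    by apply: (Rmult_le_reg_r (INR p)); [lra|rewrite Rmult_assoc Rinv_l; have := csum_bound p x; lra].
  have g2 : 1 - g <= 2 * INR p ^ 2 * sin x ^ 2.
    apply: (Rmult_le_reg_r (INR p)); first lra.
    rewrite (_ : (1 - g) * INR p = INR p - csum p x); last by rewrite /g; field; lra.
    by apply: Rle_trans (csum_near p x) _; apply: Req_le; ring.
  have g3 : 1 - g ^ 2 <= 4 * INR p ^ 2 * sin x ^ 2.
    have : 0 <= 1 - g by split_Rabs; lra.
    have : 1 + g <= 2 by split_Rabs; lra.
    by nra.
  have y0 : 0 <= B * Rabs (sin x) by apply: Rmult_le_pos; [lra|exact: Rabs_pos].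
  have := sqr_exp_neg _ y0; rewrite -/e Rpow_mult_distr pow2_abs => h.
  have h' : sin x ^ 2 * e <= 4 / B ^ 2.
    apply: (Rmult_le_reg_l (B ^ 2)) => //.
    by rewrite -Rmult_assoc (_ : B ^ 2 * (4 / B ^ 2) = 4) //; field; lra.
  have p2 : 0 < INR p ^ 2 by apply: pow_lt; lra.
  have : e * (1 - g ^ 2) <= e * (4 * INR p ^ 2 * sin x ^ 2) by apply: Rmult_le_compat_l => //; lra.
  have : 4 * INR p ^ 2 * (sin x ^ 2 * e) <= 4 * INR p ^ 2 * (4 / B ^ 2) by apply: Rmult_le_compat_l => //; lra.
  have -> : c = 4 * INR p ^ 2 * (4 / B ^ 2) by rewrite /c; field; lra.
  have : e * g ^ 2 <= g ^ 2 by have := pow2_ge_0 g; nra.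
  nra.
have := mean_le (fun x => exp (- (B * Rabs (sin x)))) (fun x => c + / INR p ^ 2 * csum p x ^ 2) 1 (c + 1) _ _ key.
rewrite (mean_lin (fun=> c) _ _ c (INR p ^ 2)) //; last by move=> _; rewrite Rabs_pos_eq; lra.
rewrite mean_const => h.
apply: Rle_trans (h _ _) _.
- by move=> x; rewrite Rabs_pos_eq //; apply: Rlt_le; exact: exp_pos.
- move=> x; apply: Rle_trans (Rabs_triang _ _) _; rewrite (Rabs_pos_eq c) // Rabs_mult Rabs_pos_eq; last lra.
  have := Rmult_le_compat_l _ _ _ (Rlt_le _ _ ip) (sq x); rewrite Rinv_l; first lra.
  by apply: pow_nonzero; lra.
- have := Rmult_le_compat_l _ _ _ (Rlt_le _ _ ip) (mean_csum_sqr p).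
  rewrite (_ : / INR p ^ 2 * INR p = / INR p); last by field; lra.
  by rewrite /c; lra.
Qed.

End Mean.

(** * Radial eigenfunctions in y *)

Lemma is_series_exp x : is_series (fun j => x ^ j / INR (fact j)) (exp x).
Proof.
have := is_exp_Reals x; rewrite is_pseries_R; apply: is_series_ext => j.
by rewrite /Rdiv Rmult_comm.
Qed.

Lemma ex_series_exp x : ex_series (fun j => x ^ j / INR (fact j)).
Proof. by exists (exp x); exact: is_series_exp. Qed.

Lemma series_dominated (a : nat -> R) A x : (forall j, Rabs (a j) <= A * (x ^ j / INR (fact j))) ->
  ex_series a.
Proof.
move=> h; apply: (ex_series_le (K := R_AbsRing) (V := R_CompleteNormedModule) _ (fun j => A * (x ^ j / INR (fact j)))).
  by move=> j; exact: h.
have := ex_series_scal (K := R_AbsRing) (V := R_NormedModule) A _ (ex_series_exp x).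
by apply: ex_series_ext => j.
Qed.

(** The right side depends on [A] and [x] only, hence is uniform over families of series with a
    common exponential majorant. *)
Lemma series_tail (a : nat -> R) A x m : 0 <= A -> (forall j, Rabs (a j) <= A * (x ^ j / INR (fact j))) ->
  Rabs (Series a - sum_f_R0 a m) <= A * (exp x - sum_f_R0 (fun j => x ^ j / INR (fact j)) m).
Proof.
move=> A0 h.
have ea := series_dominated _ _ _ h.
have ee := ex_series_exp x.
rewrite (Series_incr_n a m.+1) //; last lia.
rewrite [Nat.pred _]/=.
have -> : exp x = sum_f_R0 (fun j => x ^ j / INR (fact j)) m + Series (fun k => x ^ (m.+1 + k) / INR (fact (m.+1 + k))).
  by rewrite -(is_series_unique _ _ (is_series_exp x)) (Series_incr_n _ m.+1) //; lia.
have cancel (u v : R) : u + v - u = v by ring.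
rewrite !cancel.
have h' k : Rabs (a (m.+1 + k)%N) <= A * (x ^ (m.+1 + k) / INR (fact (m.+1 + k))) by exact: h.
have e1 : ex_series (fun k => x ^ (m.+1 + k) / INR (fact (m.+1 + k))).
  by have := proj1 (ex_series_incr_n (K := R_AbsRing) (V := R_NormedModule) _ m.+1) ee.
have e2 : ex_series (fun k => A * (x ^ (m.+1 + k) / INR (fact (m.+1 + k)))).
  exact: (ex_series_scal (K := R_AbsRing) (V := R_NormedModule) A _ e1).
apply: Rle_trans (Series_Rabs _ _) _.
  by apply: (ex_series_le (K := R_AbsRing) (V := R_CompleteNormedModule) _ _ _ e2) => k; rewrite /norm /= /abs /= Rabs_Rabsolu; exact: h'.
rewrite -Series_scal_l; apply: Series_le => // k; split; [exact: Rabs_pos|exact: h'].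
Qed.

Lemma exp_partial_sums x eps : 0 < eps -> exists m,
  Rabs (exp x - sum_f_R0 (fun j => x ^ j / INR (fact j)) m) < eps.
Proof.
move=> e0; have := is_series_exp x; move/is_series_Reals => /(_ eps e0) [m hm].
by exists m; have := hm m (Nat.le_refl _); rewrite /Rdist Rabs_minus_sym.
Qed.

Section RadialSeries.
Variable N : nat.
Hypothesis N0 : (0 < N)%N.

Let NR : 1 <= INR N.
Proof. by rewrite -[1]/(INR 1); apply: le_INR; lia. Qed.

(** [beta j] is [(N/2)^j] divided by the rising factorial of [N/2] of length [j]. With
    [r = |y|^2 / (2 N)] the series [b_z(r)] is the hypergeometric function 0F1 with parameter [N/2]
    at [z |y|^2 / 4], a normalized Bessel function of [|y|]. *)
Fixpoint beta (j : nat) : R := if j is j'.+1 then beta j' / (1 + 2 * INR j' / INR N) else 1.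

Lemma beta_den j : 1 <= 1 + 2 * INR j / INR N.
Proof.
have : 0 <= 2 * INR j / INR N; last lra.
by apply: Rdiv_le_0_compat; [have := pos_INR j|]; lra.
Qed.

Lemma beta_S j : beta j.+1 * (1 + 2 * INR j / INR N) = beta j.
Proof. by rewrite /= ; have := beta_den j; move=> h; field; split; [|]; have := pos_INR j; lra. Qed.

Lemma beta_pos j : 0 < beta j.
Proof. by elim: j => [|j IH] /=; [lra|apply: Rdiv_lt_0_compat => //; have := beta_den j; lra]. Qed.

Lemma beta_le j l : beta (j + l) <= beta j.
Proof.
elim: l => [|l IH]; first by rewrite addn0; lra.
rewrite addnS; apply: Rle_trans IH.
by have := beta_S (j + l); have := beta_den (j + l); have := beta_pos (j + l).+1; nra.
Qed.

Lemma beta_le1 j : beta j <= 1.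
Proof. exact: (beta_le 0 j). Qed.

(** Passing from [j] to [j + 1] loses at most [2 j / N], and these losses add up to
    [j (j - 1) / N]. *)
Lemma beta_lower j : 1 - beta j <= INR j * (INR j - 1) / INR N.
Proof.
elim: j => [|j IH]; first by rewrite /=; lra.
have h := beta_S j; have d := beta_den j; have p := beta_pos j.+1; have b1 := beta_le1 j.+1.
have : beta j - beta j.+1 <= 2 * INR j / INR N.
  by rewrite -h; nra.
have -> : INR j.+1 * (INR j.+1 - 1) / INR N = INR j * (INR j - 1) / INR N + 2 * INR j / INR N.
  by rewrite S_INR; field; lra.
lra.
Qed.

(** Once [j] exceeds [K N], each further factor is at most [1 / K]; the constant pays for the
    finitely many earlier ones. *)
Lemma beta_geometric (K : R) : 1 <= K -> exists C, 0 < C /\ forall j, beta j <= C * (/ K) ^ j.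
Proof.
move=> K1.
have [m hm] := nfloor_ex (K * INR N) ltac:(nra).
exists (K ^ m.+1); split; first by apply: pow_lt; lra.
have iK : 0 < / K by apply: Rinv_0_lt_compat; lra.
elim=> [|j IH].
  by rewrite /= Rmult_1_r; have := pow_R1_Rle K m.+1 K1; rewrite /=; lra.
case: (leqP j m) => jm.
  apply: Rle_trans (beta_le1 _) _.
  have -> : K ^ m.+1 * (/ K) ^ j.+1 = K ^ (m - j).
    rewrite pow_inv; have -> : m.+1 = (m - j + j.+1)%N by lia.
    by rewrite pow_add; field; apply: pow_nonzero; lra.
  exact: pow_R1_Rle.
have h := beta_S j; have p := beta_pos j.+1.
have d : K <= 1 + 2 * INR j / INR N.
  have : INR m + 1 <= INR j by rewrite -S_INR; apply: le_INR; lia.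
  move=> hj; have hK : K * INR N <= INR j by lra.
  have : K <= INR j / INR N.
    by apply: (Rmult_le_reg_r (INR N)); [lra|rewrite /Rdiv Rmult_assoc Rinv_l; lra].
  by have := beta_den j; rewrite /Rdiv Rmult_assoc => _; nra.
rewrite [(/ K) ^ _]/= (_ : K ^ m.+1 * (/ K * (/ K) ^ j) = / K * (K ^ m.+1 * (/ K) ^ j)); last by ring.
apply: (Rmult_le_reg_l K); first lra.
rewrite -Rmult_assoc Rinv_r ?Rmult_1_l; last lra.
by apply: Rle_trans IH; rewrite -h; nra.
Qed.

(* [bser c z l] is the l-th derivative of Re (c b_z). *)
Definition bcoef (c z : C) (l j : nat) : R := beta (j + l) * Re (c * z ^ (j + l)) / INR (fact j).
Definition bser c z l r := PSeries (bcoef c z l) r.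
Definition bmaj x := Series (fun j => beta j * (x ^ j / INR (fact j))).

Lemma bcoef_bound c z l j : Rabs (bcoef c z l j) <= Cmod c * Cmod z ^ l * (beta j * (Cmod z ^ j / INR (fact j))).
Proof.
have f0 := INR_fact_lt_0 j; have b0 := beta_pos (j + l).
rewrite /bcoef /Rdiv !Rabs_mult (Rabs_pos_eq (beta _)); last lra.
rewrite (Rabs_pos_eq (/ _)); last by apply: Rlt_le; apply: Rinv_0_lt_compat.
have h : Rabs (Re (c * z ^ (j + l))) <= Cmod c * Cmod z ^ l * Cmod z ^ j.
  apply: Rle_trans (re_le_Cmod _) _.
  by rewrite Cmod_mult Cmod_pow pow_add; apply: Req_le; ring.
rewrite (_ : Cmod c * Cmod z ^ l * (beta j * _) = beta j * (Cmod c * Cmod z ^ l * Cmod z ^ j) * / INR (fact j)); last ring.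
apply: Rmult_le_compat_r; first by apply: Rlt_le; apply: Rinv_0_lt_compat.
apply: Rmult_le_compat => //; [lra|exact: Rabs_pos|exact: beta_le].
Qed.

Lemma bcoef_term_bound c z l r j : Rabs (bcoef c z l j * r ^ j) <=
  Cmod c * Cmod z ^ l * (beta j * ((Cmod z * Rabs r) ^ j / INR (fact j))).
Proof.
rewrite Rabs_mult -RPow_abs Rpow_mult_distr.
have := Rmult_le_compat_r _ _ _ (pow_le _ j (Rabs_pos r)) (bcoef_bound c z l j).
by rewrite /Rdiv; move=> h; apply: Rle_trans h _; apply: Req_le; ring.
Qed.

Lemma cz_ge0 c z (l : nat) : 0 <= Cmod c * Cmod z ^ l.
Proof. by apply: Rmult_le_pos; [exact: Cmod_ge_0|apply: pow_le; exact: Cmod_ge_0]. Qed.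

Lemma bcoef_exp_bound c z l r j : Rabs (bcoef c z l j * r ^ j) <=
  Cmod c * Cmod z ^ l * ((Cmod z * Rabs r) ^ j / INR (fact j)).
Proof.
apply: Rle_trans (bcoef_term_bound _ _ _ _ _) _; apply: Rmult_le_compat_l; first exact: cz_ge0.
have h : 0 <= (Cmod z * Rabs r) ^ j / INR (fact j).
  apply: Rdiv_le_0_compat; last exact: INR_fact_lt_0.
  by apply: pow_le; apply: Rmult_le_pos; [exact: Cmod_ge_0|exact: Rabs_pos].
by have := beta_le1 j; nra.
Qed.

Lemma bser_ex c z l r : ex_series (fun j => bcoef c z l j * r ^ j).
Proof. exact: series_dominated (bcoef_exp_bound c z l r). Qed.

Lemma bcoef_radius c z l r : Rbar_lt (Rabs r) (CV_radius (bcoef c z l)).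
Proof.
have [ub _] := CV_radius_bounded (bcoef c z l).
apply: (Rbar_lt_le_trans _ (Rabs r + 1)); first by rewrite /=; lra.
apply: ub; set x := Rabs r + 1.
have x0 : 0 <= x by rewrite /x; have := Rabs_pos r; lra.
exists (Cmod c * Cmod z ^ l * exp (Cmod z * Rabs x)) => j.
apply: Rle_trans (bcoef_exp_bound _ _ _ _ _) _; apply: Rmult_le_compat_l; first exact: cz_ge0.
set y := Cmod z * Rabs x.
have y0 : 0 <= y by apply: Rmult_le_pos; [exact: Cmod_ge_0|exact: Rabs_pos].
have t k : 0 <= y ^ k / INR (fact k) by apply: Rdiv_le_0_compat; [exact: pow_le|exact: INR_fact_lt_0].
apply: (Rle_trans _ (sum_f_R0 (fun k => y ^ k / INR (fact k)) j)).
  case: (j) => [|i]; first by rewrite /=; lra.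
  by rewrite tech5; have := cond_pos_sum _ i t; lra.
apply: sum_incr t; exact/is_series_Reals/is_series_exp.
Qed.

Lemma bser_derive c z l r : is_derive (bser c z l) r (bser c z l.+1 r).
Proof.
have := is_derive_PSeries _ _ (bcoef_radius c z l r).
rewrite /bser (PSeries_ext (PS_derive (bcoef c z l)) (bcoef c z l.+1)) // => j.
rewrite /PS_derive /bcoef addnS addSn fact_simpl mult_INR; field.
by split; [exact: INR_fact_neq_0|apply: not_0_INR].
Qed.

(** On functions of [r = |y|^2 / (2 N)] the Laplacian in [y] is [d/dr + (2 r / N) d^2/dr^2], because
    [r] has Laplacian 1 and squared gradient [2 r / N]. In degree [j] this operator produces the
    factor [1 + 2 j / N] that defines [beta]. *)
Lemma bser_ode c z r : bser c z 1 r + 2 * r / INR N * bser c z 2 r = bser (c * z)%C z 0 r.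
Proof.
have -> : 2 * r / INR N * bser c z 2 r = PSeries (PS_incr_1 (PS_scal (2 / INR N) (bcoef c z 2))) r.
  by rewrite PSeries_incr_1 PSeries_scal /bser; field; lra.
rewrite /bser -PSeries_plus.
- apply: PSeries_ext => j; rewrite /PS_plus /plus /=.
  have zE k : (c * z * z ^ k)%C = (c * z ^ k.+1)%C by rewrite Cpow_S; ring.
  case: j => [|j] /=.
    rewrite /bcoef zE !add0n (_ : beta 1 = 1).
      by rewrite [beta 0]/=; exact: Rplus_0_r.
    by rewrite /=; field; lra.
  rewrite /PS_scal /scal /= /mult /= /bcoef zE !addn0 !addn1 addn2 fact_simpl mult_INR -(beta_S j.+1).
  by field; split; [lra|split; [exact: INR_fact_neq_0|apply: not_0_INR]].
- exact: CV_disk_correct (CV_disk_inside _ _ (bcoef_radius c z 1 r)) .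
- apply: ex_pseries_incr_1; apply: ex_pseries_scal; first by rewrite /mult /=; apply: Rmult_comm.
  exact: CV_disk_correct (CV_disk_inside _ _ (bcoef_radius c z 2 r)).
Qed.

Lemma bmaj_term x j : 0 <= x -> 0 <= beta j * (x ^ j / INR (fact j)) <= 1 * (x ^ j / INR (fact j)).
Proof.
move=> x0; have t : 0 <= x ^ j / INR (fact j) by apply: Rdiv_le_0_compat; [exact: pow_le|exact: INR_fact_lt_0].
by have := beta_le1 j; have := beta_pos j; split; nra.
Qed.

Lemma bmaj_ex x : 0 <= x -> ex_series (fun j => beta j * (x ^ j / INR (fact j))).
Proof.
move=> x0; apply: (series_dominated _ 1 x) => j.
by have := bmaj_term x j x0; move=> h; rewrite Rabs_pos_eq; lra.
Qed.

Lemma bser_bound c z l r : Rabs (bser c z l r) <= Cmod c * Cmod z ^ l * bmaj (Cmod z * Rabs r).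
Proof.
have zr0 : 0 <= Cmod z * Rabs r by apply: Rmult_le_pos; [exact: Cmod_ge_0|exact: Rabs_pos].
have ex : ex_series (fun j => Cmod c * Cmod z ^ l * (beta j * ((Cmod z * Rabs r) ^ j / INR (fact j)))).
  exact: (ex_series_scal (K := R_AbsRing) (V := R_NormedModule) _ _ (bmaj_ex _ zr0)).
apply: Rle_trans (Series_Rabs _ _) _.
  apply: (ex_series_le (K := R_AbsRing) (V := R_CompleteNormedModule) _ _ _ ex) => j.
  by rewrite /norm /= /abs /= Rabs_Rabsolu; exact: bcoef_term_bound.
rewrite /bmaj -Series_scal_l; apply: Series_le ex => j.
by split; [exact: Rabs_pos|exact: bcoef_term_bound].
Qed.

Lemma bmaj_le_exp x : 0 <= x -> 0 <= bmaj x <= exp x.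
Proof.
move=> x0; rewrite /bmaj; split.
  have -> : 0 = Series (fun j => 0 * (x ^ j / INR (fact j))) by rewrite Series_scal_l; ring.
  by apply: Series_le (bmaj_ex _ x0) => j; have := bmaj_term x j x0; lra.
rewrite -(is_series_unique _ _ (is_series_exp x)); apply: Series_le (ex_series_exp x) => j.
by have := bmaj_term x j x0; lra.
Qed.

Lemma bmaj_mono x y : 0 <= x <= y -> bmaj x <= bmaj y.
Proof.
move=> h; apply: Series_le; last by apply: bmaj_ex; lra.
move=> j; have := bmaj_term x j ltac:(lra) => -[h1 _]; split=> //.
apply: Rmult_le_compat_l; first by have := beta_pos j; lra.
by apply: Rmult_le_compat_r; [apply: Rlt_le; apply: Rinv_0_lt_compat; exact: INR_fact_lt_0|exact: pow_incr].
Qed.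

Lemma bmaj_slow K : 1 <= K -> exists C, 0 < C /\ forall x, 0 <= x -> bmaj x <= C * exp (x / K).
Proof.
move=> K1; have [C [C0 hC]] := beta_geometric K K1; exists C; split=> // x x0.
rewrite -(is_series_unique _ _ (is_series_exp (x / K))) -Series_scal_l /bmaj.
apply: Series_le.
  move=> j; split; first by have := bmaj_term x j x0; lra.
  rewrite (_ : C * _ = C * (/ K) ^ j * (x ^ j / INR (fact j))).
    by apply: Rmult_le_compat_r => //; apply: Rdiv_le_0_compat; [exact: pow_le|exact: INR_fact_lt_0].
  by rewrite /Rdiv Rpow_mult_distr; ring.
exact: (ex_series_scal (K := R_AbsRing) (V := R_NormedModule) _ _ (ex_series_exp _)).
Qed.

(** By [beta_lower] the error is at most the sum of [j (j - 1) x^j / (N j!)]; cancelling two factors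
    of the factorial makes this [x^2 exp x / N]. *)
Lemma bmaj_limit x : 0 <= x -> Rabs (exp x - bmaj x) <= x ^ 2 * exp x / INR N.
Proof.
move=> x0; have [_ le] := bmaj_le_exp x x0; rewrite Rabs_pos_eq; last lra.
rewrite -{1}(is_series_unique _ _ (is_series_exp x)) /bmaj -Series_minus; [|exact: ex_series_exp|exact: bmaj_ex].
have t j : 0 <= x ^ j / INR (fact j) by apply: Rdiv_le_0_compat; [exact: pow_le|exact: INR_fact_lt_0].
pose e j := / INR N * (INR j * (INR j - 1) * (x ^ j / INR (fact j))).
have eE j : e j.+2 = x ^ 2 / INR N * (x ^ j / INR (fact j)).
  rewrite /e !fact_simpl !mult_INR !S_INR /=; field.
  by have := pos_INR j; have := INR_fact_lt_0 j; move=> f0 j0; split; [lra|split; [lra|split; lra]].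
have ee : ex_series e.
  have := proj2 (ex_series_incr_n (K := R_AbsRing) (V := R_NormedModule) e 2); apply.
  apply: (ex_series_ext (fun j => x ^ 2 / INR N * (x ^ j / INR (fact j)))).
    by move=> j; rewrite -eE.
  exact: (ex_series_scal (K := R_AbsRing) (V := R_NormedModule) _ _ (ex_series_exp _)).
apply: (Rle_trans _ (Series e)).
  apply: Series_le ee => j.
  have h := beta_lower j; have h1 := beta_le1 j; have tj := t j.
  rewrite /e (_ : / INR N * _ = INR j * (INR j - 1) / INR N * (x ^ j / INR (fact j))); last by rewrite /Rdiv; ring.
  by split; nra.
rewrite (Series_incr_n e 2) //; last lia.
rewrite [sum_f_R0 _ _]/= (_ : e 0%N = 0); last by rewrite /e /=; ring.
rewrite (_ : e 1%N = 0); last by rewrite /e /=; ring.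
rewrite (Series_ext _ (fun j => x ^ 2 / INR N * (x ^ j / INR (fact j)))); last by move=> j; rewrite -eE.
rewrite Series_scal_l (is_series_unique _ _ (is_series_exp x)); apply: Req_le; field; lra.
Qed.

Lemma bser_real x r : 0 <= x * r -> bser (RtoC 1) (RtoC x) 0 r = bmaj (x * r).
Proof.
move=> xr; apply: Series_ext => j.
by rewrite /bcoef addn0 -RtoC_pow -RtoC_mult /= Rpow_mult_distr; field; exact: INR_fact_neq_0.
Qed.

(** The mean value property of the entire function [z -> b_z(r)]. As [Th] is only finitely additive,
    it is applied to partial sums, and the tails are bounded uniformly over the circle. *)
Lemma bser_mean Th z0 d r : mean_functional Th ->
  Th (fun t => bser (RtoC 1) (RtoC z0 - RtoC d * cis t)%C 0 r) = bser (RtoC 1) (RtoC z0) 0 r.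
Proof.
move=> hTh.
pose q := (Rabs z0 + Rabs d) * Rabs r.
pose zt t := (RtoC z0 - RtoC d * cis t)%C.
have zb t : Cmod (zt t) <= Rabs z0 + Rabs d.
  apply: Rle_trans (Cmod_triangle _ _) _; rewrite Cmod_opp Cmod_mult Cmod_cis !Cmod_R; lra.
have z0b : Cmod (RtoC z0) <= Rabs z0 + Rabs d by rewrite Cmod_R; have := Rabs_pos d; lra.
have tb z j : Cmod z <= Rabs z0 + Rabs d -> Rabs (bcoef (RtoC 1) z 0 j * r ^ j) <= 1 * (q ^ j / INR (fact j)).
  move=> hz; apply: Rle_trans (bcoef_exp_bound _ _ _ _ _) _.
  rewrite Cmod_R Rabs_R1 /= Rmult_1_l; apply: Rmult_le_compat_l; first lra.
  apply: Rmult_le_compat_r; first by apply: Rlt_le; apply: Rinv_0_lt_compat; exact: INR_fact_lt_0.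
  apply: pow_incr; split; first by apply: Rmult_le_pos; [exact: Cmod_ge_0|exact: Rabs_pos].
  by apply: Rmult_le_compat_r => //; exact: Rabs_pos.
pose P m z := sum_f_R0 (fun j => bcoef (RtoC 1) z 0 j * r ^ j) m.
have Pb m : exists A, forall t, Rabs (P m (zt t)) <= A.
  elim: m => [|m [A hA]].
    by exists (1 * (q ^ 0 / INR (fact 0))) => t; exact: (tb (zt t) 0%N (zb t)).
  exists (A + 1 * (q ^ m.+1 / INR (fact m.+1))) => t; rewrite /P tech5.
  apply: Rle_trans (Rabs_triang _ _) _; apply: Rplus_le_compat; first exact: hA.
  exact: (tb (zt t) m.+1 (zb t)).
have mc j : Th (fun t => bcoef (RtoC 1) (zt t) 0 j * r ^ j) = bcoef (RtoC 1) (RtoC z0) 0 j * r ^ j.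
  have e z : bcoef (RtoC 1) z 0 j * r ^ j = beta j * r ^ j / INR (fact j) * Re (z ^ j).
    by rewrite /bcoef addn0 Cmult_1_l; field; exact: INR_fact_neq_0.
  rewrite e -RtoC_pow (_ : (fun t => _) = (fun t => beta j * r ^ j / INR (fact j) * Re (zt t ^ j))).
    rewrite (mean_scal _ hTh _ _ ((Rabs z0 + Rabs d) ^ j)).
      by rewrite (mean_pow _ hTh).
    move=> t; apply: Rle_trans (re_le_Cmod _) _; rewrite Cmod_pow; apply: pow_incr.
    by split; [exact: Cmod_ge_0|exact: zb].
  by apply: functional_extensionality => t; exact: e.
have mP m : Th (fun t => P m (zt t)) = P m (RtoC z0).
  elim: m => [|m IH]; first exact: mc.
  have [A hA] := Pb m.
  rewrite /P tech5 -mc -/(P m (RtoC z0)) -IH.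
  rewrite -(mean_add _ hTh _ _ A (1 * (q ^ m.+1 / INR (fact m.+1)))) //.
  by move=> t; exact: tb.
have bb t : Rabs (bser (RtoC 1) (zt t) 0 r) <= exp q.
  apply: Rle_trans (bser_bound _ _ _ _) _; rewrite Cmod_R Rabs_R1 /= !Rmult_1_l.
  apply: (Rle_trans _ (bmaj q)).
    apply: bmaj_mono; split; first by apply: Rmult_le_pos; [exact: Cmod_ge_0|exact: Rabs_pos].
    by apply: Rmult_le_compat_r; [exact: Rabs_pos|exact: zb].
  apply: (bmaj_le_exp _ _).2; apply: Rmult_le_pos; last exact: Rabs_pos.
  by have := Rabs_pos z0; have := Rabs_pos d; lra.
apply: cond_eq => eps e0.
have [m hm] := exp_partial_sums q (eps / 2) ltac:(lra).
have [A hA] := Pb m.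
have tail z : Cmod z <= Rabs z0 + Rabs d -> Rabs (bser (RtoC 1) z 0 r - P m z) <= eps / 2.
  move=> hz; apply: Rle_trans (series_tail _ 1 q m ltac:(lra) (fun j => tb z j hz)) _.
  by move: hm; split_Rabs; lra.
have h1 := tail _ z0b.
have := mean_abs _ hTh (fun t => bser (RtoC 1) (zt t) 0 r + -1 * P m (zt t)) (eps / 2)
  ltac:(move=> t; have := tail _ (zb t); split_Rabs; lra).
rewrite (mean_lin _ hTh _ _ _ (exp q) A) // mP => h2.
suff : Rabs (Th (fun t => bser (RtoC 1) (zt t) 0 r) + -1 * P m (RtoC z0) - (bser (RtoC 1) (RtoC z0) 0 r - P m (RtoC z0))) < eps.
  by rewrite (_ : _ + _ - _ = Th (fun t => bser (RtoC 1) (zt t) 0 r) - bser (RtoC 1) (RtoC z0) 0 r) //; ring.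
have hm' : Rabs (bser (RtoC 1) (RtoC z0) 0 r - P m (RtoC z0)) < eps / 2.
  apply: Rle_lt_trans (series_tail _ 1 q m ltac:(lra) (fun j => tb _ j z0b)) _.
  by move: hm; split_Rabs; lra.
by move: h2 hm'; split_Rabs; lra.
Qed.

End RadialSeries.

From Stdlib Require Import Ranalysis5.

(** * Time factors *)

Lemma is_derive_continuity_pt (f : R -> R) x l : is_derive f x l -> continuity_pt f x.
Proof.
by move=> h; apply: derivable_continuous_pt; exists l; apply/is_derive_Reals.
Qed.

Lemma MVT_cor2' (f f' : R -> R) a b : a < b -> (forall x, a <= x <= b -> continuity_pt f x) ->
  (forall x, a < x < b -> is_derive f x (f' x)) ->
  exists c, f b - f a = f' c * (b - a) /\ a < c < b.
Proof.
move=> ab cf df.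
have pr x : a < x < b -> derivable_pt f x by move=> hx; exists (f' x); apply/is_derive_Reals; exact: df.
have [c [hc e]] := MVT f id a b pr (fun x _ => derivable_pt_id x) ab cf
  (fun x _ => derivable_continuous_pt _ _ (derivable_pt_id x)).
exists c; split=> //.
have e1 := derive_pt_eq_0 f c (f' c) (pr c hc) (proj1 (is_derive_Reals _ _ _) (df c hc)).
have e2 : derive_pt id c (derivable_pt_id c) = 1 by exact: derive_pt_id.
by move: e; rewrite e1 e2 /id; lra.
Qed.

Lemma derive_compare (u u' B B' : R -> R) a s : a <= s ->
  (forall x, a <= x <= s -> continuity_pt u x) -> (forall x, a <= x <= s -> continuity_pt B x) ->
  (forall x, a < x < s -> is_derive u x (u' x)) ->
  (forall x, a < x < s -> is_derive B x (B' x)) ->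
  (forall x, a < x < s -> Rabs (u' x) <= B' x) ->
  Rabs (u s - u a) <= B s - B a.
Proof.
move=> as_ cu cB du dB h.
have mono (F F' : R -> R) : (forall x, a <= x <= s -> continuity_pt F x) ->
    (forall x, a < x < s -> is_derive F x (F' x)) ->
    (forall x, a < x < s -> 0 <= F' x) -> F a <= F s.
  move=> cF dF F0.
  case: (Req_dec a s) => [->|ne]; first lra.
  have [c [e hc]] := MVT_cor2' F F' a s ltac:(lra) cF dF.
  by have := F0 c hc; nra.
have m1 : B a - u a <= B s - u s.
  apply: (mono (fun x => B x - u x) (fun x => B' x - u' x)) => x hx.
    by apply: continuity_pt_minus; [exact: cB|exact: cu].
    by apply: is_derive_minus; [exact: dB|exact: du].
  by have := h x hx; split_Rabs; lra.
have m2 : B a + u a <= B s + u s.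
  apply: (mono (fun x => B x + u x) (fun x => B' x + u' x)) => x hx.
    by apply: continuity_pt_plus; [exact: cB|exact: cu].
    by apply: is_derive_plus; [exact: dB|exact: du].
  by have := h x hx; split_Rabs; lra.
by split_Rabs; lra.
Qed.

(** * Linear differential equations by Picard iteration *)

Section LinearODE.
Variables (J : Type) (F : J -> R -> (J -> R) -> R) (K a : R) (v : J -> R) (V : R).
Hypothesis K0 : 0 <= K.
Hypothesis Fadd : forall j s y z, F j s (fun k => y k + z k) = F j s y + F j s z.
Hypothesis Fbd : forall j s y B, (forall k, Rabs (y k) <= B) -> Rabs (F j s y) <= K * B.
Hypothesis Fcont : forall j s (y : J -> R -> R), (forall k, continuous (y k) s) ->
  continuous (fun s => F j s (fun k => y k s)) s.
Hypothesis vV : forall j, Rabs (v j) <= V.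

(** These are the increments of the Picard iterates, not the iterates: by linearity each is the
    integral of [F] of the previous one, and the solution is their sum. *)
Fixpoint picard (m : nat) (j : J) (s : R) : R :=
  if m is m'.+1 then RInt (fun x => F j x (fun k => picard m' k x)) a s else v j.

Lemma picard_cont m j s : continuous (picard m j) s.
Proof.
elim: m j s => [|m IH] j s; first exact: continuous_const.
have c x : continuous (fun x => F j x (fun k => picard m k x)) x by apply: Fcont => k; exact: IH.
apply: ex_derive_continuous; exists (F j s (fun k => picard m k s)).
apply: (is_derive_RInt (fun x => F j x (fun k => picard m k x)) (picard m.+1 j) a) => //.
by apply: filter_forall => x; apply: RInt_correct; apply: ex_RInt_continuous.
Qed.

Lemma picard_derive m j s : is_derive (picard m.+1 j) s (F j s (fun k => picard m k s)).
Proof.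
have c x : continuous (fun x => F j x (fun k => picard m k x)) x by apply: Fcont => k; exact: picard_cont.
apply: (is_derive_RInt (fun x => F j x (fun k => picard m k x)) (picard m.+1 j) a) => //.
by apply: filter_forall => x; apply: RInt_correct; apply: ex_RInt_continuous.
Qed.

Lemma picard_bound m j s : a <= s -> Rabs (picard m j s) <= V * ((K * (s - a)) ^ m / INR (fact m)).
Proof.
elim: m j s => [|m IH] j s as_; first by rewrite /= Rdiv_1_r Rmult_1_r; exact: vV.
have fp := INR_fact_lt_0 m; have mp : INR m.+1 <> 0 by apply: not_0_INR.
rewrite fact_simpl mult_INR; move: (INR (fact m)) fp IH => f fp IH.
pose B x := V * ((K * (x - a)) ^ m.+1 / (INR m.+1 * f)).
have dB x : is_derive B x (K * (V * ((K * (x - a)) ^ m / f))).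
  rewrite /B; move: (INR m.+1) mp (S_INR m) => c c0 ce.
  auto_derive => //.
  have -> : match m with 0%N => 1 | _.+1 => INR m + 1 end = c.
    by rewrite ce; case: (m) => //; rewrite /=; ring.
  by rewrite -/(x - a); field; lra.
have := derive_compare (picard m.+1 j) (fun x => F j x (fun k => picard m k x)) B _ a s as_
  (fun x _ => is_derive_continuity_pt _ _ _ (picard_derive m j x))
  (fun x _ => is_derive_continuity_pt _ _ _ (dB x))
  (fun x _ => picard_derive m j x) (fun x _ => dB x).
rewrite (_ : picard m.+1 j a = 0); last by rewrite /= RInt_point.
rewrite (_ : B a = 0); last by rewrite /B Rminus_diag Rmult_0_r pow_ne_zero //; rewrite /Rdiv; ring.
by rewrite !Rminus_0_r; apply => x hx; apply: Fbd => k; apply: IH; lra.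
Qed.

Definition picard_sum j s := Series (fun m => picard m j s).

Lemma picard_sum_tail j s rho M : 0 <= V -> a <= s <= a + rho ->
  Rabs (picard_sum j s - sum_f_R0 (fun m => picard m j s) M) <=
  V * (exp (K * rho) - sum_f_R0 (fun m => (K * rho) ^ m / INR (fact m)) M).
Proof.
move=> V0 hs; apply: series_tail => // m; apply: Rle_trans (picard_bound m j s _) _; first lra.
apply: Rmult_le_compat_l => //; apply: Rmult_le_compat_r.
  by apply: Rlt_le; apply: Rinv_0_lt_compat; exact: INR_fact_lt_0.
apply: pow_incr; split; first by apply: Rmult_le_pos; lra.
by apply: Rmult_le_compat_l; lra.
Qed.

Hypothesis V0 : 0 <= V.

Lemma Fsub j s y z : F j s (fun k => y k - z k) = F j s y - F j s z.
Proof.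
have := Fadd j s (fun k => y k - z k) z.
rewrite (_ : (fun k => y k - z k + z k) = y); first by move=> ->; ring.
by apply: functional_extensionality => k; ring.
Qed.

Lemma picard_cvu j s (r : posreal) : a < s - r ->
  CVU (fun M s => sum_f_R0 (fun m => picard m j s) M) (picard_sum j) s r.
Proof.
move=> hr eps e0.
pose q := K * (s + r - a).
have V1 : 0 < V + 1 by lra.
have := is_series_exp q; move/is_series_Reals => /(_ (eps / (V + 1))) [|M hM].
  exact: Rdiv_lt_0_compat.
exists M => m y hm hy.
have hy' : a <= y <= a + (s + r - a) by move: hy; rewrite /Boule; split_Rabs; lra.
apply: Rle_lt_trans (picard_sum_tail j y (s + r - a) m V0 hy') _.
have := hM m hm; rewrite /Rdist Rabs_minus_sym => h.
have h' : exp q - sum_f_R0 (fun j => q ^ j / INR (fact j)) m < eps / (V + 1) by split_Rabs; lra.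
have : (V + 1) * (eps / (V + 1)) = eps by field; lra.
have : 0 < eps / (V + 1) by exact: Rdiv_lt_0_compat.
rewrite -/q; set A := exp q - _ in h' *; nra.
Qed.

Lemma picard_sum_continuity j s : a < s -> continuity_pt (picard_sum j) s.
Proof.
move=> as_.
have r0 : 0 < (s - a) / 2 by lra.
apply: (CVU_continuity _ _ s (mkposreal _ r0) (picard_cvu j s _ _)) => /=; first lra.
- move=> M y _; elim: M => [|M IH] /=; first by apply: continuity_pt_const.
  apply: continuity_pt_plus => //.
  by apply/continuity_pt_filterlim; exact: picard_cont M.+1 j y.
- by rewrite /Boule /= Rminus_diag Rabs_R0.
Qed.

Lemma picard_sum_derive j s : a < s -> is_derive (picard_sum j) s (F j s (fun k => picard_sum k s)).
Proof.
move=> as_; apply/is_derive_Reals.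
have r0 : 0 < (s - a) / 2 by lra.
pose r := mkposreal _ r0.
(* The derivative of the partial sum up to [M] is [F] of the partial sum up to [M - 1], since the
   first term is constant. *)
pose fn' M x := if M is M'.+1 then F j x (fun k => sum_f_R0 (fun m => picard m k x) M') else 0.
apply: (derivable_pt_lim_CVU (fun M s => sum_f_R0 (fun m => picard m j s) M) fn' (picard_sum j)
  (fun s => F j s (fun k => picard_sum k s)) s s r).
- by rewrite /Boule /= Rminus_diag Rabs_R0 /=.
- move=> x M _; case: M => [|M]; first by rewrite /=; apply/is_derive_Reals; exact: is_derive_const.
  apply/is_derive_Reals; rewrite /fn'.
  elim: M => [|M IH].
    rewrite /=; evar_last; first by apply: is_derive_plus; [exact: is_derive_const|exact: (picard_derive 0 j x)].
    by rewrite /plus /zero /= Rplus_0_l.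
  apply: (is_derive_ext (fun s => sum_f_R0 (fun m => picard m j s) M.+1 + picard M.+2 j s)); first by [].
  evar_last; first by apply: is_derive_plus; [exact: IH|exact: (picard_derive M.+1 j x)].
  by rewrite /plus /= -Fadd.
- move=> x hx.
  have hx' : a <= x <= a + (x - a) by move: hx; rewrite /Boule /r /=; split_Rabs; lra.
  have := is_series_unique _ _ (is_series_exp (K * (x - a))) => _.
  move=> eps e0.
  have [M hM] := picard_cvu j s r ltac:(rewrite /r /=; lra) eps e0.
  by exists M => m hm; rewrite /Rdist Rabs_minus_sym; exact: hM.
- move=> eps e0.
  have K1 : 0 < K + 1 by lra.
  have cv : exists M, forall m y k, (M <= m)%coq_nat -> Boule s r y ->
      Rabs (picard_sum k y - sum_f_R0 (fun m => picard m k y) m) <= eps / (K + 1) / 2.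
    pose q := K * (s + r - a).
    have V1 : 0 < V + 1 by lra.
    have := is_series_exp q; move/is_series_Reals => /(_ (eps / (K + 1) / 2 / (V + 1))) [|M hM].
      apply: Rdiv_lt_0_compat => //; apply: Rdiv_lt_0_compat; last lra; exact: Rdiv_lt_0_compat.
    exists M => m y k hm hy.
    have hy' : a <= y <= a + (s + r - a) by move: hy; rewrite /Boule /r /=; split_Rabs; lra.
    apply: Rle_trans (picard_sum_tail k y (s + r - a) m V0 hy') _.
    have := hM m hm; rewrite /Rdist Rabs_minus_sym; set e := eps / (K + 1) / 2 => h.
    have ep : 0 < e by rewrite /e; apply: Rdiv_lt_0_compat; [exact: Rdiv_lt_0_compat|lra].
    have h' : exp q - sum_f_R0 (fun j => q ^ j / INR (fact j)) m < e / (V + 1) by split_Rabs; lra.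
    have : (V + 1) * (e / (V + 1)) = e by field; lra.
    have : 0 < e / (V + 1) by exact: Rdiv_lt_0_compat.
    by rewrite -/q; set A := exp q - _ in h' *; nra.
  have [M hM] := cv; exists M.+1 => -[|m] y hm hy; first lia.
  rewrite /fn' -Fsub.
  apply: Rle_lt_trans (Fbd _ _ _ (eps / (K + 1) / 2) _) _.
    by move=> k; apply: hM => //; lia.
  have ep : 0 < eps / (K + 1) by exact: Rdiv_lt_0_compat.
  have : (K + 1) * (eps / (K + 1)) = eps by field; lra.
  by nra.
- move=> x hx; apply/continuity_pt_filterlim; apply: Fcont => k.
  apply/continuity_pt_filterlim; apply: picard_sum_continuity.
  by move: hx; rewrite /Boule /r /=; split_Rabs; lra.
Qed.

Lemma picard_sum_init j : picard_sum j a = v j.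
Proof.
apply: cond_eq => eps e0.
have := picard_sum_tail j a 0 0 V0 ltac:(lra).
rewrite /= Rmult_0_r exp_0 /Rdiv Rinv_1 Rmult_1_r Rminus_diag Rmult_0_r; lra.
Qed.

Lemma picard_sum_cont_right j eps : 0 < eps -> exists d, 0 < d /\ forall s, a <= s < a + d ->
  Rabs (picard_sum j s - v j) < eps.
Proof.
move=> e0.
have c : continuity_pt (fun r => V * (exp (K * r) - 1)) 0.
  apply/continuity_pt_filterlim; apply: ex_derive_continuous; auto_derive => //.
have [d [d0 hd]] := c eps e0.
exists (d / 2); split; first lra.
move=> s hs.
apply: Rle_lt_trans (picard_sum_tail j s (s - a) 0 V0 ltac:(lra)) _.
rewrite /= /Rdiv Rinv_1 Rmult_1_r.
case: (Req_dec s a) => [->|ne]; first by rewrite Rminus_diag Rmult_0_r exp_0 Rminus_diag Rmult_0_r.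
have := hd (s - a); rewrite /= /Rdist Rmult_0_r exp_0 => h.
have {}h : Rabs (V * (exp (K * (s - a)) - 1) - V * (1 - 1)) < eps.
  by apply: h; split; [split=> //; lra|rewrite Rminus_0_r Rabs_pos_eq; lra].
by move: h; split_Rabs; lra.
Qed.

(** The solution is continued to the left of [a] by its initial value, through [Rmax a s]; this
    gives the two-sided continuity at [a] that mean value arguments on [[a, s]] require. *)
Lemma linear_ode_exists : exists y : J -> R -> R, (forall j, y j a = v j) /\
  (forall j s, a <= s -> continuity_pt (y j) s) /\
  (forall j s, a < s -> is_derive (y j) s (F j s (fun k => y k s))).
Proof.
exists (fun j s => picard_sum j (Rmax a s)); split; last split.
- by move=> j; rewrite Rmax_left ?picard_sum_init //; lra.
- move=> j s as_; case: (Req_dec a s) => [<-|ne].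
    move=> eps e0; have [d [d0 hd]] := picard_sum_cont_right j eps e0.
    exists d; split=> // x [_ hx]; rewrite /= /Rdist in hx *.
    rewrite (Rmax_left a a) ?picard_sum_init; last lra.
    by apply: hd; rewrite /Rmax; case: Rle_dec; split_Rabs; lra.
  apply: (continuity_pt_ext_loc (picard_sum j)); last by apply: picard_sum_continuity; lra.
  have d0 : 0 < s - a by lra.
  exists (mkposreal _ d0) => x; rewrite /ball /= /AbsRing_ball /abs /minus /plus /opp /= => hx.
  by rewrite Rmax_right //; split_Rabs; lra.
- move=> j s as_.
  rewrite (_ : (fun k => picard_sum k (Rmax a s)) = (fun k => picard_sum k s)); last first.
    by apply: functional_extensionality => k; rewrite Rmax_right; lra.
  apply: (is_derive_ext_loc (picard_sum j)); last exact: picard_sum_derive.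
  have d0 : 0 < s - a by lra.
  exists (mkposreal _ d0) => x; rewrite /ball /= /AbsRing_ball /abs /minus /plus /opp /= => hx.
  by rewrite Rmax_right //; split_Rabs; lra.
Qed.

End LinearODE.

Lemma derive_le (u u' B B' : R -> R) a s : a <= s ->
  (forall x, a <= x <= s -> continuity_pt u x) -> (forall x, a <= x <= s -> continuity_pt B x) ->
  (forall x, a < x < s -> is_derive u x (u' x)) ->
  (forall x, a < x < s -> is_derive B x (B' x)) ->
  (forall x, a < x < s -> u' x <= B' x) -> u s - u a <= B s - B a.
Proof.
move=> as_ cu cB du dB h.
case: (Req_dec a s) => [->|ne]; first lra.
have [|x hx|c [e hc]] := MVT_cor2' (fun x => B x - u x) (fun x => B' x - u' x) a s ltac:(lra).
- by move=> x hx; apply: continuity_pt_minus; [exact: cB|exact: cu].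
- by apply: is_derive_minus; [exact: dB|exact: du].
- by have := h c hc; nra.
Qed.

Lemma Cmod_le_sum (x y : R) : Cmod (x, y) <= Rabs x + Rabs y.
Proof.
have -> : (x, y) = (RtoC x + Ci * RtoC y)%C by rewrite /RtoC /Ci /Cmult /Cplus /=; congr (_, _); ring.
apply: Rle_trans (Cmod_triangle _ _) _; rewrite Cmod_mult !Cmod_R.
by rewrite (_ : Cmod Ci = 1) ?Rmult_1_l; [lra|rewrite /Cmod /= -[RHS]sqrt_1; congr sqrt; ring].
Qed.

Lemma im_le_Cmod (z : C) : Rabs (Im z) <= Cmod z.
Proof. exact: Rle_trans (Rmax_r _ _) (Rmax_Cmod z). Qed.

(* With s = sqrt t, the substitution E(t) = sqrt s * exp (- i mu s) * f(s) turns 4 t E'' = - mu^2 E into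
   f'' = 2 i mu f' + 3 / (4 s^2) f; for |mu| large the solution with f(a) = 1, f'(a) = 0 stays close to 1.
   [Rmax x a] keeps the coefficient continuous on the whole line. *)
Section Amplitude.
Variables (a S : R) (mu : C).
Hypothesis a0 : 0 < a.
Hypothesis aS : a <= S.
Hypothesis mu0 : 0 <= Im mu.
Let m1 := Re mu.
Let m2 := Im mu.
Let q x := 3 / (4 * (Rmax x a) ^ 2).
Let Q := 3 / (4 * a ^ 2).

(** The first boolean of an index separates the amplitude from its derivative, the second the real
    from the imaginary part. *)
Let F (j : bool * bool) (s : R) (y : bool * bool -> R) : R :=
  match j with
  | (false, b) => y (true, b)
  | (true, false) => - 2 * m2 * y (true, false) + - 2 * m1 * y (true, true) + q s * y (false, false)
  | (true, true) => 2 * m1 * y (true, false) + - 2 * m2 * y (true, true) + q s * y (false, true)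
  end.

Let q_bound x : 0 <= q x <= Q.
Proof.
have h : a <= Rmax x a := Rmax_r _ _.
have h2 : a ^ 2 <= Rmax x a ^ 2 by apply: pow_incr; lra.
have a2 : 0 < a ^ 2 by apply: pow_lt.
rewrite /q /Q /Rdiv; split.
  by apply: Rmult_le_pos; [lra|apply: Rlt_le; apply: Rinv_0_lt_compat; lra].
by apply: Rmult_le_compat_l; [lra|apply: Rinv_le_contravar; lra].
Qed.

Let q_cont s : continuous q s.
Proof.
have e x : Rmax x a = (x + a + Rabs (x - a)) / 2 by rewrite /Rmax; case: Rle_dec; split_Rabs; lra.
apply: (continuous_ext (fun x => 3 / (4 * ((x + a + Rabs (x - a)) / 2) ^ 2))).
  by move=> x; rewrite /q e.
have nz : 0 < (s + a + Rabs (s - a)) / 2 by split_Rabs; lra.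
apply: (continuous_comp (fun x => (x + a + Rabs (x - a)) / 2) (fun z => 3 / (4 * z ^ 2))).
  apply: (continuous_comp (fun x => x + a + Rabs (x - a)) (fun z => z / 2)).
    apply: (continuous_plus (V := R_NormedModule) (fun x => x + a) (fun x => Rabs (x - a))).
      by apply: (continuous_plus (V := R_NormedModule)); [exact: continuous_id|exact: continuous_const].
    by apply: continuous_Rabs_comp; apply: (continuous_minus (V := R_NormedModule)); [exact: continuous_id|exact: continuous_const].
  by apply: ex_derive_continuous; auto_derive.
by apply: ex_derive_continuous; auto_derive; nra.
Qed.

Lemma amplitude_system : exists f1 f2 g1 g2 : R -> R,
  [/\ f1 a = 1, f2 a = 0, g1 a = 0 & g2 a = 0] /\
  (forall s, a <= s -> [/\ continuity_pt f1 s, continuity_pt f2 s, continuity_pt g1 s & continuity_pt g2 s]) /\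
  (forall s, a < s -> [/\ is_derive f1 s (g1 s), is_derive f2 s (g2 s),
     is_derive g1 s (- 2 * m2 * g1 s + - 2 * m1 * g2 s + 3 / (4 * s ^ 2) * f1 s) &
     is_derive g2 s (2 * m1 * g1 s + - 2 * m2 * g2 s + 3 / (4 * s ^ 2) * f2 s)]).
Proof.
pose v (j : bool * bool) : R := match j with (false, false) => 1 | _ => 0 end.
have p1 := Rabs_pos m1; have p2 := Rabs_pos m2; have [q1 q2] := q_bound a.
have cm (c : R) (y : R -> R) s : continuous y s -> continuous (fun s => c * y s) s.
  by move=> h; apply: (continuous_mult (K := R_AbsRing) (fun=> c) y); [exact: continuous_const|].
have Fadd j s y z : F j s (fun k => y k + z k) = F j s y + F j s z.
  by case: j => [[|] [|]]; rewrite /F; ring.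
have Fbd j s y B : (forall k, Rabs (y k) <= B) -> Rabs (F j s y) <= (1 + 2 * Rabs m1 + 2 * Rabs m2 + Q) * B.
  move=> hy; have B0 : 0 <= B := Rle_trans _ _ _ (Rabs_pos _) (hy (true, true)).
  have [h1 h2] := q_bound s.
  have t (c d : R) k : Rabs c <= d -> Rabs (c * y k) <= d * B.
    by move=> hc; rewrite Rabs_mult; apply: Rmult_le_compat => //; exact: Rabs_pos.
  have two (c : R) : Rabs (2 * c) <= 2 * Rabs c by rewrite Rabs_mult (Rabs_pos_eq 2); lra.
  have mtwo (c : R) : Rabs (- 2 * c) <= 2 * Rabs c.
    by rewrite Rabs_mult Rabs_Ropp (Rabs_pos_eq 2); lra.
  have qq : Rabs (q s) <= Q by rewrite Rabs_pos_eq.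
  have pB1 := Rmult_le_pos _ _ p1 B0; have pB2 := Rmult_le_pos _ _ p2 B0; have pB3 : 0 <= Q * B by apply: Rmult_le_pos; lra.
  case: j => [[|] b]; rewrite /F; last by have := hy (true, b); nra.
  case: b; (apply: Rle_trans (Rabs_triang _ _) _); (apply: Rle_trans (Rplus_le_compat_r _ _ _ (Rabs_triang _ _)) _).
  - have := t _ _ (true, false) (two m1); have := t _ _ (true, true) (mtwo m2); have := t _ _ (false, true) qq; lra.
  - have := t _ _ (true, false) (mtwo m2); have := t _ _ (true, true) (mtwo m1); have := t _ _ (false, false) qq; lra.
have Fcont j s (y : bool * bool -> R -> R) : (forall k, continuous (y k) s) ->
    continuous (fun s => F j s (fun k => y k s)) s.
  move=> hy; case: j => [[|] b]; rewrite /F; last exact: hy.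
  have cq k : continuous (fun s => q s * y k s) s.
    by apply: (continuous_mult (K := R_AbsRing) q (y k)).
  case: b.
  - apply: (continuous_plus (V := R_NormedModule) (fun s => 2 * m1 * y (true, false) s + - 2 * m2 * y (true, true) s)) => //.
    apply: (continuous_plus (V := R_NormedModule) (fun s => 2 * m1 * y (true, false) s)); exact: cm.
  - apply: (continuous_plus (V := R_NormedModule) (fun s => - 2 * m2 * y (true, false) s + - 2 * m1 * y (true, true) s)) => //.
    apply: (continuous_plus (V := R_NormedModule) (fun s => - 2 * m2 * y (true, false) s)); exact: cm.
have [y [y0 [yc yd]]] := linear_ode_exists (bool * bool) F (1 + 2 * Rabs m1 + 2 * Rabs m2 + Q) a v 1
   ltac:(lra) Fadd Fbd Fcont ltac:(by case=> [[|] [|]] /=; rewrite ?Rabs_R0 ?Rabs_R1; lra) ltac:(lra).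
exists (y (false, false)), (y (false, true)), (y (true, false)), (y (true, true)); split; last split.
- by rewrite !y0.
- by move=> s hs; split; exact: yc.
- move=> s hs.
  have qs : q s = 3 / (4 * s ^ 2) by rewrite /q Rmax_left //; lra.
  split; [exact: (yd (false, false))|exact: (yd (false, true))| |].
  - by have := yd (true, false) s hs; rewrite /F qs.
  - by have := yd (true, true) s hs; rewrite /F qs.
Qed.

Let rho := 6 * (Q * (S - a)).

(** Let [M] be the maximum of [|f|]. As [Im mu >= 0], the term [2 i mu f'] does not increase [|f'|],
    so [|f'| <= Q M (S - a)]. Moreover [2 i mu (f - 1) - f'] has derivative [- 3 f / (4 s^2)], which
    gives [2 |mu| |f - 1| <= 3 Q M (S - a)]. For [|mu| >= rho] this is at most [|mu| M / 2], so
    [|f - 1| <= M / 4], and at the maximum [M <= 4 / 3]. *)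
Lemma amplitude_bound (f1 f2 g1 g2 : R -> R) :
  [/\ f1 a = 1, f2 a = 0, g1 a = 0 & g2 a = 0] ->
  (forall s, a <= s -> [/\ continuity_pt f1 s, continuity_pt f2 s, continuity_pt g1 s & continuity_pt g2 s]) ->
  (forall s, a < s -> [/\ is_derive f1 s (g1 s), is_derive f2 s (g2 s),
     is_derive g1 s (- 2 * m2 * g1 s + - 2 * m1 * g2 s + 3 / (4 * s ^ 2) * f1 s) &
     is_derive g2 s (2 * m1 * g1 s + - 2 * m2 * g2 s + 3 / (4 * s ^ 2) * f2 s)]) ->
  rho <= Cmod mu -> 0 < Cmod mu ->
  forall s, a <= s <= S -> Cmod ((f1 s, f2 s) - RtoC 1)%C <= / 3 /\ Cmod (g1 s, g2 s) <= 4 / 3 * Q * (S - a).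
Proof.
move=> [i1 i2 i3 i4] fc fd hrho mupos.
have [Q0 Q1] := q_bound a.
have {}Q0 : 0 <= Q by lra.
have L0 : 0 <= S - a by lra.
pose nf s := Cmod (f1 s, f2 s).
have nfE s : nf s = sqrt (f1 s * f1 s + f2 s * f2 s) by rewrite /nf /Cmod /=; congr sqrt; ring.
have nfc s : a <= s <= S -> continuity_pt nf s.
  move=> hs; apply: (continuity_pt_ext (fun s => sqrt (f1 s * f1 s + f2 s * f2 s))) => [x|]; first by rewrite nfE.
  have [c1 c2 _ _] := fc s hs.1.
  apply: (continuity_pt_comp (fun s => f1 s * f1 s + f2 s * f2 s) sqrt).
    by apply: continuity_pt_plus; apply: continuity_pt_mult.
  by apply: continuity_pt_sqrt; have := Rle_0_sqr (f1 s); have := Rle_0_sqr (f2 s); rewrite /Rsqr; lra.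
have [sM [hM hsM]] := continuity_ab_maj nf a S aS nfc.
set M := nf sM in hM.
have M0 : 0 <= M := Cmod_ge_0 _.
have QM : 0 <= Q * M by exact: Rmult_le_pos.
have qs s : a <= s -> 0 <= 3 / (4 * s ^ 2) <= Q.
  by move=> hs; have := q_bound s; rewrite /q Rmax_left //; lra.
have fM s : a <= s <= S -> Rabs (f1 s) <= M /\ Rabs (f2 s) <= M.
  by move=> hs; split; apply: Rle_trans (hM s hs); [exact: (re_le_Cmod (f1 s, f2 s))|exact: (im_le_Cmod (f1 s, f2 s))].
have gM s : a <= s <= S -> Cmod (g1 s, g2 s) <= Q * M * (S - a).
  move=> hs.
  suff key eps : 0 < eps -> Cmod (g1 s, g2 s) <= eps + Q * M * (s - a).
    apply: (Rle_trans _ (Q * M * (s - a))); last by apply: Rmult_le_compat_l; lra.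
    by apply: Rnot_lt_le => lt; have := key ((Cmod (g1 s, g2 s) - Q * M * (s - a)) / 2); lra.
  move=> e0.
  (* The modulus of [f'] need not be differentiable at its zeros, and [f'] vanishes at [a]; adding
     [eps ^ 2] under the root removes this. *)
  pose H x := g1 x * g1 x + g2 x * g2 x + eps ^ 2.
  have e2 : 0 < eps ^ 2 by apply: pow_lt.
  have H0 x : 0 < H x by rewrite /H; have := Rle_0_sqr (g1 x); have := Rle_0_sqr (g2 x); rewrite /Rsqr; lra.
  have phic x : a <= x <= s -> continuity_pt (fun x => sqrt (H x)) x.
    move=> hx; have [_ _ c1 c2] := fc x hx.1.
    apply: (continuity_pt_comp H sqrt); last by apply: continuity_pt_sqrt; have := H0 x; lra.
    apply: continuity_pt_plus; last by apply: continuity_pt_const.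
    by apply: continuity_pt_plus; apply: continuity_pt_mult.
  pose d1 x := - 2 * m2 * g1 x + - 2 * m1 * g2 x + 3 / (4 * x ^ 2) * f1 x.
  pose d2 x := 2 * m1 * g1 x + - 2 * m2 * g2 x + 3 / (4 * x ^ 2) * f2 x.
  have phid x : a < x < s -> is_derive (fun x => sqrt (H x)) x ((g1 x * d1 x + g2 x * d2 x) / sqrt (H x)).
    move=> hx; have [_ _ D1 D2] := fd x hx.1.
    have dH : is_derive H x (2 * (g1 x * d1 x + g2 x * d2 x)).
      rewrite /H; auto_derive.
        by do ! split; first [by exists (d1 x)|by exists (d2 x)].
      by rewrite (is_derive_unique _ _ _ D1) (is_derive_unique _ _ _ D2) -/(d1 x) -/(d2 x); ring.
    evar_last; first by apply: (is_derive_comp sqrt H); [apply/is_derive_Reals/derivable_pt_lim_sqrt; exact: H0|exact: dH].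
    rewrite /scal /= /mult /=; field.
    by apply: Rgt_not_eq; apply: sqrt_lt_R0.
  have := derive_le (fun x => sqrt (H x)) _ (fun x => Q * M * x) (fun=> Q * M) a s hs.1 phic _ phid.
  have -> : sqrt (H a) = eps.
    by rewrite /H i3 i4 (_ : 0 * 0 + 0 * 0 + eps ^ 2 = eps ^ 2) ?sqrt_pow2; lra.
  move=> X.
  have {}X : sqrt (H s) - eps <= Q * M * s - Q * M * a.
    apply: X.
    - move=> x _; apply: is_derive_continuity_pt; auto_derive; first by [].
      by reflexivity.
    - by move=> x _; auto_derive => //; ring.
    - move=> x hx.
      have sp : 0 < sqrt (H x) by apply: sqrt_lt_R0.
      apply: (Rmult_le_reg_r (sqrt (H x))) => //.
      rewrite /Rdiv Rmult_assoc Rinv_l ?Rmult_1_r; last lra.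
      have e : g1 x * d1 x + g2 x * d2 x = - 2 * m2 * (g1 x * g1 x + g2 x * g2 x)
           + 3 / (4 * x ^ 2) * (f1 x * g1 x + f2 x * g2 x) by rewrite /d1 /d2; ring.
      have n0 : 0 <= m2 * (g1 x * g1 x + g2 x * g2 x).
        by apply: Rmult_le_pos => //; have := Rle_0_sqr (g1 x); have := Rle_0_sqr (g2 x); rewrite /Rsqr; lra.
      have [q1 q2] := qs x ltac:(lra).
      (* The Cauchy-Schwarz inequality in the plane, through the square of [f1 g2 - f2 g1]. *)
      have cs : f1 x * g1 x + f2 x * g2 x <= M * sqrt (H x).
        have hx' : a <= x <= S by lra.
        have h1 := hM x hx'; rewrite nfE in h1.
        have h2 : f1 x * f1 x + f2 x * f2 x <= M * M.
          rewrite -(sqrt_sqrt (f1 x * f1 x + f2 x * f2 x)).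
            by apply: Rmult_le_compat => //; exact: sqrt_pos.
          by have := Rle_0_sqr (f1 x); have := Rle_0_sqr (f2 x); rewrite /Rsqr; lra.
        apply: Rsqr_incr_0_var; last by apply: Rmult_le_pos => //; lra.
        rewrite /Rsqr (_ : M * sqrt (H x) * (M * sqrt (H x)) = (M * M) * (sqrt (H x) * sqrt (H x))); last ring.
        rewrite sqrt_sqrt; last by have := H0 x; lra.
        apply: (Rle_trans _ ((f1 x * f1 x + f2 x * f2 x) * H x)); last first.
          by apply: Rmult_le_compat_r => //; have := H0 x; lra.
        rewrite /H.
        have := Rle_0_sqr (f1 x * g2 x - f2 x * g1 x).
        have : 0 <= (f1 x * f1 x + f2 x * f2 x) * eps ^ 2.
          by apply: Rmult_le_pos; [have := Rle_0_sqr (f1 x); have := Rle_0_sqr (f2 x); rewrite /Rsqr|]; lra.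
        rewrite /Rsqr; lra.
      rewrite e.
      have : 3 / (4 * x ^ 2) * (f1 x * g1 x + f2 x * g2 x) <= Q * (M * sqrt (H x)).
        apply: (Rle_trans _ (3 / (4 * x ^ 2) * (M * sqrt (H x)))); first exact: Rmult_le_compat_l.
        by apply: Rmult_le_compat_r => //; apply: Rmult_le_pos => //; lra.
      lra.
  apply: (Rle_trans _ (sqrt (H s))); last lra.
  rewrite /Cmod; apply: sqrt_le_1_alt; rewrite /H /=; lra.
have hb (f g : R -> R) (s : R) : a <= s <= S -> (forall x, a <= x -> continuity_pt g x) ->
    (forall x, a < x < s -> is_derive g x (- (3 / (4 * x ^ 2)) * f x)) ->
    (forall x, a <= x <= S -> Rabs (f x) <= M) -> g a = 0 -> Rabs (g s) <= Q * M * (S - a).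
  move=> hs gc gd fb ga.
  have := derive_compare g (fun x => - (3 / (4 * x ^ 2)) * f x) (fun x => Q * M * x) (fun=> Q * M) a s hs.1.
  rewrite ga Rminus_0_r => X.
  apply: (Rle_trans _ (Q * M * s - Q * M * a)).
    apply: X => // x hx.
    - by apply: gc; lra.
    - apply: is_derive_continuity_pt; auto_derive; first by [].
      by reflexivity.
    - by auto_derive => //; ring.
    - have [q1 q2] := qs x ltac:(lra).
      rewrite Rabs_mult Rabs_Ropp Rabs_pos_eq //.
      by apply: Rmult_le_compat => //; [exact: Rabs_pos|apply: fb; lra].
  have : Q * M * s <= Q * M * S by apply: Rmult_le_compat_l; lra.
  lra.
(* [h1] and [h2] are the real and imaginary parts of [2 i mu (f - 1) - f']; [mu] no longer occurs in
   their derivatives. *)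
pose h1 s := - 2 * m2 * (f1 s - 1) + - 2 * m1 * f2 s + -1 * g1 s.
pose h2 s := 2 * m1 * (f1 s - 1) + - 2 * m2 * f2 s + -1 * g2 s.
have hcont (c1 c2 : R) (g : R -> R) s : a <= s -> continuity_pt g s ->
    continuity_pt (fun s => c1 * (f1 s - 1) + c2 * f2 s + -1 * g s) s.
  move=> hs gc; have [k1 k2 _ _] := fc s hs.
  have cc (c : R) : continuity_pt (fun=> c) s by apply: continuity_pt_const.
  apply: continuity_pt_plus; last by apply: continuity_pt_mult.
  apply: continuity_pt_plus; apply: continuity_pt_mult => //.
  exact: continuity_pt_minus.
have h1b s : a <= s <= S -> Rabs (h1 s) <= Q * M * (S - a).
  move=> hs; apply: (hb f1 h1) => //.
  - by move=> x hx; apply: hcont => //; have [_ _ k _] := fc x hx.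
  - move=> x hx; have [D1 D2 D3 D4] := fd x hx.1.
    rewrite /h1; auto_derive.
      by split; [exists (g1 x)|split; [exists (g2 x)|split=> //; eexists; exact: D3]].
    rewrite (is_derive_unique _ _ _ D1) (is_derive_unique _ _ _ D2) (is_derive_unique _ _ _ D3); ring.
  - by move=> x hx; have [] := fM x hx.
  - by rewrite /h1 i1 i2 i3; ring.
have h2b s : a <= s <= S -> Rabs (h2 s) <= Q * M * (S - a).
  move=> hs; apply: (hb f2 h2) => //.
  - by move=> x hx; apply: hcont => //; have [_ _ _ k] := fc x hx.
  - move=> x hx; have [D1 D2 D3 D4] := fd x hx.1.
    rewrite /h2; auto_derive.
      by split; [exists (g1 x)|split; [exists (g2 x)|split=> //; eexists; exact: D4]].
    rewrite (is_derive_unique _ _ _ D1) (is_derive_unique _ _ _ D2) (is_derive_unique _ _ _ D4); ring.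
  - by move=> x hx; have [] := fM x hx.
  - by rewrite /h2 i1 i2 i4; ring.
have dev s : a <= s <= S -> 2 * Cmod mu * Cmod ((f1 s, f2 s) - RtoC 1)%C <= 3 * (Q * M * (S - a)).
  move=> hs.
  have -> : 2 * Cmod mu * Cmod ((f1 s, f2 s) - RtoC 1)%C = Cmod (RtoC 2 * Ci * mu * ((f1 s, f2 s) - RtoC 1))%C.
    rewrite !Cmod_mult Cmod_R (Rabs_pos_eq 2); last lra.
    by rewrite (_ : Cmod Ci = 1) ?Rmult_1_r // /Cmod /= -[RHS]sqrt_1; congr sqrt; ring.
  have -> : (RtoC 2 * Ci * mu * ((f1 s, f2 s) - RtoC 1))%C = ((h1 s, h2 s) + (g1 s, g2 s))%C.
    by rewrite /h1 /h2 /m1 /m2; case: (mu) => x y; rewrite /Cmult /Cplus /Cminus /Copp /RtoC /Ci /=; congr (_, _); ring.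
  apply: Rle_trans (Cmod_triangle _ _) _.
  have := Cmod_le_sum (h1 s) (h2 s); have := h1b s hs; have := h2b s hs; have := gM s hs; lra.
have M1 : M <= 1 + Cmod ((f1 sM, f2 sM) - RtoC 1)%C.
  have e (z : C) : z = (RtoC 1 + (z - RtoC 1))%C by ring.
  rewrite /M /nf {1}(e (f1 sM, f2 sM)).
  by apply: Rle_trans (Cmod_triangle _ _) _; rewrite Cmod_R Rabs_R1; lra.
have dM := dev sM hsM.
have M43 : M <= 4 / 3.
  set D := Cmod (_ - _)%C in M1 dM.
  have h : 12 * (Q * M * (S - a)) <= 2 * Cmod mu * M.
    rewrite (_ : 12 * _ = 2 * M * rho); last by rewrite /rho; ring.
    by rewrite (_ : 2 * Cmod mu * M = 2 * M * Cmod mu); [apply: Rmult_le_compat_l; lra|ring].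
  have : Cmod mu * (4 * D) <= Cmod mu * M by lra.
  by move/(Rmult_le_reg_l _ _ _ mupos); lra.
move=> s hs; split.
  have dS := dev s hs.
  have h : 12 * (Q * M * (S - a)) <= 2 * Cmod mu * M.
    rewrite (_ : 12 * _ = 2 * M * rho); last by rewrite /rho; ring.
    by rewrite (_ : 2 * Cmod mu * M = 2 * M * Cmod mu); [apply: Rmult_le_compat_l; lra|ring].
  set D := Cmod (_ - _)%C in dS *.
  have : Cmod mu * (4 * D) <= Cmod mu * M by lra.
  by move/(Rmult_le_reg_l _ _ _ mupos); lra.
apply: Rle_trans (gM s hs) _; apply: Rmult_le_compat_r => //.
by rewrite (Rmult_comm (4 / 3)); apply: Rmult_le_compat_l.
Qed.

End Amplitude.

Lemma is_derive_comp_sqrt (W W' : R -> R) t : 0 < t -> is_derive W (sqrt t) (W' (sqrt t)) ->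
  is_derive (fun t => W (sqrt t)) t (W' (sqrt t) / (2 * sqrt t)).
Proof.
move=> t0 h; have s0 : 0 < sqrt t by apply: sqrt_lt_R0.
evar_last; first by apply: (is_derive_comp W sqrt); [exact: h|apply/is_derive_Reals/derivable_pt_lim_sqrt].
by rewrite /scal /= /mult /=; field; lra.
Qed.

Lemma Cmod_sqr_bound (z : C) r : Cmod (z - RtoC 1)%C <= r -> 1 - r <= Cmod z <= 1 + r.
Proof.
move=> h.
have e1 : z = (RtoC 1 + (z - RtoC 1))%C by ring.
have e2 : RtoC 1 = (z - (z - RtoC 1))%C by ring.
have h1 : Cmod z <= 1 + Cmod (z - RtoC 1)%C.
  by rewrite {1}e1; apply: Rle_trans (Cmod_triangle _ _) _; rewrite Cmod_R Rabs_R1; lra.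
have h2 : 1 <= Cmod z + Cmod (z - RtoC 1)%C.
  rewrite -{1}Rabs_R1 -Cmod_R {1}e2; apply: Rle_trans (Cmod_triangle _ _) _; rewrite Cmod_opp; lra.
lra.
Qed.

(** * Decaying solutions of the time equation *)

Section TimeSolution.
Variables (t0 T : R).
Hypothesis t00 : 0 < t0.
Hypothesis t0T : t0 < T.
Let a := sqrt t0 / 2.
Let S := sqrt T.

Definition is_time_solution (mu : C) (E1 E2 D1 D2 : R -> R) :=
  [/\ E1 T = 1, E2 T = 0,
   forall t, t0 <= t <= T -> [/\ is_derive E1 t (D1 t), is_derive E2 t (D2 t),
     is_derive D1 t (- / (4 * t) * (Re (mu * mu) * E1 t - Im (mu * mu) * E2 t)) &
     is_derive D2 t (- / (4 * t) * (Re (mu * mu) * E2 t + Im (mu * mu) * E1 t))] &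
   forall t, t0 <= t <= T -> Cmod (E1 t, E2 t) <= 2 * exp (- (Im mu * (sqrt T - sqrt t)))].

(** The system starts at [a = sqrt t0 / 2], left of the slab, so that derivatives at [t0] are
    two-sided. With [s = sqrt t], the unnormalized solution has modulus between 2/3 and 4/3 of
    [sqrt s * exp (Im mu * (s - a))]. Division by its value at [T] turns growth in [s] into decay
    backwards from [T]; the constant 2 is the ratio of 4/3 to 2/3. *)
Theorem time_solution : exists M0 C0, [/\ 0 < M0, 0 <= C0 & forall mu : C, 0 <= Im mu -> M0 <= Cmod mu ->
  exists E1 E2 D1 D2 : R -> R, is_time_solution mu E1 E2 D1 D2 /\
   forall t, t0 <= t <= T -> Cmod (D1 t, D2 t) <= C0 * (1 + Cmod mu)].
Proof.
have st0 : 0 < sqrt t0 by apply: sqrt_lt_R0.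
have sT : sqrt t0 < sqrt T by apply: sqrt_lt_1; lra.
have a0 : 0 < a by rewrite /a; lra.
have aS : a <= S by rewrite /a /S; lra.
pose Q := 3 / (4 * a ^ 2).
have Q0 : 0 <= Q.
  by apply: Rdiv_le_0_compat; [lra|have : 0 < a ^ 2 by [apply: pow_lt]; lra].
pose rho := 6 * (Q * (S - a)).
have rho0 : 0 <= rho by rewrite /rho; apply: Rmult_le_pos; [lra|apply: Rmult_le_pos; lra].
pose G := 4 / 3 * Q * (S - a).
have G0 : 0 <= G by rewrite /G; apply: Rmult_le_pos; lra.
exists (rho + 1), (3 / (4 * a) * (G + 4 / 3 + 2 / (3 * a))); split; first lra.
  apply: Rmult_le_pos; first by apply: Rdiv_le_0_compat; lra.
  by have : 0 <= 2 / (3 * a) by [apply: Rdiv_le_0_compat; lra]; lra.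
move=> mu mu2 hmu.
have [f1 [f2 [g1 [g2 [ini [fc fd]]]]]] := amplitude_system a mu a0.
have bd := amplitude_bound a S mu a0 aS mu2 f1 f2 g1 g2 ini fc fd ltac:(rewrite -/Q -/rho; lra) ltac:(lra).
set m1 := Re mu in fd; set m2 := Im mu in fd mu2.
pose p1 s := exp (m2 * (s - a)) * cos (m1 * (s - a)).
pose p2 s := - (exp (m2 * (s - a)) * sin (m1 * (s - a))).
have dp1 s : is_derive p1 s (m2 * p1 s + m1 * p2 s) by rewrite /p1 /p2; auto_derive => //; rewrite -/(s - a); ring.
have dp2 s : is_derive p2 s (m2 * p2 s - m1 * p1 s) by rewrite /p1 /p2; auto_derive => //; rewrite -/(s - a); ring.
have pmod s : Cmod (p1 s, p2 s) = exp (m2 * (s - a)).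
  have -> : (p1 s, p2 s) = (RtoC (exp (m2 * (s - a))) * cis (- (m1 * (s - a))))%C.
    by rewrite /p1 /p2 /cis cos_neg sin_neg /RtoC /Cmult /=; congr (_, _); ring.
  by rewrite Cmod_mult Cmod_cis Cmod_R Rabs_pos_eq ?Rmult_1_r //; apply: Rlt_le; exact: exp_pos.
(* [r] is the square root with only its derivative rule exposed, so that [auto_derive] and [field]
   treat it as an unknown function. *)
have [r [rE dr]] : exists r : R -> R, (forall s, r s = sqrt s) /\
    (forall s, 0 < s -> is_derive r s (r s / (2 * s))).
  exists sqrt; split=> // s s0; have sq0 : 0 < sqrt s by apply: sqrt_lt_R0.
  have -> : sqrt s / (2 * s) = / (2 * sqrt s).
    by rewrite -{2}(sqrt_sqrt s); [field|]; lra.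
  by apply/is_derive_Reals/derivable_pt_lim_sqrt.
(* In the variable [s = sqrt t], [w] is [sqrt s * exp (- i mu (s - a)) * f], [k] is
   [f' - i mu f + f / (2 s)], and [z] is the derivative of [w] with respect to [t], whence the
   division by [2 s]. *)
pose w1 s := r s * (p1 s * f1 s - p2 s * f2 s).
pose w2 s := r s * (p1 s * f2 s + p2 s * f1 s).
pose k1 s := g1 s + m2 * f1 s + m1 * f2 s + f1 s / (2 * s).
pose k2 s := g2 s + m2 * f2 s - m1 * f1 s + f2 s / (2 * s).
pose z1 s := r s * (p1 s * k1 s - p2 s * k2 s) / (2 * s).
pose z2 s := r s * (p1 s * k2 s + p2 s * k1 s) / (2 * s).
have der s : a < s -> [/\ is_derive w1 s (2 * s * z1 s), is_derive w2 s (2 * s * z2 s),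
   is_derive z1 s (2 * s * (- / (4 * s ^ 2) * (Re (mu * mu) * w1 s - Im (mu * mu) * w2 s))) &
   is_derive z2 s (2 * s * (- / (4 * s ^ 2) * (Re (mu * mu) * w2 s + Im (mu * mu) * w1 s)))].
  move=> hs; have s0 : 0 < s by lra.
  have [D1 D2 D3 D4] := fd s hs.
  have reE : Re (mu * mu) = m1 * m1 - m2 * m2 by rewrite /m1 /m2; case: (mu).
  have imE : Im (mu * mu) = 2 * m1 * m2 by rewrite /m1 /m2; case: (mu) => x y /=; ring.
  have dP1 := dp1 s; have dP2 := dp2 s; have dR := dr s s0.
  rewrite reE imE /z1 /z2 /w1 /w2 /k1 /k2.
  clear -s0 D1 D2 D3 D4 dP1 dP2 dR.
  split; auto_derive;
   try (do ! split => //; first [lra|eexists; eassumption]);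
   rewrite (is_derive_unique _ _ _ D1) (is_derive_unique _ _ _ D2) (is_derive_unique _ _ _ dP1)
     (is_derive_unique _ _ _ dP2) (is_derive_unique _ _ _ dR)
     ?(is_derive_unique _ _ _ D3) ?(is_derive_unique _ _ _ D4); field; lra.
have ha t : t0 <= t -> a < sqrt t /\ sqrt t * sqrt t = t.
  by move=> h; split; [rewrite /a; have := sqrt_le_1 t0 t; lra|apply: sqrt_sqrt; lra].
pose Y1 t := w1 (sqrt t); pose Y2 t := w2 (sqrt t); pose Z1 t := z1 (sqrt t); pose Z2 t := z2 (sqrt t).
have Yder t : t0 <= t <= T -> [/\ is_derive Y1 t (Z1 t), is_derive Y2 t (Z2 t),
     is_derive Z1 t (- / (4 * t) * (Re (mu * mu) * Y1 t - Im (mu * mu) * Y2 t)) &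
     is_derive Z2 t (- / (4 * t) * (Re (mu * mu) * Y2 t + Im (mu * mu) * Y1 t))].
  move=> [h1 h2]; have [h3 h4] := ha t h1; have tp : 0 < t by lra.
  have s0 : 0 < sqrt t by lra.
  have [d1 d2 d3 d4] := der _ h3.
  have conv (W : R -> R) l : is_derive W (sqrt t) (2 * sqrt t * l) -> is_derive (fun t => W (sqrt t)) t l.
    move=> h; have := is_derive_comp_sqrt W (fun=> 2 * sqrt t * l) t tp h.
    by rewrite (_ : 2 * sqrt t * l / (2 * sqrt t) = l) //; field; lra.
  have s2 : sqrt t ^ 2 = t by rewrite -[RHS]h4; ring.
  by rewrite s2 in d3 d4; split; apply: conv.
have Ymod t : t0 <= t <= T -> 2 / 3 * (sqrt (sqrt t) * exp (m2 * (sqrt t - a))) <= Cmod (Y1 t, Y2 t)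
    <= 4 / 3 * (sqrt (sqrt t) * exp (m2 * (sqrt t - a))).
  move=> [h1 h2]; have [h3 h4] := ha t h1.
  have hs : a <= sqrt t <= S by split; [lra|rewrite /S; apply: sqrt_le_1; lra].
  have -> : (Y1 t, Y2 t) = (RtoC (r (sqrt t)) * ((p1 (sqrt t), p2 (sqrt t)) * (f1 (sqrt t), f2 (sqrt t))))%C.
    by rewrite /Y1 /Y2 /w1 /w2 /RtoC /Cmult /=; congr (_, _); ring.
  rewrite !Cmod_mult pmod Cmod_R rE Rabs_pos_eq; last exact: sqrt_pos.
  have [b1 _] := bd _ hs; have [b2 b3] := Cmod_sqr_bound _ _ b1.
  have A0 : 0 <= sqrt (sqrt t) * exp (m2 * (sqrt t - a)).
    by apply: Rmult_le_pos; [exact: sqrt_pos|apply: Rlt_le; exact: exp_pos].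
  rewrite -(Rmult_assoc (sqrt (sqrt t)) (exp _) (Cmod _)).
  set A := sqrt (sqrt t) * exp _ in A0 *.
  rewrite (Rmult_comm (2 / 3)) (Rmult_comm (4 / 3)).
  by split; apply: Rmult_le_compat_l => //; lra.
have hT : t0 <= T <= T by lra.
have sS0 : 0 < sqrt S by apply: sqrt_lt_R0; lra.
have YT : 0 < Cmod (Y1 T, Y2 T).
  have [y1 _] := Ymod T hT; apply: Rlt_le_trans y1.
  by apply: Rmult_lt_0_compat; [lra|apply: Rmult_lt_0_compat => //; exact: exp_pos].
have YTn : ((Y1 T, Y2 T) : C) <> RtoC 0 by move=> e; rewrite e Cmod_0 in YT; lra.
pose c := (/ (Y1 T, Y2 T))%C.
have cmod : Cmod c = / Cmod (Y1 T, Y2 T) by rewrite /c Cmod_inv.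
have cb : Cmod c * (2 / 3 * (sqrt S * exp (m2 * (S - a)))) <= 1.
  rewrite cmod; apply: (Rmult_le_reg_l (Cmod (Y1 T, Y2 T))) => //.
  by rewrite -Rmult_assoc Rinv_r ?Rmult_1_l; [have [] := Ymod T hT; rewrite -/S; lra|lra].
have c0 : 0 <= Cmod c := Cmod_ge_0 _.
have ratio t : t0 <= t <= T -> Cmod c * (sqrt (sqrt t) * exp (m2 * (sqrt t - a))) <= 3 / 2 * exp (- (m2 * (S - sqrt t))).
  move=> [h1 h2]; have [h3 h4] := ha t h1.
  have tS : sqrt t <= S by rewrite /S; apply: sqrt_le_1; lra.
  have e : exp (m2 * (sqrt t - a)) = exp (m2 * (S - a)) * exp (- (m2 * (S - sqrt t))).
    by rewrite -exp_plus; congr exp; ring.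
  rewrite e.
  have q0 : 0 < exp (- (m2 * (S - sqrt t))) := exp_pos _.
  have q1 : 0 < exp (m2 * (S - a)) := exp_pos _.
  have q2 : sqrt (sqrt t) <= sqrt S by apply: sqrt_le_1_alt.
  have q3 : Cmod c * (sqrt (sqrt t) * exp (m2 * (S - a))) <= 3 / 2.
    have : Cmod c * (sqrt (sqrt t) * exp (m2 * (S - a))) <= Cmod c * (sqrt S * exp (m2 * (S - a))).
      by apply: Rmult_le_compat_l => //; apply: Rmult_le_compat_r => //; lra.
    lra.
  rewrite -!Rmult_assoc; apply: Rmult_le_compat_r; first lra.
  by rewrite Rmult_assoc.
exists (fun t => Re c * Y1 t - Im c * Y2 t), (fun t => Re c * Y2 t + Im c * Y1 t),
  (fun t => Re c * Z1 t - Im c * Z2 t), (fun t => Re c * Z2 t + Im c * Z1 t).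
have cY (y1 y2 : R) : (Re c * y1 - Im c * y2, Re c * y2 + Im c * y1) = (c * (y1, y2))%C.
  by case: (c).
split; first split.
- by have := cY (Y1 T) (Y2 T); rewrite /c Cinv_l // => -[].
- by have := cY (Y1 T) (Y2 T); rewrite /c Cinv_l // => -[].
- move=> t ht; have [d1 d2 d3 d4] := Yder t ht.
  have lin (u v : R -> R) (x y k l : R) : is_derive u t x -> is_derive v t y ->
      is_derive (fun t => k * u t + l * v t) t (k * x + l * y).
    by move=> hu hv; apply: is_derive_plus; apply: is_derive_scal.
  have sub (u v : R -> R) (x y k l : R) : is_derive u t x -> is_derive v t y ->
      is_derive (fun t => k * u t - l * v t) t (k * x - l * y).
    by move=> hu hv; apply: is_derive_minus; apply: is_derive_scal.
  split.
  - exact: sub.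
  - exact: lin.
  - evar_last; first exact: (sub _ _ _ _ _ _ d3 d4); ring.
  - evar_last; first exact: (lin _ _ _ _ _ _ d4 d3); ring.
- move=> t ht; rewrite cY Cmod_mult.
  have [_ y2] := Ymod t ht; have h := ratio t ht.
  have : Cmod c * Cmod (Y1 t, Y2 t) <= Cmod c * (4 / 3 * (sqrt (sqrt t) * exp (m2 * (sqrt t - a)))).
    exact: Rmult_le_compat_l.
  by rewrite -/m2 -/S; lra.
- move=> t ht; rewrite cY Cmod_mult; have [h3 h4] := ha t ht.1.
  have hs : a <= sqrt t <= S by split; [lra|rewrite /S; apply: sqrt_le_1; lra].
  set s := sqrt t in h3 h4 hs *.
  have [b1 b2] := bd _ hs; have [_ b3] := Cmod_sqr_bound _ _ b1.
  have s0 : 0 < s by lra.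
  have zE : (Z1 t, Z2 t) = (RtoC (/ (2 * s)) * (RtoC (r s) * ((p1 s, p2 s) * ((g1 s, g2 s) + (RtoC (/ (2 * s)) - Ci * mu) * (f1 s, f2 s)))))%C.
    rewrite /Z1 /Z2 /z1 /z2 /k1 /k2 -/s /m1 /m2; case: (mu) => x y.
    by rewrite /RtoC /Cmult /Cplus /Cminus /Copp /Ci /=; congr (_, _); field; lra.
  rewrite zE !Cmod_mult pmod !Cmod_R rE (Rabs_pos_eq (sqrt s)); last exact: sqrt_pos.
  have i2 : 0 < / (2 * s) by apply: Rinv_0_lt_compat; lra.
  rewrite Rabs_pos_eq; last lra.
  have inner : Cmod ((g1 s, g2 s) + (RtoC (/ (2 * s)) - Ci * mu) * (f1 s, f2 s))%C <= (G + 4 / 3 + 2 / (3 * a)) * (1 + Cmod mu).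
    apply: Rle_trans (Cmod_triangle _ _) _; rewrite Cmod_mult.
    have n1 : Cmod (RtoC (/ (2 * s)) - Ci * mu)%C <= / (2 * a) + Cmod mu.
      apply: Rle_trans (Cmod_triangle _ _) _; rewrite Cmod_opp Cmod_mult Cmod_R Rabs_pos_eq; last lra.
      rewrite (_ : Cmod Ci = 1); last by rewrite /Cmod /= -[RHS]sqrt_1; congr sqrt; ring.
      by have : / (2 * s) <= / (2 * a) by [apply: Rinv_le_contravar; lra]; lra.
    have b2' : Cmod (g1 s, g2 s) <= G by exact: b2.
    have n0 : 0 <= Cmod (RtoC (/ (2 * s)) - Ci * mu)%C := Cmod_ge_0 _.
    have n2 : Cmod (RtoC (/ (2 * s)) - Ci * mu)%C * Cmod (f1 s, f2 s) <= (/ (2 * a) + Cmod mu) * (4 / 3).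
      by apply: Rmult_le_compat => //; [exact: Cmod_ge_0|lra].
    have ia : 0 < / (2 * a) by apply: Rinv_0_lt_compat; lra.
    have e : 2 / (3 * a) = 4 / 3 * / (2 * a) by field; lra.
    rewrite e; move: (Cmod mu) (Cmod_ge_0 mu) n2 => m mge n2.
    nra.
  have ex1 : exp (- (m2 * (S - s))) <= 1.
    rewrite -exp_0; have : 0 <= m2 * (S - s) by apply: Rmult_le_pos => //; lra.
    by case=> [lt|<-]; [apply: Rlt_le; apply: exp_increasing; lra|rewrite Ropp_0; lra].
  have h := ratio t ht; rewrite -/s in h.
  set I := Cmod (_ + _)%C in inner *.
  have I0 : 0 <= I := Cmod_ge_0 _.
  rewrite (_ : Cmod c * _ = / (2 * s) * (Cmod c * (sqrt s * exp (m2 * (s - a)))) * I); last ring.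
  rewrite (_ : 3 / (4 * a) * (G + 4 / 3 + 2 / (3 * a)) * (1 + Cmod mu) = 3 / (4 * a) * ((G + 4 / 3 + 2 / (3 * a)) * (1 + Cmod mu))); last ring.
  have X0 : 0 <= Cmod c * (sqrt s * exp (m2 * (s - a))).
    by apply: Rmult_le_pos => //; apply: Rmult_le_pos; [exact: sqrt_pos|apply: Rlt_le; exact: exp_pos].
  apply: Rmult_le_compat => //; first by apply: Rmult_le_pos; lra.
  rewrite (_ : 3 / (4 * a) = / (2 * a) * (3 / 2)); last by field; lra.
  apply: Rmult_le_compat; [lra|done| |lra].
  by apply: Rinv_le_contravar; lra.
Qed.

End TimeSolution.

(** * Superposed solutions *)

Lemma sumR_add m (f g : 'I_m -> R) : sumR (fun i => f i + g i) = sumR f + sumR g.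
Proof. by rewrite /sumR big_split. Qed.

Lemma sumR_scal m c (f : 'I_m -> R) : sumR (fun i => c * f i) = c * sumR f.
Proof. exact: rsum_scal. Qed.

Lemma tame_sum (Om : Type) (w : Om -> R) (w1 : forall om, 1 <= w om) (L : (Om -> R) -> R) m (G : 'I_m -> Om -> R) :
  tame_functional w L -> (forall i, tame w (G i)) ->
  tame w (fun om => sumR (fun i => G i om)) /\ sumR (fun i => L (G i)) = L (fun om => sumR (fun i => G i om)).
Proof.
move=> HL tG.
have tz : tame w (fun=> 0) by apply: (tame_bounded _ _ 0) => om; rewrite Rabs_R0; lra.
suff h (s : seq 'I_m) : tame w (fun om => \big[Rplus/0]_(i <- s) G i om) /\
    \big[Rplus/0]_(i <- s) L (G i) = L (fun om => \big[Rplus/0]_(i <- s) G i om).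
  exact: h.
elim: s => [|i s [IH1 IH2]].
  rewrite (_ : (fun om => _) = (fun=> 0)); last by apply: functional_extensionality => om; rewrite big_nil.
  by split=> //; rewrite big_nil; have := tf_scal _ _ _ HL _ 0 tz; rewrite Rmult_0_l Rmult_0_l => ->.
rewrite (_ : (fun om => _) = (fun om => G i om + 1 * \big[Rplus/0]_(i <- s) G i om)); last first.
  by apply: functional_extensionality => om; rewrite big_cons Rmult_1_l.
split; last by rewrite big_cons IH2 HL.1 ?Rmult_1_l.
apply: (tame_add _ _ w1) => //.
by rewrite (_ : (fun om => _) = (fun om => \big[Rplus/0]_(i <- s) G i om)) //; apply: functional_extensionality => om; rewrite Rmult_1_l.
Qed.

Section SlabFamilies.
Variables (Om : Type) (w : Om -> R).
Hypothesis w1 : forall om, 1 <= w om.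
Variables (I : finType) (time : I) (t0 T : R).
Implicit Types F G : Om -> (I -> R) -> R.

Let D := fun p : I -> R => t0 <= p time <= T.
Let lt := loc_tame w time t0 T.

Definition pd F G (i : I) := forall om, has_pderiv_in D (F om) (G om) i.

Lemma nice_zero k : nice w time t0 T k (fun _ _ => 0).
Proof. by apply: nice_const; apply: (tame_bounded _ _ 0) => om; rewrite Rabs_R0; lra. Qed.

Lemma nice_succ k F : lt F -> (forall i, exists G, pd F G i /\ nice w time t0 T k G) ->
  nice w time t0 T k.+1 F.
Proof. by []. Qed.

Lemma pd_locally_const F i : (forall om p s, F om (upd p i s) = F om p) -> pd F (fun _ _ => 0) i.
Proof.
move=> h om; apply: has_pderiv_of_derive => p _.
apply: (is_derive_ext (fun=> F om p)); first by move=> s; rewrite h.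
exact: is_derive_const.
Qed.

Lemma nice_scale k (c : R) F : nice w time t0 T k F -> nice w time t0 T k (fun om p => c * F om p).
Proof.
move=> h; apply: (nice_mul _ _ w1 _ _ _ _ _ (fun _ _ => c)) => //.
by apply: nice_const; apply: (tame_bounded _ _ (Rabs c)) => om; lra.
Qed.

Lemma nice_coord j k : nice w time t0 T k (fun _ p => p j).
Proof.
have l : lt (fun _ p => p j).
  by move=> Rb; exists 0%N, Rb => om p _ hp; rewrite /= Rmult_1_r.
case: k => [|k]; first by split.
apply: nice_succ => // i; case: (altP (j =P i)) => [e|ne].
  exists (fun _ _ => 1); split.
    move=> om; apply: has_pderiv_of_derive => p _.
    by apply: (is_derive_ext id) => [s|]; [rewrite e upd_same|exact: is_derive_id].
  by apply: nice_const; apply: (tame_bounded _ _ 1) => om; rewrite Rabs_R1; lra.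
exists (fun _ _ => 0); split; last exact: nice_zero.
by apply: pd_locally_const => om p s; rewrite upd_other.
Qed.

Lemma nice_inv_time k : 0 < t0 -> nice w time t0 T k (fun _ p => / p time).
Proof.
move=> t00; have l : lt (fun _ p => / p time).
  move=> Rb; exists 0%N, (/ t0) => om p [h1 h2] _; rewrite /= Rmult_1_r Rabs_pos_eq.
    by apply: Rinv_le_contravar.
  by apply: Rlt_le; apply: Rinv_0_lt_compat; lra.
elim: k => [|k IH]; first by split.
apply: nice_succ => // i; case: (altP (time =P i)) => [<-|ne].
  exists (fun om p => -1 * (/ p time * / p time)); split.
    move=> om; apply: has_pderiv_of_derive => p [h1 h2].
    apply: (is_derive_ext Rinv) => [s|]; first by rewrite upd_same.
    by auto_derive; [lra|field; lra].
  by apply: nice_scale; exact: (nice_mul _ _ w1).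
exists (fun _ _ => 0); split; last exact: nice_zero.
by apply: pd_locally_const => om p s; rewrite upd_other.
Qed.

Lemma pd_ext F G G' i : pd F G i -> (forall om p, D p -> G om p = G' om p) -> pd F G' i.
Proof. by move=> h e om p Dp; rewrite -e //; exact: h. Qed.

Lemma nice_tame_mul k (a : Om -> R) F : tame w a -> nice w time t0 T k F -> nice w time t0 T k (fun om p => a om * F om p).
Proof. by move=> ta; apply: (nice_mul _ _ w1); exact: nice_const. Qed.

Section Phase.
Variables (n : nat) (xc : 'I_n -> I).
Hypothesis xcI : injective xc.
Variable xi : Om -> 'I_n -> R.
Hypothesis txi : forall i, tame w (fun om => xi om i).

Definition phase om (p : I -> R) := dot n (xi om) (fun i => p (xc i)).

Lemma phase_upd om p i s : phase om (upd p (xc i) s) = phase om p + (s - p (xc i)) * xi om i.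
Proof.
have -> : phase om (upd p (xc i) s) = dot n (xi om) (upd (fun j => p (xc j)) i s).
  congr (dot n (xi om) _); apply: functional_extensionality => j.
  by rewrite /upd (inj_eq xcI).
by rewrite dotC dot_upd dotC.
Qed.

Lemma phase_other om p i s : (forall j, i <> xc j) -> phase om (upd p i s) = phase om p.
Proof.
move=> h; congr (dot n (xi om) _); apply: functional_extensionality => j; rewrite upd_other //.
by apply/eqP => e; apply: (h j).
Qed.

Lemma trig_derive b x : is_derive (trig b) x ((if b then -1 else 1) * trig (~~ b) x).
Proof. by case: b; rewrite /trig; auto_derive => //=; ring. Qed.

Lemma pd_trig (b : Om -> bool) i : pd (fun om p => trig (b om) (phase om p))
  (fun om p => (xi om i * (if b om then -1 else 1)) * trig (~~ b om) (phase om p)) (xc i).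
Proof.
move=> om; apply: has_pderiv_of_derive => p Dp.
apply: (is_derive_ext (fun s => trig (b om) (phase om p + (s - p (xc i)) * xi om i))).
  by move=> s; rewrite phase_upd.
evar_last.
  apply: (is_derive_comp (trig (b om))); first exact: trig_derive.
  by auto_derive; [|reflexivity].
rewrite (_ : phase om p + (p (xc i) - p (xc i)) * xi om i = phase om p); last by ring.
by rewrite /scal /= /mult /=; ring.
Qed.

Lemma tame_sg (b : Om -> bool) i : tame w (fun om => xi om i * (if b om then -1 else 1)).
Proof.
apply: tame_mul => //; apply: (tame_bounded _ _ 1) => om.
by case: (b om); rewrite ?Rabs_Ropp Rabs_R1; lra.
Qed.

Lemma pd_trig_other (b : Om -> bool) i : (forall j, i <> xc j) -> pd (fun om p => trig (b om) (phase om p)) (fun _ _ => 0) i.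
Proof. by move=> h; apply: pd_locally_const => om p s; rewrite phase_other. Qed.

Lemma nice_trig k (b : Om -> bool) : nice w time t0 T k (fun om p => trig (b om) (phase om p)).
Proof.
elim: k b => [|k IH] b.
all: have l : lt (fun om p => trig (b om) (phase om p))
  by move=> Rb; exists 0%N, 1 => om p _ _; rewrite /= Rmult_1_r; exact: trig_bound.
- by split.
- apply: nice_succ => // i; case: (pickP (fun j => i == xc j)) => [j /eqP ->|none].
  + exists (fun om p => (xi om j * (if b om then -1 else 1)) * trig (~~ b om) (phase om p)).
    by split; [exact: pd_trig|apply: nice_tame_mul; [exact: tame_sg|exact: (IH (fun om => ~~ b om))]].
  + exists (fun _ _ => 0); split; last exact: nice_zero.
    by apply: pd_trig_other => j e; have := none j; rewrite e eqxx.
Qed.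

End Phase.
End SlabFamilies.

Section WaveFamilies.
Variables (Om : Type) (w : Om -> R).
Hypothesis w1 : forall om, 1 <= w om.
Variables (n N : nat) (t0 T : R).

Let I : finType := option ('I_n + 'I_N)%type.
Let time : I := None.
Let xc (i : 'I_n) : I := Some (inl i).
Let yc (k : 'I_N) : I := Some (inr k).
Implicit Types F G : Om -> (I -> R) -> R.

Let D := fun p : I -> R => t0 <= p time <= T.
Let nice_all F := forall k, nice w time t0 T k F.

Let pd := pd Om I time t0 T.

(** The condition at [T] is left out because the individual terms violate it; it holds only after
    averaging over the circles and superposing. *)
Definition wave_family F := exists Ft Ftt (Fx Fxx : 'I_n -> Om -> (I -> R) -> R)
    (Fy Fyy : 'I_N -> Om -> (I -> R) -> R),
  [/\ nice_all F, nice_all Ft & nice_all Ftt] /\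
  [/\ forall i, nice_all (Fx i), forall i, nice_all (Fxx i), forall k, nice_all (Fy k) & forall k, nice_all (Fyy k)] /\
  [/\ pd F Ft time /\ pd Ft Ftt time,
      forall i, pd F (Fx i) (xc i) /\ pd (Fx i) (Fxx i) (xc i) &
      forall k, pd F (Fy k) (yc k) /\ pd (Fy k) (Fyy k) (yc k)] /\
  (forall om p, D p -> 2 * p time / INR N * Ftt om p -
     (sumR (fun i => Fxx i om p) + sumR (fun k => Fyy k om p)) = 0).

Lemma wave_family_add F G : wave_family F -> wave_family G -> wave_family (fun om p => F om p + G om p).
Proof.
move=> [Ft [Ftt [Fx [Fxx [Fy [Fyy [[a1 a2 a3] [[a4 a5 a6 a7] [[[a8 a9] a10 a11] a12]]]]]]]]].
move=> [Gt [Gtt [Gx [Gxx [Gy [Gyy [[b1 b2 b3] [[b4 b5 b6 b7] [[[b8 b9] b10 b11] b12]]]]]]]]].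
exists (fun om p => Ft om p + Gt om p), (fun om p => Ftt om p + Gtt om p),
  (fun i om p => Fx i om p + Gx i om p), (fun i om p => Fxx i om p + Gxx i om p),
  (fun i om p => Fy i om p + Gy i om p), (fun i om p => Fyy i om p + Gyy i om p).
have na F' G' : nice_all F' -> nice_all G' -> nice_all (fun om p => F' om p + G' om p).
  by move=> h h' k; apply: (nice_add _ _ w1).
have pa F' F'' G' G'' i : pd F' F'' i -> pd G' G'' i -> pd (fun om p => F' om p + G' om p) (fun om p => F'' om p + G'' om p) i.
  by move=> h h' om; apply: pderiv_add.
split; first by split; apply: na.
split; first by split=> i; apply: na.
split.
  split; first by split; apply: pa.
    by move=> i; have [? ?] := a10 i; have [? ?] := b10 i; split; apply: pa.
  by move=> i; have [? ?] := a11 i; have [? ?] := b11 i; split; apply: pa.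
move=> om p Dp; rewrite !sumR_add; have := a12 om p Dp; have := b12 om p Dp; lra.
Qed.

Lemma superpose_wave F (L : (Om -> R) -> R) : tame_functional w L -> wave_family F ->
  let U := fun p => L (fun om => F om p) in
  Ck_in D 2 U /\
  exists (Ut Utt : (I -> R) -> R) (Ux Uxx : 'I_n -> (I -> R) -> R) (Uy Uyy : 'I_N -> (I -> R) -> R),
     has_pderiv_in D U Ut None /\ has_pderiv_in D Ut Utt None /\
     (forall i, has_pderiv_in D U (Ux i) (Some (inl i)) /\
                has_pderiv_in D (Ux i) (Uxx i) (Some (inl i))) /\
     (forall k, has_pderiv_in D U (Uy k) (Some (inr k)) /\
                has_pderiv_in D (Uy k) (Uyy k) (Some (inr k))) /\
     (forall p, D p ->
        (2 * p None / INR N) * Utt p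
        - (sumR (fun i => Uxx i p) + sumR (fun k => Uyy k p)) = 0).
Proof.
move=> HL [Ft [Ftt [Fx [Fxx [Fy [Fyy [[a1 a2 a3] [[a4 a5 a6 a7] [[[a8 a9] a10 a11] a12]]]]]]]]] U.
have sp F' G' i : nice_all F' -> nice_all G' -> pd F' G' i ->
    has_pderiv_in D (fun p => L (fun om => F' om p)) (fun p => L (fun om => G' om p)) i.
  move=> nF nG h; have [lG /(_ i) [H [GH lH]]] := nG 1%N.
  exact: (superpose_pderiv _ w w1 _ _ _ _ _ HL F' G' H i (nF 0%N).1 lG (nice_loc _ _ _ _ _ _ 0 _ lH) h GH).
split; first exact: (superpose_Ck _ w w1).
exists (fun p => L (fun om => Ft om p)), (fun p => L (fun om => Ftt om p)),
  (fun i p => L (fun om => Fx i om p)), (fun i p => L (fun om => Fxx i om p)),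
  (fun i p => L (fun om => Fy i om p)), (fun i p => L (fun om => Fyy i om p)).
split; first exact: sp.
split; first exact: sp.
split; first by move=> i; have [h1 h2] := a10 i; split; apply: sp.
split; first by move=> i; have [h1 h2] := a11 i; split; apply: sp.
move=> p Dp.
have tm G : nice_all G -> tame w (fun om => G om p) by move=> h; exact: (loc_tame_at _ _ _ _ _ _ _ _ (h 0%N).1 Dp).
have Lsum m (G : 'I_m -> Om -> (I -> R) -> R) : (forall i, nice_all (G i)) ->
    tame w (fun om => sumR (fun i => G i om p)) /\ sumR (fun i => L (fun om => G i om p)) = L (fun om => sumR (fun i => G i om p)).
  by move=> hG; apply: (tame_sum _ _ w1) => // i; exact: tm.
have [t1 ->] := Lsum _ _ a5; have [t2 ->] := Lsum _ _ a7.
have tt := tm _ a3.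
rewrite -(tf_scal _ _ _ HL _ _ tt) -[X in _ - (_ + X)]Rmult_1_l -HL.1 //.
rewrite -(tf_sub _ _ _ HL).
- rewrite (_ : (fun om => _) = (fun=> 0 * 0)).
    rewrite (tf_scal _ _ _ HL); first ring.
    by apply: (tame_bounded _ _ 0) => om; rewrite Rabs_R0; lra.
  by apply: functional_extensionality => om; rewrite Rmult_1_l a12 // Rmult_0_l.
- apply: (tame_mul _ _ (fun=> 2 * p None / INR N)) => //.
  by apply: (tame_bounded _ _ (Rabs (2 * p None / INR N))) => om; lra.
- apply: (tame_add _ _ w1) => //.
  by rewrite (_ : (fun om => _) = (fun om => sumR (fun k => Fyy k om p))) //; apply: functional_extensionality => om; rewrite Rmult_1_l.
Qed.

End WaveFamilies.

Lemma bser_linear N c z l r : (0 < N)%N ->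
  bser N c z l r = Re c * bser N (RtoC 1) z l r - Im c * bser N (0, -1) z l r.
Proof.
move=> N0; rewrite /bser /PSeries -!Series_scal_l -Series_minus.
- apply: Series_ext => j; rewrite /bcoef; case: (c) => x y; case: (_ ^ _)%C => u v /=.
  by field; exact: INR_fact_neq_0.
- exact: (ex_series_scal (K := R_AbsRing) (V := R_NormedModule) _ _ (bser_ex N N0 _ z l r)).
- exact: (ex_series_scal (K := R_AbsRing) (V := R_NormedModule) _ _ (bser_ex N N0 _ z l r)).
Qed.

(** * Separated solutions of the wave equation *)

Section Separated.
Variables (Om : Type) (w : Om -> R).
Hypothesis w1 : forall om, 1 <= w om.
Variables (n N : nat) (t0 T : R).
Hypothesis N0 : (0 < N)%N.
Hypothesis t00 : 0 < t0.
Let I : finType := option ('I_n + 'I_N)%type.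
Let time : I := None.
Let xc (i : 'I_n) : I := Some (inl i).
Let yc (k : 'I_N) : I := Some (inr k).
Implicit Types F G : Om -> (I -> R) -> R.
Let NR : 1 <= INR N.
Proof. by rewrite -[1]/(INR 1); apply: le_INR; lia. Qed.
Let lt := loc_tame w time t0 T.
Let nice_all F := forall k, nice w time t0 T k F.
Let pd := pd Om I time t0 T.

Let xcI : injective xc.
Proof. by move=> i j [->]. Qed.

Variables (xi : Om -> 'I_n -> R) (bo : Om -> bool) (c : Om -> R) (e1 e2 d1 d2 : Om -> R -> R) (ka z : Om -> C).
Hypothesis txi : forall i, tame w (fun om => xi om i).
Hypothesis tre : tame w (fun om => Re (ka om)).
Hypothesis tim : tame w (fun om => Im (ka om)).
Hypothesis te : exists q A, forall om t, t0 <= t <= T ->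
  [/\ Rabs (e1 om t) <= A * w om ^ q, Rabs (e2 om t) <= A * w om ^ q,
      Rabs (d1 om t) <= A * w om ^ q & Rabs (d2 om t) <= A * w om ^ q].
Hypothesis de : forall om t, t0 <= t <= T ->
  [/\ is_derive (e1 om) t (d1 om t), is_derive (e2 om) t (d2 om t),
     is_derive (d1 om) t (- (INR N / (2 * t)) * (Re (ka om) * e1 om t - Im (ka om) * e2 om t)) &
     is_derive (d2 om) t (- (INR N / (2 * t)) * (Re (ka om) * e2 om t + Im (ka om) * e1 om t))].
Hypothesis tb : forall cc : C, Cmod cc <= 1 -> forall Rb l, exists q A, forall om r, 0 <= r <= Rb ->
  Rabs (c om * bser N cc (z om) l r) <= A * w om ^ q.
Hypothesis hz : forall om, z om = (RtoC (dot n (xi om) (xi om)) - ka om)%C.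

Definition sqradius (p : I -> R) := sumR (fun k => p (yc k) ^ 2) / (2 * INR N).

Lemma sqradius_upd_y p k s : sqradius (upd p (yc k) s) = sqradius p + (s ^ 2 - p (yc k) ^ 2) / (2 * INR N).
Proof.
rewrite /sqradius /sumR (bigD1 k) //= [in RHS](bigD1 k) //= upd_same.
rewrite (eq_bigr (fun j => p (yc j) ^ 2)).
  have alg (a b d u : R) : (a + u) / d = (b + u) / d + (a - b) / d by rewrite /Rdiv; ring.
  exact: alg.
by move=> j jk; rewrite upd_other //; apply: contra jk => /eqP [->].
Qed.

Lemma sqradius_upd_other p i s : (forall k, i <> yc k) -> sqradius (upd p i s) = sqradius p.
Proof.
move=> h; congr (_ / _); apply: eq_bigr => k _; rewrite upd_other //.
by apply/eqP => e; apply: (h k).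
Qed.

Let E1 om (p : I -> R) := e1 om (p time).
Let E2 om (p : I -> R) := e2 om (p time).
Let D1 om (p : I -> R) := d1 om (p time).
Let D2 om (p : I -> R) := d2 om (p time).
Let DD1 om (p : I -> R) := (- (INR N / 2)) * (/ p time * (Re (ka om) * E1 om p + -1 * (Im (ka om) * E2 om p))).
Let DD2 om (p : I -> R) := (- (INR N / 2)) * (/ p time * (Re (ka om) * E2 om p + Im (ka om) * E1 om p)).
Let B (cc : C) l om (p : I -> R) := c om * bser N cc (z om) l (sqradius p).
Let phase := phase Om I n xc xi.
Let T0 om (p : I -> R) := trig (bo om) (phase om p).

Let nmul k F G := nice_mul _ w w1 I time t0 T k F G.
Let nadd k F G := nice_add _ w w1 I time t0 T k F G.
Let nconst k a := nice_const _ w I time t0 T k a.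

Let pd_time (h h' : Om -> R -> R) : (forall om t, t0 <= t <= T -> is_derive (h om) t (h' om t)) ->
  pd (fun om p => h om (p time)) (fun om p => h' om (p time)) time.
Proof.
move=> H om; apply: has_pderiv_of_derive => p Dp.
by apply: (is_derive_ext (h om)) => [s|]; [rewrite upd_same|exact: H].
Qed.

Let pd_time_other (h : Om -> R -> R) i : time != i -> pd (fun om p => h om (p time)) (fun _ _ => 0) i.
Proof. by move=> ne; apply: pd_locally_const => om p s; rewrite upd_other. Qed.

Let pd_D1 : pd D1 DD1 time.
Proof.
apply: (pd_ext _ _ _ _ _ _ _ _ _ (pd_time d1 (fun om t => - (INR N / (2 * t)) * (Re (ka om) * e1 om t - Im (ka om) * e2 om t)) _)).
  by move=> om t ht; have [] := de om t ht.
by move=> om p [h1 h2]; rewrite /DD1 /E1 /E2; field; lra.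
Qed.

Let pd_D2 : pd D2 DD2 time.
Proof.
apply: (pd_ext _ _ _ _ _ _ _ _ _ (pd_time d2 (fun om t => - (INR N / (2 * t)) * (Re (ka om) * e2 om t + Im (ka om) * e1 om t)) _)).
  by move=> om t ht; have [] := de om t ht.
by move=> om p [h1 h2]; rewrite /DD2 /E1 /E2; field; lra.
Qed.

Let pd_E1 : pd E1 D1 time.
Proof. by apply: pd_time => om t ht; have [] := de om t ht. Qed.

Let pd_E2 : pd E2 D2 time.
Proof. by apply: pd_time => om t ht; have [] := de om t ht. Qed.

(** The differential equation expresses the derivatives of [D1] and [D2] by [E1], [E2] and [1 / t];
    bounds on these four functions therefore control derivatives of every order. *)
Let nice_E k : [/\ nice w time t0 T k E1, nice w time t0 T k E2, nice w time t0 T k D1 & nice w time t0 T k D2].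
Proof.
have [q [A h]] := te.
have l : [/\ lt E1, lt E2, lt D1 & lt D2].
  by split=> Rb; exists q, A => om p Dp _; have [] := h om _ Dp.
move: l => [l1 l2 l3 l4].
elim: k => [|k [i1 i2 i3 i4]]; first by split.
have nz i F : pd F (fun _ _ => 0) i -> exists G, pd F G i /\ nice w time t0 T k G.
  by move=> hF; exists (fun _ _ => 0); split=> //; exact: nice_zero.
have ninv := nice_inv_time Om w w1 I time t0 T k t00.
have nsc a F := nice_scale Om w w1 I time t0 T k a F.
have cmul (a : Om -> R) F : tame w a -> nice w time t0 T k F -> nice w time t0 T k (fun om p => a om * F om p).
  by move=> ta; apply: nmul; exact: nconst.
split; apply: nice_succ => // i; case: (altP (time =P i)) => [<-|ne];
  try (by apply: nz; apply: pd_time_other).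
- by exists D1.
- by exists D2.
- exists DD1; split=> //; apply: (nsc); apply: nmul => //; apply: nadd; first exact: cmul.
  by apply: (nsc); exact: cmul.
- exists DD2; split=> //; apply: (nsc); apply: nmul => //; apply: nadd; exact: cmul.
Qed.

Let nice_DD : nice_all DD1 /\ nice_all DD2.
Proof.
have cmul k (a : Om -> R) F : tame w a -> nice w time t0 T k F -> nice w time t0 T k (fun om p => a om * F om p).
  by move=> ta; apply: nmul; exact: nconst.
split=> k; have [i1 i2 i3 i4] := nice_E k; apply: nice_scale => //.
- apply: nmul; first exact: nice_inv_time.
  by apply: nadd; [exact: cmul|apply: nice_scale => //; exact: cmul].
- by apply: nmul; [exact: nice_inv_time|apply: nadd; exact: cmul].
Qed.

Let pd_B cc l k : pd (B cc l) (fun om p => / INR N * (p (yc k) * B cc l.+1 om p)) (yc k).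
Proof.
move=> om; apply: has_pderiv_of_derive => p Dp; rewrite /B.
apply: (is_derive_ext (fun s => c om * bser N cc (z om) l (sqradius p + (s ^ 2 - p (yc k) ^ 2) / (2 * INR N)))).
  by move=> s; rewrite sqradius_upd_y.
evar_last.
  apply: (is_derive_scal (fun s => bser N cc (z om) l (sqradius p + (s ^ 2 - p (yc k) ^ 2) / (2 * INR N)))).
  apply: (is_derive_comp (bser N cc (z om) l)); first exact: bser_derive.
  by auto_derive; [|reflexivity].
rewrite (_ : sqradius p + (p (yc k) ^ 2 - p (yc k) ^ 2) / (2 * INR N) = sqradius p); last by field; lra.
by rewrite /scal /= /mult /=; field; lra.
Qed.

Let pd_B_other cc l i : (forall k, i <> yc k) -> pd (B cc l) (fun _ _ => 0) i.
Proof. by move=> h; apply: pd_locally_const => om p s; rewrite /B sqradius_upd_other. Qed.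

Let nice_B cc l : Cmod cc <= 1 -> nice_all (B cc l).
Proof.
move=> hcc k; elim: k l => [|k IH] l.
all: have lB : lt (B cc l).
1,3: move=> Rb; have [q [A h]] := tb cc hcc (Rabs Rb ^ 2) l; exists q, A => om p Dp hp; apply: h.
1,2: have pk (i : 'I_N) : 0 <= p (yc i) ^ 2 <= Rabs Rb ^ 2.
1,3: split; [exact: pow2_ge_0|rewrite -(pow2_abs (p (yc i))); apply: pow_incr; split; [exact: Rabs_pos|apply: Rle_trans (hp (yc i)) _; exact: Rle_abs]].
1,2: have R2 : 0 <= Rabs Rb ^ 2 by exact: pow2_ge_0.
1,2: have s1 : 0 <= sumR (fun k => p (yc k) ^ 2) by rewrite /sumR; elim/big_ind: _ => [|*|i _]; [lra|lra|have := pk i; lra].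
1,2: have s2 : sumR (fun k => p (yc k) ^ 2) <= INR N * Rabs Rb ^ 2
  by have e := rsum_const 'I_N (Rabs Rb ^ 2); rewrite card_ord in e; rewrite -e; apply: rsum_le => i; have := pk i; lra.
1,2: rewrite /sqradius; split; first by apply: Rdiv_le_0_compat; lra.
1,2: apply: (Rmult_le_reg_r (2 * INR N)); first lra.
1,2: rewrite /Rdiv Rmult_assoc Rinv_l ?Rmult_1_r; nra.
- by split.
- apply: nice_succ => // -[[i|j]|].
  + exists (fun _ _ => 0); split; last exact: nice_zero.
    by apply: pd_B_other.
  + exists (fun om p => / INR N * (p (yc j) * B cc l.+1 om p)); split; first exact: pd_B.
    by apply: nice_scale => //; apply: nmul => //; exact: nice_coord.
  + exists (fun _ _ => 0); split; last exact: nice_zero.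
    by apply: pd_B_other.
Qed.

Let trig_pd := pd_trig Om I time t0 T n xc xcI xi.
Let trig_pd_other := pd_trig_other Om I time t0 T n xc xi.
Let trig_nice b k := nice_trig Om w w1 I time t0 T n xc xcI xi txi k b.

(** The common shape of the mode and of all its derivatives: the real part of a product of two
    complex factors, times a phase. *)
Let comb (a b u v t : Om -> (I -> R) -> R) om (p : I -> R) := (a om p * u om p + -1 * (b om p * v om p)) * t om p.

Let nice_comb a b u v t : nice_all a -> nice_all b -> nice_all u -> nice_all v -> nice_all t -> nice_all (comb a b u v t).
Proof.
move=> ha hb hu hv ht k; apply: nmul => //; apply: nadd; first exact: nmul.
by apply: nice_scale => //; exact: nmul.
Qed.

Let pd_comb a a' b b' u u' v v' t t' i : pd a a' i -> pd b b' i -> pd u u' i -> pd v v' i -> pd t t' i ->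
  pd (comb a b u v t) (fun om p => (a' om p * u om p + a om p * u' om p
      + -1 * (b' om p * v om p + b om p * v' om p)) * t om p
      + (a om p * u om p + -1 * (b om p * v om p)) * t' om p) i.
Proof.
move=> ha hb hu hv ht om.
have hm := pderiv_mul _ _ _ _ _ _ (pderiv_const (fun p : I -> R => t0 <= p None <= T) (-1) i) (pderiv_mul _ _ _ _ _ _ (hb om) (hv om)).
have := pderiv_mul _ _ _ _ _ _ (pderiv_add _ _ _ _ _ _ (pderiv_mul _ _ _ _ _ _ (ha om) (hu om)) hm) (ht om).
set g := (X in has_pderiv_in _ _ X _) => h.
set g' := (X in has_pderiv_in _ _ X _).
rewrite (_ : g' = g) //; apply: functional_extensionality => p; rewrite /g /g'; ring.
Qed.

Let mi : C := (0, -1).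

(** The real part of [E b_z(r)], times [c] and a phase: the coefficient [- i = (0, -1)] extracts the
    imaginary part of [b_z]. *)
Definition separated om (p : I -> R) :=
  (e1 om (p time) * (c om * bser N (RtoC 1) (z om) 0 (sqradius p)) +
   -1 * (e2 om (p time) * (c om * bser N (0, -1) (z om) 0 (sqradius p)))) *
  trig (bo om) (dot n (xi om) (fun i => p (xc i))).

Lemma separated_wave_family : wave_family Om w n N t0 T separated.
Proof.
have c1 : Cmod (RtoC 1) <= 1 by rewrite Cmod_R Rabs_R1; lra.
have cmi : Cmod mi <= 1 by rewrite /mi /Cmod /= -[X in _ <= X]sqrt_1; apply: sqrt_le_1_alt; lra.
have nE k : _ := nice_E k.
have [nDD1 nDD2] := nice_DD.
have n1 : nice_all E1 by move=> k; have [] := nE k.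
have n2 : nice_all E2 by move=> k; have [] := nE k.
have n3 : nice_all D1 by move=> k; have [] := nE k.
have n4 : nice_all D2 by move=> k; have [] := nE k.
have nT0 : nice_all T0 := trig_nice bo.
pose TX i om p := (xi om i * (if bo om then -1 else 1)) * trig (~~ bo om) (phase om p).
pose TXX i om p := (-1 * (xi om i * xi om i)) * T0 om p.
have nTX i : nice_all (TX i).
  by move=> k; apply: nmul; [apply: nconst; apply: tame_sg; exact: txi|exact: (trig_nice (fun om => ~~ bo om))].
have nTXX i : nice_all (TXX i).
  move=> k; apply: nmul => //; apply: nconst; apply: tame_mul; last exact: tame_mul.
  by apply: (tame_bounded _ _ 1) => om; rewrite Rabs_Ropp Rabs_R1; lra.
pose BY cc l k om p := / INR N * (p (yc k) * B cc l.+1 om p).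
pose BYY cc k om p := / INR N * B cc 1 om p + / INR N * (p (yc k) * BY cc 1%N k om p).
have nBY cc l k : Cmod cc <= 1 -> nice_all (BY cc l k).
  by move=> h m; apply: nice_scale => //; apply: nmul; [exact: nice_coord|exact: nice_B].
have nBYY cc k : Cmod cc <= 1 -> nice_all (BYY cc k).
  move=> h m; apply: nadd; apply: nice_scale => //; first exact: nice_B.
  by apply: nmul; [exact: nice_coord|exact: nBY].
have tne k : time <> yc k by [].
have tnx j : time <> xc j by [].
have xny i k : xc i <> yc k by [].
have ynx k j : yc k <> xc j by [].
have timex (h : Om -> R -> R) i : pd (fun om p => h om (p time)) (fun _ _ => 0) (xc i) by exact: pd_time_other.
have timey (h : Om -> R -> R) k : pd (fun om p => h om (p time)) (fun _ _ => 0) (yc k) by exact: pd_time_other.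
exists (comb D1 D2 (B (RtoC 1) 0) (B mi 0) T0), (comb DD1 DD2 (B (RtoC 1) 0) (B mi 0) T0),
  (fun i => comb E1 E2 (B (RtoC 1) 0) (B mi 0) (TX i)), (fun i => comb E1 E2 (B (RtoC 1) 0) (B mi 0) (TXX i)),
  (fun k => comb E1 E2 (BY (RtoC 1) 0%N k) (BY mi 0%N k) T0), (fun k => comb E1 E2 (BYY (RtoC 1) k) (BYY mi k) T0).
have nB1 : nice_all (B (RtoC 1) 0) by exact: nice_B.
have nB2 : nice_all (B mi 0) by exact: nice_B.
split; first by split; apply: nice_comb.
split.
  split.
  - by move=> i; apply: nice_comb.
  - by move=> i; apply: nice_comb.
  - by move=> k; apply: nice_comb => //; exact: nBY.
  - by move=> k; apply: nice_comb => //; exact: nBYY.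
split.
  split.
  - split.
    + apply: (pd_ext _ _ _ _ _ _ _ _ _ (pd_comb _ _ _ _ _ _ _ _ _ _ _ pd_E1 pd_E2 (pd_B_other (RtoC 1) 0%N _ tne) (pd_B_other mi 0%N _ tne) (trig_pd_other bo _ tnx))).
      by move=> om p _; rewrite /comb /T0 /phase; ring.
    + apply: (pd_ext _ _ _ _ _ _ _ _ _ (pd_comb _ _ _ _ _ _ _ _ _ _ _ pd_D1 pd_D2 (pd_B_other (RtoC 1) 0%N _ tne) (pd_B_other mi 0%N _ tne) (trig_pd_other bo _ tnx))).
      by move=> om p _; rewrite /comb /T0 /phase; ring.
  - move=> i; split.
    + apply: (pd_ext _ _ _ _ _ _ _ _ _ (pd_comb _ _ _ _ _ _ _ _ _ _ _ (timex e1 i) (timex e2 i) (pd_B_other (RtoC 1) 0%N _ (xny i)) (pd_B_other mi 0%N _ (xny i)) (trig_pd bo i))).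
      by move=> om p _; rewrite /comb /TX /T0 /phase /E1 /E2; ring.
    + have hTX : pd (TX i) (TXX i) (xc i).
        move=> om; have := pderiv_mul _ _ _ _ _ _ (pderiv_const (fun p : I -> R => t0 <= p None <= T) (xi om i * (if bo om then -1 else 1)) (xc i)) (trig_pd (fun om => ~~ bo om) i om).
        set g := (X in has_pderiv_in _ _ X _) => h.
        rewrite (_ : TXX i om = g) //; apply: functional_extensionality => p.
        by rewrite /g /TXX /T0 /phase negbK; case: (bo om) => /=; ring.
      apply: (pd_ext _ _ _ _ _ _ _ _ _ (pd_comb _ _ _ _ _ _ _ _ _ _ _ (timex e1 i) (timex e2 i) (pd_B_other (RtoC 1) 0%N _ (xny i)) (pd_B_other mi 0%N _ (xny i)) hTX)).
      by move=> om p _; rewrite /comb /T0 /phase /E1 /E2; ring.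
  - move=> k; split.
    + apply: (pd_ext _ _ _ _ _ _ _ _ _ (pd_comb _ _ _ _ _ _ _ _ _ _ _ (timey e1 k) (timey e2 k) (pd_B (RtoC 1) 0%N k) (pd_B mi 0%N k) (trig_pd_other bo _ (ynx k)))).
      by move=> om p _; rewrite /comb /BY /T0 /phase /E1 /E2; ring.
    + have hBY cc : pd (BY cc 0%N k) (BYY cc k) (yc k).
        move=> om.
        have hy : has_pderiv_in (fun p : I -> R => t0 <= p None <= T) (fun p => p (yc k)) (fun=> 1) (yc k).
          by apply: has_pderiv_of_derive => p _; apply: (is_derive_ext id) => [s|]; [rewrite upd_same|exact: is_derive_id].
        have := pderiv_mul _ _ _ _ _ _ (pderiv_const (fun p : I -> R => t0 <= p None <= T) (/ INR N) (yc k)) (pderiv_mul _ _ _ _ _ _ hy (pd_B cc 1%N k om)).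
        set g := (X in has_pderiv_in _ _ X _) => h.
        rewrite (_ : BYY cc k om = g) //; apply: functional_extensionality => p.
        by rewrite /g /BYY /BY; ring.
      apply: (pd_ext _ _ _ _ _ _ _ _ _ (pd_comb _ _ _ _ _ _ _ _ _ _ _ (timey e1 k) (timey e2 k) (hBY (RtoC 1)) (hBY mi) (trig_pd_other bo _ (ynx k)))).
      by move=> om p _; rewrite /comb /T0 /phase /E1 /E2; ring.
move=> om p [h1 h2].
have p0 : 0 < p time := Rlt_le_trans _ _ _ t00 h1.
set r := sqradius p.
set lam := dot n (xi om) (xi om).
have sx : sumR (fun i => comb E1 E2 (B (RtoC 1) 0) (B mi 0) (TXX i) om p) =
    - lam * ((E1 om p * B (RtoC 1) 0 om p - E2 om p * B mi 0 om p) * T0 om p).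
  rewrite (_ : - lam * _ = (- ((E1 om p * B (RtoC 1) 0 om p - E2 om p * B mi 0 om p) * T0 om p)) * lam); last ring.
  by rewrite /lam /dot -sumR_scal; apply: eq_bigr => i _; rewrite /comb /TXX; ring.
have s2 : sumR (fun k => p (yc k) ^ 2) = 2 * INR N * r by rewrite /r /sqradius; field; lra.
have sy : sumR (fun k => comb E1 E2 (BYY (RtoC 1) k) (BYY mi k) T0 om p) =
    (E1 om p * (B (RtoC 1) 1 om p + 2 * r / INR N * B (RtoC 1) 2 om p)
     - E2 om p * (B mi 1 om p + 2 * r / INR N * B mi 2 om p)) * T0 om p.
  rewrite (_ : sumR _ = sumR (fun k : 'I_N => / INR N * ((E1 om p * B (RtoC 1) 1 om p - E2 om p * B mi 1 om p) * T0 om p)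
     + / INR N ^ 2 * ((E1 om p * B (RtoC 1) 2 om p - E2 om p * B mi 2 om p) * T0 om p) * p (yc k) ^ 2)).
    rewrite sumR_add [X in _ + X]sumR_scal s2 /sumR rsum_const card_ord; field; lra.
  by apply: eq_bigr => k _; rewrite /comb /BYY /BY; field; lra.
have ode cc : B cc 1 om p + 2 * r / INR N * B cc 2 om p = c om * bser N (cc * z om)%C (z om) 0 r.
  by rewrite -(bser_ode N N0) /B -/r; ring.
rewrite sx sy !ode (bser_linear _ (RtoC 1 * z om)%C) // (bser_linear _ (mi * z om)%C) //.
rewrite /comb /DD1 /DD2 /B -/r.
have zr : Re (z om) = lam - Re (ka om) by rewrite hz -/lam; case: (ka om) => x y; rewrite /=; ring.
have zi : Im (z om) = - Im (ka om) by rewrite hz -/lam; case: (ka om) => x y; rewrite /=; ring.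
have a1 : Re (RtoC 1 * z om) = Re (z om) by case: (z om) => x y; rewrite /=; ring.
have a2 : Im (RtoC 1 * z om) = Im (z om) by case: (z om) => x y; rewrite /=; ring.
have a3 : Re (mi * z om) = Im (z om) by case: (z om) => x y; rewrite /=; ring.
have a4 : Im (mi * z om) = - Re (z om) by case: (z om) => x y; rewrite /=; ring.
rewrite a1 a2 a3 a4 zr zi -/mi; rewrite /time in p0 *.
by field; lra.
Qed.

End Separated.

Lemma Cmod_sqr (z : C) : Cmod z ^ 2 = Re z ^ 2 + Im z ^ 2.
Proof.
rewrite /Cmod; apply: pow2_sqrt.
by have := pow2_ge_0 (Re z); have := pow2_ge_0 (Im z); rewrite /Re /Im; lra.
Qed.

Lemma upper_sqrt (z : C) : exists mu : C, [/\ (mu * mu)%C = z, 0 <= Im mu,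
  Im mu ^ 2 = (Cmod z - Re z) / 2 & Cmod mu ^ 2 = Cmod z].
Proof.
have hx : Rabs (Re z) <= Cmod z := re_le_Cmod z.
have m2 := Cmod_sqr z.
set x := Re z in hx m2 *; set y := Im z in m2; set m := Cmod z in hx m2 *.
have a0 : 0 <= (m + x) / 2 by split_Rabs; lra.
have b0 : 0 <= (m - x) / 2 by split_Rabs; lra.
pose u := sqrt ((m + x) / 2); pose v := sqrt ((m - x) / 2).
have u2 : u * u = (m + x) / 2 by apply: sqrt_sqrt.
have v2 : v * v = (m - x) / 2 by apply: sqrt_sqrt.
have u0 : 0 <= u := sqrt_pos _; have v0 : 0 <= v := sqrt_pos _.
have uv : 2 * (u * v) = Rabs y.
  apply: Rsqr_inj; [by apply: Rmult_le_pos; [lra|exact: Rmult_le_pos]|exact: Rabs_pos|].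
  rewrite -Rsqr_abs /Rsqr (_ : _ * _ = 4 * (u * u) * (v * v)); last ring.
  by rewrite u2 v2; have := m2; lra.
pose s := if Rle_dec 0 y then 1 else -1.
have s2 : s * s = 1 by rewrite /s; destruct (Rle_dec 0 y) => /=; ring.
have sy : s * Rabs y = y by rewrite /s; destruct (Rle_dec 0 y) => /=; split_Rabs; lra.
exists (s * u, v); split=> //=.
- rewrite /Cmult /= [RHS]surjective_pairing -/(Re z) -/(Im z) -/x -/y; congr (_, _).
    by rewrite (_ : s * u * (s * u) = s * s * (u * u)); [rewrite s2 u2 v2; field|ring].
  by rewrite -sy -uv; ring.
- by rewrite Rmult_1_r v2.
- have := Cmod_sqr (s * u, v); rewrite /Re /Im /= !Rmult_1_r => ->.
  by rewrite (_ : s * u * (s * u) = s * s * (u * u)); [rewrite s2 u2 v2; field|ring].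
Qed.

Definition is_time_factor (t0 T : R) (N : nat) (ka : C) (E1 E2 D1 D2 : R -> R) :=
  [/\ E1 T = 1, E2 T = 0 &
   forall t, t0 <= t <= T -> [/\ is_derive E1 t (D1 t), is_derive E2 t (D2 t),
     is_derive D1 t (- (INR N / (2 * t)) * (Re ka * E1 t - Im ka * E2 t)) &
     is_derive D2 t (- (INR N / (2 * t)) * (Re ka * E2 t + Im ka * E1 t))]].

Definition decaying_time_factors t0 T d0 C0 := forall (N : nat) (ka : C), (0 < N)%N -> d0 <= Cmod ka ->
  exists E1 E2 D1 D2 : R -> R, [/\ is_time_factor t0 T N ka E1 E2 D1 D2,
    forall t, t0 <= t <= T -> Cmod (E1 t, E2 t) <= 2 * exp (- (sqrt (INR N * (Cmod ka - Re ka)) * (sqrt T - sqrt t))) &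
    forall t, t0 <= t <= T -> Cmod (D1 t, D2 t) <= C0 * (2 + 2 * INR N * Cmod ka)].

(** [(2 t / N) E'' = - kappa E] is [4 t E'' = - mu^2 E] with [mu^2 = 2 N kappa], and then
    [Im mu = sqrt (N (|kappa| - Re kappa))]. As [N >= 1], the threshold [d0 = M0^2 / 2] on [|kappa|]
    guarantees [|mu| >= M0] for all [N] at once. *)
Lemma time_factor t0 T : 0 < t0 -> t0 < T ->
  exists d0 C0, [/\ 0 < d0, 0 <= C0 & decaying_time_factors t0 T d0 C0].
Proof.
move=> t00 t0T; have [M0 [C0 [M00 C00 H]]] := time_solution t0 T t00 t0T.
have M2 : 0 < M0 ^ 2 by apply: pow_lt.
exists (M0 ^ 2 / 2), C0; split=> //; first lra.
move=> N ka N0 hka.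
have NR : 1 <= INR N by rewrite -[1]/(INR 1); apply: le_INR; lia.
have [mu [m1 m2 m3 m4]] := upper_sqrt (RtoC (2 * INR N) * ka)%C.
have cm : Cmod (RtoC (2 * INR N) * ka)%C = 2 * INR N * Cmod ka.
  by rewrite Cmod_mult Cmod_R Rabs_pos_eq; lra.
have rm : Re (RtoC (2 * INR N) * ka)%C = 2 * INR N * Re ka by case: (ka) => x y; rewrite /=; ring.
have im : Im (RtoC (2 * INR N) * ka)%C = 2 * INR N * Im ka by case: (ka) => x y; rewrite /=; ring.
have ka0 := Cmod_ge_0 ka.
have mu0 := Cmod_ge_0 mu.
have hM : M0 <= Cmod mu.
  apply: Rsqr_incr_0_var => //; rewrite /Rsqr.
  have : M0 ^ 2 <= Cmod mu ^ 2 by rewrite m4 cm; nra.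
  by rewrite /=; lra.
have [E1 [E2 [D1 [D2 [[i1 i2 hd hb] hD]]]]] := H mu m2 hM.
exists E1, E2, D1, D2; split.
- split=> // t ht; have tp : 0 < t by lra.
  have [h1 h2 h3 h4] := hd t ht; rewrite m1 rm im in h3 h4; split=> //.
  + by rewrite (_ : - (INR N / (2 * t)) * _ = - / (4 * t) * (2 * INR N * Re ka * E1 t - 2 * INR N * Im ka * E2 t)) //; field; lra.
  + by rewrite (_ : - (INR N / (2 * t)) * _ = - / (4 * t) * (2 * INR N * Re ka * E2 t + 2 * INR N * Im ka * E1 t)) //; field; lra.
- move=> t ht; have := hb t ht; suff -> : Im mu = sqrt (INR N * (Cmod ka - Re ka)) by [].
  rewrite -[LHS](sqrt_pow2 _ m2) m3 cm rm; congr sqrt; field.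
- move=> t ht; apply: Rle_trans (hD t ht) _; apply: Rmult_le_compat_l => //.
  have := pow2_ge_0 (Cmod mu - 1); rewrite -cm -m4; nra.
Qed.

(** * Superposition of heat modes *)

Section HeatFamily.
Variables (Om : Type) (w : Om -> R).
Hypothesis w1 : forall om, 1 <= w om.
Variables (n : nat) (t0 T : R).
Let I : finType := option 'I_n.
Let time : I := None.
Variables (xi : Om -> 'I_n -> R) (bo : Om -> bool).
Hypothesis txi : forall i, tame w (fun om => xi om i).
Let lam om := dot n (xi om) (xi om).
Hypothesis tlam : tame w lam.
Let D := fun p : I -> R => t0 <= p time <= T.

Definition heat_mode om (p : I -> R) :=
  exp (- (lam om * (T - p time))) * trig (bo om) (dot n (xi om) (fun i => p (Some i))).

Let xcI : injective (@Some 'I_n).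
Proof. by move=> i j [->]. Qed.

Let EX om (p : I -> R) := exp (- (lam om * (T - p time))).
Let ph := phase Om I n Some xi.

Let EX_le1 om p : D p -> 0 < EX om p <= 1.
Proof.
move=> [h1 h2]; split; first exact: exp_pos.
rewrite -exp_0 /EX; have : 0 <= lam om * (T - p time) by apply: Rmult_le_pos; [exact: dot_self_ge0|lra].
case=> [h|<-]; last by rewrite Ropp_0; lra.
by apply: Rlt_le; apply: exp_increasing; lra.
Qed.

Let pd_EX : pd Om I time t0 T EX (fun om p => lam om * EX om p) time.
Proof.
move=> om; apply: has_pderiv_of_derive => p Dp.
apply: (is_derive_ext (fun s => exp (- (lam om * (T - s))))) => [s|]; first by rewrite /EX upd_same.
by auto_derive => //; rewrite /EX -/(T - p time); ring.
Qed.

Let pd_EX_other i : time != i -> pd Om I time t0 T EX (fun _ _ => 0) i.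
Proof. by move=> ne; apply: pd_locally_const => om p s; rewrite /EX upd_other. Qed.

Let nice_EX k : nice w time t0 T k EX.
Proof.
have l : loc_tame w time t0 T EX.
  move=> Rb; exists 0%N, 1 => om p Dp _; rewrite /= Rmult_1_r.
  by have [h1 h2] := EX_le1 om p Dp; rewrite Rabs_pos_eq; lra.
elim: k => [|k IH]; first by split.
apply: nice_succ => // i; case: (altP (time =P i)) => [<-|ne].
  exists (fun om p => lam om * EX om p); split=> //; exact: nice_tame_mul.
by exists (fun _ _ => 0); split; [exact: pd_EX_other|exact: nice_zero].
Qed.

Theorem superpose_heat (L : (Om -> R) -> R) (h : ('I_n -> R) -> R) : tame_functional w L ->
  (forall x, L (fun om => trig (bo om) (dot n (xi om) x)) = h x) ->
  heat_solution t0 T h (fun t x => L (fun om => exp (- (lam om * (T - t))) * trig (bo om) (dot n (xi om) x))).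
Proof.
move=> HL hL; rewrite /heat_solution.
set V := uncurry2 _.
have VE : V = (fun p => L (fun om => heat_mode om p)) by [].
have nT k b : nice w time t0 T k (fun om p => trig (b om) (ph om p)) := nice_trig Om w w1 I time t0 T n Some xcI xi txi k b.
have nE k : nice w time t0 T k heat_mode by apply: nice_mul => //; exact: (nT k bo).
pose Vt om p := lam om * heat_mode om p.
pose Vx i om p := EX om p * ((xi om i * (if bo om then -1 else 1)) * trig (~~ bo om) (ph om p)).
pose Vxx i om p := (-1 * (xi om i * xi om i)) * heat_mode om p.
have nVt k : nice w time t0 T k Vt by exact: nice_tame_mul.
have nVx i k : nice w time t0 T k (Vx i).
  apply: nice_mul => //; apply: (nice_tame_mul _ _ w1); [exact: tame_sg|exact: (nT k (fun om => ~~ bo om))].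
have txx i : tame w (fun om => -1 * (xi om i * xi om i)).
  apply: tame_mul; last exact: tame_mul.
  by apply: (tame_bounded _ _ 1) => om; rewrite Rabs_Ropp Rabs_R1; lra.
have nVxx i k : nice w time t0 T k (Vxx i) by exact: nice_tame_mul.
have sp F G i : (forall k, nice w time t0 T k F) -> (forall k, nice w time t0 T k G) -> pd Om I time t0 T F G i ->
    has_pderiv_in D (fun p => L (fun om => F om p)) (fun p => L (fun om => G om p)) i.
  move=> nF nG hFG; have [lG /(_ i) [H [GH lH]]] := nG 1%N.
  exact: (superpose_pderiv _ w w1 _ _ _ _ _ HL F G H i (nF 0%N).1 lG (nice_loc _ _ _ _ _ _ 0 _ lH) hFG GH).
have tpd := pd_trig Om I time t0 T n Some xcI xi.
have pm (F F' G G' : Om -> (I -> R) -> R) i : pd Om I time t0 T F F' i -> pd Om I time t0 T G G' i ->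
   pd Om I time t0 T (fun om p => F om p * G om p) (fun om p => F' om p * G om p + F om p * G' om p) i.
  by move=> hF hG om; apply: pderiv_mul.
split.
  by move=> k; rewrite VE; apply: (superpose_Ck _ w w1).
split; last first.
  move=> x; rewrite -(hL x); congr L; apply: functional_extensionality => om.
  by rewrite Rminus_diag Rmult_0_r Ropp_0 exp_0 Rmult_1_l.
exists (fun p => L (fun om => Vt om p)), (fun i p => L (fun om => Vx i om p)), (fun i p => L (fun om => Vxx i om p)).
split.
  rewrite VE; apply: sp => //.
  apply: (pd_ext _ _ _ _ _ _ _ _ _ (pm _ _ _ _ _ pd_EX (pd_trig_other Om I time t0 T n Some xi bo None _))) => //.
  by move=> om p _; rewrite /Vt /heat_mode /EX /phase; ring.
split.
  move=> i; split.
    rewrite VE; apply: sp => //.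
    apply: (pd_ext _ _ _ _ _ _ _ _ _ (pm _ _ _ _ _ (pd_EX_other (Some i) isT) (tpd bo i))).
    by move=> om p _; rewrite /Vx /ph; ring.
  apply: sp => //.
  have h2 : pd Om I time t0 T (fun om p => (xi om i * (if bo om then -1 else 1)) * trig (~~ bo om) (ph om p))
      (fun om p => (xi om i * (if bo om then -1 else 1)) * ((xi om i * (if ~~ bo om then -1 else 1)) * trig (bo om) (ph om p))) (Some i).
    move=> om; have := pderiv_mul _ _ _ _ _ _ (pderiv_const (fun p : I -> R => t0 <= p time <= T) (xi om i * (if bo om then -1 else 1)) (Some i)) (tpd (fun om => ~~ bo om) i om).
    set g := (X in has_pderiv_in _ _ X _) => H.
    set g' := (X in has_pderiv_in _ _ X _).
    rewrite (_ : g' = g) //; apply: functional_extensionality => p; rewrite /g /g' negbK /ph; ring.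
  apply: (pd_ext _ _ _ _ _ _ _ _ _ (pm _ _ _ _ _ (pd_EX_other (Some i) isT) h2)).
  by move=> om p _; rewrite /Vxx /heat_mode /EX /ph /phase; case: (bo om) => /=; ring.
move=> p Dp.
have tm G : (forall k, nice w time t0 T k G) -> tame w (fun om => G om p).
  by move=> hG; exact: (loc_tame_at _ _ _ _ _ _ _ _ (hG 0%N).1 Dp).
have tz : tame w (fun=> 0) by apply: (tame_bounded _ _ 0) => om; rewrite Rabs_R0; lra.
have [ts Ls] : tame w (fun om => sumR (fun i => Vxx i om p)) /\
    sumR (fun i => L (fun om => Vxx i om p)) = L (fun om => sumR (fun i => Vxx i om p)).
  by apply: (tame_sum _ _ w1) => // i; apply: tm.
rewrite Ls -[X in _ + X]Rmult_1_l -HL.1 //; last exact: tm.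
rewrite (_ : (fun om => _) = (fun=> 0 * 0)).
  by rewrite (tf_scal _ _ _ HL) //; ring.
apply: functional_extensionality => om.
have -> : sumR (fun i => Vxx i om p) = - lam om * heat_mode om p.
  rewrite (_ : - lam om * _ = - heat_mode om p * lam om); last ring.
  by rewrite /lam /dot -sumR_scal; apply: eq_bigr => i _; rewrite /Vxx; ring.
by rewrite /Vt; ring.
Qed.

End HeatFamily.

(** * Approximation of the backward heat flow *)

(** The angle needs no weight: a mean over the circle is bounded by any bound that is uniform in the
    angle. *)
Lemma product_functional (Om0 : Type) (w : Om0 -> R) (L : (Om0 -> R) -> R) (Th : (R -> R) -> R) :
  tame_functional w L -> mean_functional Th ->
  tame_functional (fun om : Om0 * R => w om.1) (fun F => L (fun o => Th (fun th => F (o, th)))).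
Proof.
move=> [l1 l2] hTh; split.
  move=> F G c [q [A hF]] [q' [B hG]]; rewrite -l1.
  - congr L; apply: functional_extensionality => o.
    by apply: (mean_lin _ hTh _ _ _ (A * w o ^ q) (B * w o ^ q')) => th; [exact: (hF (o, th))|exact: (hG (o, th))].
  - by exists q, A => o; apply: (mean_abs _ hTh) => th; exact: (hF (o, th)).
  - by exists q', B => o; apply: (mean_abs _ hTh) => th; exact: (hG (o, th)).
move=> q; have [C [C0 hC]] := l2 q; exists C; split=> // F A hF; apply: hC => o.
by apply: (mean_abs _ hTh) => th; exact: (hF (o, th)).
Qed.

Lemma mx_app_sqr N (A : 'I_N -> 'I_N -> R) (y : 'I_N -> R) : orthogonal_mx A ->
  sumR (fun i => mx_app A y i ^ 2) = sumR (fun i => y i ^ 2).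
Proof.
move=> hA.
have sqE (f : 'I_N -> R) : sumR f ^ 2 = sumR (fun j => sumR (fun k => f j * f k)).
  rewrite (_ : sumR f ^ 2 = sumR f * sumR f); last by rewrite /=; ring.
  by rewrite -sumR_scal; apply: eq_bigr => j _; rewrite Rmult_comm -sumR_scal.
transitivity (sumR (fun j => sumR (fun k => y j * y k * sumR (fun i => A i j * A i k)))).
  transitivity (sumR (fun i => sumR (fun j => sumR (fun k => (A i j * y j) * (A i k * y k))))).
    by apply: eq_bigr => i _; rewrite sqE.
  rewrite /sumR exchange_big; apply: eq_bigr => j _; rewrite exchange_big; apply: eq_bigr => k _.
  by rewrite -rsum_scal; apply: eq_bigr => i _; ring.
apply: eq_bigr => j _; rewrite {1}/sumR (bigD1 j) //= hA eqxx big1; first by ring.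
by move=> k kj; rewrite hA eq_sym (negbTE kj) Rmult_0_r.
Qed.

Lemma sqradius_paraboloid n N t (N0 : (0 < N)%N) (p : option ('I_n + 'I_N) -> R) : 0 <= t ->
  (forall k : 'I_N, p (Some (inr k)) = if nat_of_ord k == 0%N then sqrt (2 * INR N * t) else 0) ->
  sqradius n N p = t.
Proof.
move=> ht hp; rewrite /sqradius.
have Np : 0 < INR N by apply: lt_0_INR; lia.
have -> : sumR (fun k => p (Some (inr k)) ^ 2) = 2 * INR N * t.
  rewrite /sumR (bigD1 (Ordinal N0)) //= big1.
    by rewrite hp /= Rmult_1_r sqrt_sqrt; [rewrite Rplus_0_r|nra].
  by move=> k; rewrite hp -val_eqE /= => /negbTE ->; ring.
by field; lra.
Qed.

Section SymbolBounds.
Variables (Om : Type) (w lam : Om -> R).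
Hypothesis lam0 : forall om, 0 <= lam om.
Hypothesis lamw : forall om, 1 + lam om <= w om.
Variables (N : nat) (N0 : (0 < N)%N) (T : R) (T0 : 0 < T).
Variables (c : Om -> R) (z : Om -> C).

Let lam_tame a l om : 0 <= a -> (lam om + a) ^ l <= (1 + a) ^ l * w om ^ l.
Proof.
move=> a0; rewrite -Rpow_mult_distr; apply: pow_incr.
by have := lam0 om; have := lamw om; nra.
Qed.

(* b_z(r) = O(exp (|z| r / K)) for every K because beta_j decays geometrically at every rate; this is what lets
   [exp (- lam T)] absorb it for arbitrarily large radii r. *)
Lemma slow_symbol a : 0 <= a -> (forall om, Rabs (c om) <= exp (- (lam om * T))) ->
  (forall om, Cmod (z om) <= lam om + a) -> forall cc : C, Cmod cc <= 1 -> forall Rb l,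
  exists q A, forall om r, 0 <= r <= Rb -> Rabs (c om * bser N cc (z om) l r) <= A * w om ^ q.
Proof.
move=> a0 hc hz cc hcc Rb l.
have K1 : 1 <= Rabs Rb / T + 1.
  have := Rdiv_le_0_compat _ _ (Rabs_pos Rb) T0; lra.
have [C [C0 hC]] := bmaj_slow N N0 _ K1.
exists l, (C * exp (a * T) * (1 + a) ^ l) => om r hr.
have z0 := Cmod_ge_0 (z om); have la := lam0 om.
have hb := bser_bound N N0 cc (z om) l r.
rewrite (Rabs_pos_eq r) in hb; last lra.
have x0 : 0 <= Cmod (z om) * r by nra.
have hx : Cmod (z om) * r / (Rabs Rb / T + 1) <= (lam om + a) * T.
  apply/Rle_div_l; first lra.
  have -> : (lam om + a) * T * (Rabs Rb / T + 1) = (lam om + a) * (Rabs Rb + T) by field; lra.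
  apply: Rmult_le_compat => //; first lra.
  by have := Rle_abs Rb; lra.
have hB : bmaj N (Cmod (z om) * r) <= C * (exp (a * T) * exp (lam om * T)).
  apply: Rle_trans (hC _ x0) _; apply: Rmult_le_compat_l; first lra.
  rewrite -exp_plus; have : Cmod (z om) * r / (Rabs Rb / T + 1) <= a * T + lam om * T by lra.
  by case=> [h|->]; [apply: Rlt_le; exact: exp_increasing|lra].
have b0 := (bmaj_le_exp N N0 _ x0).1.
have zl : Cmod (z om) ^ l <= (1 + a) ^ l * w om ^ l.
  apply: Rle_trans (lam_tame a l om a0); apply: pow_incr; have := hz om; lra.
have zl0 : 0 <= Cmod (z om) ^ l by exact: pow_le.
have h1 : Rabs (bser N cc (z om) l r) <= ((1 + a) ^ l * w om ^ l) * (C * (exp (a * T) * exp (lam om * T))).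
  apply: Rle_trans hb _; rewrite Rmult_assoc -[X in _ <= X]Rmult_1_l.
  apply: Rmult_le_compat => //; first exact: Cmod_ge_0.
    exact: Rmult_le_pos.
  exact: Rmult_le_compat.
rewrite Rabs_mult.
have -> : C * exp (a * T) * (1 + a) ^ l * w om ^ l =
   exp (- (lam om * T)) * ((1 + a) ^ l * w om ^ l * (C * (exp (a * T) * exp (lam om * T)))).
  have e : exp (- (lam om * T)) * exp (lam om * T) = 1 by rewrite -exp_plus Rplus_opp_l exp_0.
  transitivity (C * exp (a * T) * (1 + a) ^ l * w om ^ l * (exp (- (lam om * T)) * exp (lam om * T))).
    by rewrite e; ring.
  by ring.
by apply: Rmult_le_compat => //; apply: Rabs_pos.
Qed.

(** For the circle around [lam]: there [z = lam - kappa] stays bounded, so a prefactor of size 1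
    suffices. *)
Lemma bounded_symbol M : (forall om, Rabs (c om) <= 1) -> (forall om, Cmod (z om) <= M) ->
  forall cc : C, Cmod cc <= 1 -> forall Rb l,
  exists q A, forall om r, 0 <= r <= Rb -> Rabs (c om * bser N cc (z om) l r) <= A * w om ^ q.
Proof.
move=> hc hz cc hcc Rb l; exists 0%N, (M ^ l * exp (M * Rb)) => om r hr; rewrite /= Rmult_1_r.
have z0 := Cmod_ge_0 (z om); have hM := hz om.
have hb := bser_bound N N0 cc (z om) l r.
rewrite (Rabs_pos_eq r) in hb; last lra.
have x0 : 0 <= Cmod (z om) * r by nra.
have [b0 b1] := bmaj_le_exp N N0 _ x0.
have be : bmaj N (Cmod (z om) * r) <= exp (M * Rb).
  apply: Rle_trans b1 _; have : Cmod (z om) * r <= M * Rb by apply: Rmult_le_compat => //; lra.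
  by case=> [h|->]; [apply: Rlt_le; exact: exp_increasing|lra].
have zl : Cmod (z om) ^ l <= M ^ l by apply: pow_incr.
have zl0 : 0 <= Cmod (z om) ^ l by exact: pow_le.
rewrite Rabs_mult -[X in _ <= X]Rmult_1_l; apply: Rmult_le_compat => //; try exact: Rabs_pos.
apply: Rle_trans hb _; rewrite Rmult_assoc -[X in _ <= X]Rmult_1_l.
apply: Rmult_le_compat => //; first exact: Cmod_ge_0.
  exact: Rmult_le_pos.
exact: Rmult_le_compat.
Qed.

End SymbolBounds.

Lemma exp_le x y : x <= y -> exp x <= exp y.
Proof. by case=> [h|->]; [apply: Rlt_le; exact: exp_increasing|exact: Rle_refl]. Qed.

Section Blocks.
Variables (t0 T : R).
Hypotheses (t00 : 0 < t0) (t0T : t0 < T).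
Variables (Om : Type) (w : Om -> R).
Hypothesis w1 : forall om, 1 <= w om.
Variables (n N : nat).
Hypothesis N0 : (0 < N)%N.
Variables (xi : Om -> 'I_n -> R) (bo : Om -> bool).
Hypothesis txi : forall i, tame w (fun om => xi om i).
Let lam om := dot n (xi om) (xi om).
Hypothesis lamw : forall om, 1 + lam om <= w om.
Let NR : 1 <= INR N.
Proof. by rewrite -[1]/(INR 1); apply: le_INR; lia. Qed.

Lemma stationary_family (c : Om -> R) (z : Om -> C) :
  (forall cc : C, Cmod cc <= 1 -> forall Rb l, exists q A, forall om r, 0 <= r <= Rb ->
    Rabs (c om * bser N cc (z om) l r) <= A * w om ^ q) ->
  (forall om, z om = RtoC (lam om)) ->
  wave_family Om w n N t0 T (separated Om n N xi bo c (fun _ _ => 1) (fun _ _ => 0) z).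
Proof.
move=> tb hz.
apply: (separated_wave_family Om w w1 n N t0 T N0 t00 xi bo c _ _ (fun _ _ => 0) (fun _ _ => 0) (fun=> RtoC 0) z) => //.
- by apply: (tame_bounded _ _ 0) => om; rewrite /= Rabs_R0; lra.
- by apply: (tame_bounded _ _ 0) => om; rewrite /= Rabs_R0; lra.
- by exists 0%N, 1 => om t _; rewrite /= Rabs_R0 Rabs_R1; split; lra.
- move=> om t _; split; try exact: (is_derive_const (K := R_AbsRing) (V := R_NormedModule)).
    rewrite (_ : _ * _ = 0); first exact: (is_derive_const (K := R_AbsRing) (V := R_NormedModule)).
    by rewrite /=; ring.
  rewrite (_ : _ * _ = 0); first exact: (is_derive_const (K := R_AbsRing) (V := R_NormedModule)).
  by rewrite /=; ring.
- by move=> om; rewrite hz; apply: injective_projections; rewrite /= /lam; ring.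
Qed.

(** The time factors are picked for each [om] by choice, with no relation between different values
    of [kappa]; tameness rests on bounds that are explicit in [|kappa|]. *)
Lemma decaying_family d0 C0 (c : Om -> R) (ka z : Om -> C) a : 0 <= C0 -> 0 <= a ->
  decaying_time_factors t0 T d0 C0 ->
  (forall om, d0 <= Cmod (ka om) <= lam om + a) ->
  (forall cc : C, Cmod cc <= 1 -> forall Rb l, exists q A, forall om r, 0 <= r <= Rb ->
    Rabs (c om * bser N cc (z om) l r) <= A * w om ^ q) ->
  (forall om, z om = (RtoC (lam om) - ka om)%C) ->
  exists e1 e2 : Om -> R -> R, [/\ wave_family Om w n N t0 T (separated Om n N xi bo c e1 e2 z),
    forall om, e1 om T = 1 /\ e2 om T = 0 &
    forall om t, t0 <= t <= T ->
      Cmod (e1 om t, e2 om t) <= 2 * exp (- (sqrt (INR N * (Cmod (ka om) - Re (ka om))) * (sqrt T - sqrt t)))].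
Proof.
move=> C00 a0 TF hka tb hz.
have ch om : { f : (R -> R) * (R -> R) * (R -> R) * (R -> R) |
   [/\ is_time_factor t0 T N (ka om) f.1.1.1 f.1.1.2 f.1.2 f.2,
    forall t, t0 <= t <= T -> Cmod (f.1.1.1 t, f.1.1.2 t) <= 2 * exp (- (sqrt (INR N * (Cmod (ka om) - Re (ka om))) * (sqrt T - sqrt t))) &
    forall t, t0 <= t <= T -> Cmod (f.1.2 t, f.2 t) <= C0 * (2 + 2 * INR N * Cmod (ka om))]}.
  apply: constructive_indefinite_description.
  have [E1 [E2 [D1 [D2 H]]]] := TF N (ka om) N0 (hka om).1.
  by exists (E1, E2, D1, D2).
have lw om : lam om + a <= (1 + a) * w om by have := lamw om; have := w1 om; nra.
have kw om : Cmod (ka om) <= (1 + a) * w om ^ 1 by rewrite /= Rmult_1_r; have := lw om; have := hka om; lra.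
exists (fun om => (proj1_sig (ch om)).1.1.1), (fun om => (proj1_sig (ch om)).1.1.2); split.
- apply: (separated_wave_family Om w w1 n N t0 T N0 t00 xi bo c _ _ (fun om => (proj1_sig (ch om)).1.2)
    (fun om => (proj1_sig (ch om)).2) ka z) => //.
  + by exists 1%N, (1 + a) => om; apply: Rle_trans (re_le_Cmod _) _.
  + by exists 1%N, (1 + a) => om; apply: Rle_trans (im_le_Cmod _) _.
  + exists 1%N, (2 + C0 * (2 + 2 * INR N * (1 + a))) => om t ht; case: (ch om) => [[[[E1 E2] D1] D2]] /= [_ hE hD].
    have ww := w1 om; rewrite Rmult_1_r.
    have b1 : Cmod (E1 t, E2 t) <= 2.
      apply: Rle_trans (hE t ht) _; suff : exp (- (sqrt (INR N * (Cmod (ka om) - Re (ka om))) * (sqrt T - sqrt t))) <= exp 0.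
        by rewrite exp_0; lra.
      apply: exp_le; have : 0 <= sqrt (INR N * (Cmod (ka om) - Re (ka om))) * (sqrt T - sqrt t).
        apply: Rmult_le_pos; first exact: sqrt_pos.
        have : sqrt t <= sqrt T by apply: sqrt_le_1; lra.
        lra.
      lra.
    have b2 : Cmod (D1 t, D2 t) <= C0 * (2 + 2 * INR N * (1 + a)) * w om.
      apply: Rle_trans (hD t ht) _; rewrite (Rmult_assoc C0); apply: Rmult_le_compat_l => //.
      have := kw om; rewrite /= Rmult_1_r => k.
      have : INR N * Cmod (ka om) <= INR N * ((1 + a) * w om) by apply: Rmult_le_compat_l; lra.
      lra.
    have pw : 0 <= C0 * (2 + 2 * INR N * (1 + a)).
      by apply: Rmult_le_pos => //; have : 0 <= INR N * (1 + a) by [apply: Rmult_le_pos; lra]; lra.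
    have q1 : 2 <= (2 + C0 * (2 + 2 * INR N * (1 + a))) * w om by nra.
    have q2 : C0 * (2 + 2 * INR N * (1 + a)) * w om <= (2 + C0 * (2 + 2 * INR N * (1 + a))) * w om by nra.
    have := re_le_Cmod (E1 t, E2 t); have := im_le_Cmod (E1 t, E2 t).
    have := re_le_Cmod (D1 t, D2 t); have := im_le_Cmod (D1 t, D2 t).
    by rewrite /=; split; lra.
  + by move=> om t ht; case: (ch om) => [[[[E1 E2] D1] D2]] /= [[_ _ H] _ _]; apply: H.
- by move=> om; case: (ch om) => [[[[E1 E2] D1] D2]] /= [[h1 h2 _] _ _].
- by move=> om t ht; case: (ch om) => [[[[E1 E2] D1] D2]] /= [_ H _]; apply: H.
Qed.

Lemma symbol_exp_bound (c : R) (z cc : C) a b r : Cmod cc <= 1 -> Rabs c <= exp (- a) -> 0 <= r ->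
  Cmod z * r <= a + b -> Rabs (c * bser N cc z 0 r) <= exp b.
Proof.
move=> hcc hc hr hz; rewrite Rabs_mult.
have z0 := Cmod_ge_0 z.
have hb := bser_bound N N0 cc z 0 r.
rewrite (Rabs_pos_eq r) //= Rmult_1_r in hb.
have x0 : 0 <= Cmod z * r by nra.
have [b0 b1] := bmaj_le_exp N N0 _ x0.
have -> : exp b = exp (- a) * exp (a + b) by rewrite -exp_plus; congr exp; ring.
apply: Rmult_le_compat => //; try exact: Rabs_pos.
apply: Rle_trans hb _; rewrite -[X in _ <= X]Rmult_1_l.
apply: Rmult_le_compat => //; first exact: Cmod_ge_0.
by apply: Rle_trans b1 _; apply: exp_le.
Qed.

Lemma separated_bound c e1 e2 z om p Bd :
  (forall cc : C, Cmod cc <= 1 -> Rabs (c om * bser N cc (z om) 0 (sqradius n N p)) <= Bd) ->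
  Rabs (separated Om n N xi bo c e1 e2 z om p) <= 2 * Cmod (e1 om (p None), e2 om (p None)) * Bd.
Proof.
move=> hB; rewrite /separated.
have h1 : Rabs (c om * bser N (RtoC 1) (z om) 0 (sqradius n N p)) <= Bd by apply: hB; rewrite Cmod_R Rabs_R1; lra.
have h2 : Rabs (c om * bser N (0, -1) (z om) 0 (sqradius n N p)) <= Bd.
  by apply: hB; apply: Rle_trans (Cmod_le_sum _ _) _; rewrite Rabs_R0 Rabs_Ropp Rabs_R1; lra.
set X := c om * _ in h1 *; set Y := c om * _ in h2 *.
have := re_le_Cmod (e1 om (p None), e2 om (p None)); have := im_le_Cmod (e1 om (p None), e2 om (p None)).
rewrite /=; set u1 := e1 _ _; set u2 := e2 _ _; set m := Cmod _ => i2 i1.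
have m0 : 0 <= m by exact: Cmod_ge_0.
rewrite Rabs_mult -[X in _ <= X]Rmult_1_r; apply: Rmult_le_compat; try exact: Rabs_pos; last exact: trig_bound.
apply: Rle_trans (Rabs_triang _ _) _; rewrite (Rabs_mult u1) (Rabs_mult (-1)) (Rabs_mult u2) (_ : Rabs (-1) = 1); last by rewrite Rabs_Ropp Rabs_R1.
have : Rabs u1 * Rabs X <= m * Bd by apply: Rmult_le_compat => //; exact: Rabs_pos.
have : Rabs u2 * Rabs Y <= m * Bd by apply: Rmult_le_compat => //; exact: Rabs_pos.
lra.
Qed.

(** From [(|kappa| - Re kappa) (|kappa| + Re kappa) = (Im kappa)^2], where the second factor is at
    most [2 (1 + 3 d0) (1 + l)]. This brings the decay into the form [exp (- B |sin|)] that
    [mean_exp_sin] averages. *)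
Lemma decay_sin d0 (ka : C) l s tau : 0 < d0 -> 0 <= l -> 0 <= tau -> Cmod ka <= l + 3 * d0 -> d0 * Rabs s <= Rabs (Im ka) ->
  exp (- (sqrt (INR N * (Cmod ka - Re ka)) * tau)) <=
  exp (- (sqrt (INR N * (d0 ^ 2 / (2 * (1 + 3 * d0))) / (1 + l)) * tau * Rabs s)).
Proof.
move=> d00 l0 tau0 hk hi; apply: exp_le; apply: Ropp_le_contravar.
rewrite (_ : _ * tau * Rabs s = sqrt (INR N * (d0 ^ 2 / (2 * (1 + 3 * d0))) / (1 + l)) * Rabs s * tau); last by ring.
apply: Rmult_le_compat_r => //.
have bp : 0 <= INR N * (d0 ^ 2 / (2 * (1 + 3 * d0))) / (1 + l).
  apply: Rdiv_le_0_compat; last lra.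
  apply: Rmult_le_pos; first lra.
  by apply: Rdiv_le_0_compat; [exact: pow2_ge_0|lra].
rewrite -(sqrt_Rsqr_abs s) -sqrt_mult_alt //; apply: sqrt_le_1_alt.
have e : (Cmod ka - Re ka) * (Cmod ka + Re ka) = Im ka ^ 2.
  have := Cmod_sqr ka; rewrite /Re /Im; lra.
have k0 := Cmod_ge_0 ka.
have rk := re_le_Cmod ka; have rk1 := Rle_abs (Re ka).
have rk2 : - Re ka <= Cmod ka by have := Rle_abs (- Re ka); rewrite Rabs_Ropp; lra.
have hi2 : d0 ^ 2 * Rsqr s <= Im ka ^ 2.
  rewrite (Rsqr_abs s) -(pow2_abs (Im ka)) /Rsqr; have := Rabs_pos s => sp.
  have : 0 <= d0 * Rabs s by apply: Rmult_le_pos; lra.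
  nra.
have key : d0 ^ 2 * Rsqr s <= (Cmod ka - Re ka) * (2 * (l + 3 * d0)).
  apply: Rle_trans hi2 _; rewrite -e; apply: Rmult_le_compat_l; lra.
have key2 : (Cmod ka - Re ka) * (2 * (l + 3 * d0)) <= (Cmod ka - Re ka) * (2 * (1 + 3 * d0) * (1 + l)).
  apply: Rmult_le_compat_l; [lra|nra].
have -> : INR N * (d0 ^ 2 / (2 * (1 + 3 * d0))) / (1 + l) * Rsqr s = INR N * (d0 ^ 2 * Rsqr s / (2 * (1 + 3 * d0) * (1 + l))).
  by field; split; lra.
apply: Rmult_le_compat_l; first lra.
apply/Rle_div_l; [nra|lra].
Qed.

End Blocks.

Lemma exp_opp_le1 x : 0 <= x -> exp (- x) <= 1.
Proof. by move=> x0; rewrite -exp_0; apply: exp_le; lra. Qed.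

Lemma mean_error Th (hTh : mean_functional Th) (G : R -> R) a K B p : 0 <= K -> 0 < B -> (0 < p)%N ->
  (forall th, Rabs (G th) <= a + K * exp (- (B * Rabs (sin th)))) ->
  Rabs (Th G) <= a + K * (/ INR p + 16 * INR p ^ 2 / B ^ 2).
Proof.
move=> K0 B0 p0 hG.
pose E th := exp (- (B * Rabs (sin th))).
have E1 th : 0 <= E th <= 1.
  split; first by apply: Rlt_le; exact: exp_pos.
  by rewrite -exp_0; apply: exp_le; have := Rabs_pos (sin th); nra.
have aE th : Rabs (a + K * E th) <= Rabs a + K.
  apply: Rle_trans (Rabs_triang _ _) _; apply: Rplus_le_compat_l.
  by rewrite Rabs_pos_eq; have := E1 th; nra.
have bG th : Rabs (G th) <= Rabs a + K by apply: Rle_trans (hG th) _; apply: Rle_trans (Rle_abs _) (aE th).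
have bE th : Rabs (E th) <= 1 by have := E1 th; move=> [? ?]; rewrite Rabs_pos_eq.
have ThE : Th (fun th => a + K * E th) = a + K * Th E.
  by rewrite (mean_lin _ hTh (fun=> a) E K (Rabs a) 1) // ?(mean_const _ hTh) // => _; exact: Rle_refl.
have hB := mean_exp_sin Th hTh B p B0 p0.
have up F : (forall th, Rabs (F th) <= Rabs a + K) -> (forall th, F th <= a + K * E th) -> Th F <= a + K * Th E.
  by move=> h1 h2; rewrite -ThE; exact: (mean_le _ hTh _ _ _ _ h1 aE h2).
have h1 : Th G <= a + K * Th E.
  by apply: up => // th; apply: Rle_trans (Rle_abs _) (hG th).
have h2 : Th (fun th => -1 * G th) <= a + K * Th E.
  apply: up => th; rewrite -Ropp_mult_distr_l Rmult_1_l; first by rewrite Rabs_Ropp.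
  by apply: Rle_trans (Rle_abs _) _; rewrite Rabs_Ropp; exact: hG.
rewrite (mean_scal _ hTh _ _ _ bG) in h2.
apply: Rle_trans (_ : a + K * Th E <= _); first by apply: Rabs_le; lra.
by apply: Rplus_le_compat_l; apply: Rmult_le_compat_l.
Qed.

(** * The approximants and their error *)

Section Approximation.
Variables (n : nat) (t0 T : R) (h : ('I_n -> R) -> R).
Hypotheses (t00 : 0 < t0) (t0T : t0 < T).
Variables (L : (('I_n -> R) * bool -> R) -> R) (Th : (R -> R) -> R) (d0 C0 : R).
Hypothesis HL : tame_functional (fun om : ('I_n -> R) * bool => weight om.1) L.
Hypothesis hL : forall x, L (fun om => trig om.2 (dot n om.1 x)) = h x.
Hypothesis hTh : mean_functional Th.
Hypotheses (d00 : 0 < d0) (C00 : 0 <= C0).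
Hypothesis TF : decaying_time_factors t0 T d0 C0.
Let Om : Type := ((('I_n -> R) * bool) * R)%type.
Let w (om : Om) := weight om.1.1.
Let xi (om : Om) := om.1.1.
Let bo (om : Om) := om.1.2.
Let lam (om : Om) := dot n (xi om) (xi om).
(* The radius of the circle of values of kappa around lam must keep kappa away from 0, where the time
   factors do not decay. *)
Let radius (l : R) := if Rle_dec (2 * d0) l then d0 else l + d0.
Let ka1 (om : Om) : C := (RtoC d0 * cis om.2)%C.
Let ka2 (om : Om) : C := (RtoC (lam om) + RtoC (radius (lam om)) * cis om.2)%C.
Let z1 (om : Om) : C := (RtoC (lam om) - RtoC d0 * cis om.2)%C.
Let z2 (om : Om) : C := (RtoC 0 - RtoC (radius (lam om)) * cis om.2)%C.

Let w1 om : 1 <= w om. Proof. exact: weight_ge1. Qed.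
Let lam0 om : 0 <= lam om. Proof. exact: dot_self_ge0. Qed.
Let lamw om : 1 + lam om <= w om. Proof. exact: weight_dot. Qed.
Let txi i : tame w (fun om => xi om i).
Proof. by exists 1%N, 1 => om; rewrite /= Rmult_1_r Rmult_1_l; exact: coord_le_weight. Qed.

Let radius_bound l : 0 <= l -> d0 <= radius l <= 3 * d0 /\ d0 <= Rabs (radius l - l).
Proof.
move=> l0; rewrite /radius; case: Rle_dec => hl /=.
  by split; [split; lra|rewrite Rabs_minus_sym Rabs_pos_eq; lra].
by split; [split; lra|rewrite Rabs_pos_eq; lra].
Qed.

Let Cmod_scaled_cis a x : 0 <= a -> Cmod (RtoC a * cis x)%C = a.
Proof. by move=> a0; rewrite Cmod_mult Cmod_cis Cmod_R Rabs_pos_eq // Rmult_1_r. Qed.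

Let ka1_bound om : d0 <= Cmod (ka1 om) <= lam om + 3 * d0.
Proof. by rewrite /ka1 Cmod_scaled_cis; [have := lam0 om; lra|lra]. Qed.

Let ka2_bound om : d0 <= Cmod (ka2 om) <= lam om + 3 * d0.
Proof.
have [r1 r2] := radius_bound _ (lam0 om); have l0 := lam0 om.
have c : Cmod (RtoC (radius (lam om)) * cis om.2)%C = radius (lam om) by apply: Cmod_scaled_cis; lra.
split.
  have h1 := Cmod_triangle (ka2 om) (- RtoC (lam om))%C.
  have h2 := Cmod_triangle (ka2 om) (- (RtoC (radius (lam om)) * cis om.2))%C.
  rewrite !Cmod_opp in h1 h2.
  rewrite c (_ : ka2 om + _ = RtoC (lam om))%C in h2; last by rewrite /ka2; ring.
  rewrite (_ : ka2 om + _ = RtoC (radius (lam om)) * cis om.2)%C in h1; last by rewrite /ka2; ring.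
  rewrite c in h1; rewrite Cmod_R Rabs_pos_eq // in h1 h2.
  by apply: Rle_trans r2 _; apply: Rabs_le; lra.
apply: Rle_trans (Cmod_triangle _ _) _; rewrite c Cmod_R Rabs_pos_eq //; lra.
Qed.

Let z1_bound om : Cmod (z1 om) <= lam om + d0.
Proof.
apply: Rle_trans (Cmod_triangle _ _) _; rewrite Cmod_opp Cmod_scaled_cis; last lra.
by rewrite Cmod_R Rabs_pos_eq //; apply: Rle_refl.
Qed.

Let z2_bound om : Cmod (z2 om) <= 3 * d0.
Proof.
have [r1 r2] := radius_bound _ (lam0 om).
apply: Rle_trans (Cmod_triangle _ _) _; rewrite Cmod_opp Cmod_scaled_cis; last lra.
by rewrite Cmod_R Rabs_R0; lra.
Qed.

Definition heat_limit t x := L (fun o => exp (- (dot n o.1 o.1 * (T - t))) * trig o.2 (dot n o.1 x)).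

Lemma heat_limit_solution : heat_solution t0 T h heat_limit.
Proof.
apply: (superpose_heat _ (fun om : ('I_n -> R) * bool => weight om.1) _ n t0 T (fun o => o.1) (fun o => o.2) _ _ L h HL hL).
- by move=> om; exact: weight_ge1.
- by move=> i; exists 1%N, 1 => om; rewrite /= Rmult_1_r Rmult_1_l; exact: coord_le_weight.
- exists 1%N, 1 => om; rewrite /= Rmult_1_r Rmult_1_l Rabs_pos_eq; last exact: dot_self_ge0.
  by have := weight_dot om.1; lra.
Qed.

Section FixedN.
Variable N : nat.
Hypothesis N0 : (0 < N)%N.
Let I : finType := option ('I_n + 'I_N)%type.
Let c0 om := exp (- (lam om * T)).
Let c1 om := - exp (- (lam om * T)).
Variables e1 e2 f1 f2 : Om -> R -> R.
Let m0 := separated Om n N xi bo c0 (fun _ _ => 1) (fun _ _ => 0) (fun om => RtoC (lam om)).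
Let m1 := separated Om n N xi bo c1 e1 e2 z1.
Let m2 := separated Om n N xi bo (fun=> 1) f1 f2 z2.
(** [m1] runs over the circle around 0 and cancels the trace of [m0]; [m2] runs over the circle
    around [lam] and supplies the trace 1. [m0] does not depend on the angle. *)
Definition mode om p := m0 om p + m1 om p + m2 om p.
Definition approx t x y := L (fun o => Th (fun th => mode (o, th)
  (fun j : I => match j with None => t | Some (inl i) => x i | Some (inr k) => y k end))).

Let NR : 1 <= INR N.
Proof. by rewrite -[1]/(INR 1); apply: le_INR; lia. Qed.

Hypotheses (We : wave_family Om w n N t0 T m1) (Wf : wave_family Om w n N t0 T m2).
Hypotheses (eT : forall om, e1 om T = 1 /\ e2 om T = 0) (fT : forall om, f1 om T = 1 /\ f2 om T = 0).
Hypothesis ed : forall om t, t0 <= t <= T ->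
  Cmod (e1 om t, e2 om t) <= 2 * exp (- (sqrt (INR N * (Cmod (ka1 om) - Re (ka1 om))) * (sqrt T - sqrt t))).
Hypothesis fd : forall om t, t0 <= t <= T ->
  Cmod (f1 om t, f2 om t) <= 2 * exp (- (sqrt (INR N * (Cmod (ka2 om) - Re (ka2 om))) * (sqrt T - sqrt t))).

Lemma approx_wave : wave_solution t0 T h approx.
Proof.
have H0 : wave_family Om w n N t0 T m0.
  apply: stationary_family => //.
  apply: (slow_symbol Om w lam lam0 lamw N N0 T _ c0 _ 0) => //; try lra.
    by move=> om; rewrite /c0 Rabs_pos_eq; [exact: Rle_refl|apply: Rlt_le; exact: exp_pos].
  by move=> om; rewrite Cmod_R Rabs_pos_eq //; lra.
have HF : wave_family Om w n N t0 T mode.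
  by apply: (wave_family_add Om w w1) => //; apply: (wave_family_add Om w w1).
have HP := product_functional _ _ L Th HL hTh.
have [k1 k2] := superpose_wave Om w w1 n N t0 T mode _ HP HF.
have UE : uncurry3 approx = (fun p : I -> R => L (fun o => Th (fun th => mode (o, th) p))) by [].
rewrite /wave_solution UE; split; first exact: k1; split; first exact: k2.
move=> x y; rewrite -(hL x) /approx; congr L; apply: functional_extensionality => o.
set p : I -> R := fun j => _.
set r := sqradius n N p.
pose l := dot n o.1 o.1.
set tr := trig _ _.
have r0 : 0 <= r.
  rewrite /r /sqradius; apply: Rdiv_le_0_compat; last lra.
  apply: (big_ind (fun s => 0 <= s)) => [|a b|k _]; [lra|lra|exact: pow2_ge_0].
have l0 : 0 <= l by exact: dot_self_ge0.
have bz (z0 d : R) th : Rabs (bser N (RtoC 1) (RtoC z0 - RtoC d * cis th)%C 0 r) <= exp ((Rabs z0 + Rabs d) * r).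
  rewrite -[X in Rabs X]Rmult_1_l; apply: (symbol_exp_bound N N0 1 _ _ 0) => //.
  - by rewrite Cmod_R Rabs_R1; lra.
  - by rewrite Rabs_R1 Ropp_0 exp_0; lra.
  - rewrite Rplus_0_l; apply: Rmult_le_compat_r => //.
    apply: Rle_trans (Cmod_triangle _ _) _; rewrite Cmod_opp Cmod_mult Cmod_cis !Cmod_R; lra.
pose A := bser N (RtoC 1) (RtoC l) 0 r.
pose g1 th := bser N (RtoC 1) (RtoC l - RtoC d0 * cis th)%C 0 r.
pose g2 th := bser N (RtoC 1) (RtoC 0 - RtoC (radius l) * cis th)%C 0 r.
have -> : (fun th => mode (o, th) p) = (fun th => (exp (- (l * T)) * A * tr + (- exp (- (l * T)) * tr) * g1 th) + tr * g2 th).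
  apply: functional_extensionality => th; rewrite /mode /m0 /m1 /m2 /separated.
  rewrite (_ : p None = T) // (eT (o, th)).1 (eT (o, th)).2 (fT (o, th)).1 (fT (o, th)).2.
  rewrite /c0 /c1 /z1 /z2 /lam /xi /bo /= -/l -/r -/(g1 th) -/(g2 th) -/A.
  by rewrite (_ : trig _ _ = tr) //; ring.
have b1 th : Rabs (g1 th) <= exp ((Rabs l + Rabs d0) * r) by exact: bz.
have b2 th : Rabs (g2 th) <= exp ((Rabs 0 + Rabs (radius l)) * r) by exact: bz.
have bA th : Rabs (exp (- (l * T)) * A * tr + (- exp (- (l * T)) * tr) * g1 th) <=
    Rabs (exp (- (l * T)) * A * tr) + Rabs (- exp (- (l * T)) * tr) * exp ((Rabs l + Rabs d0) * r).
  apply: Rle_trans (Rabs_triang _ _) _; apply: Rplus_le_compat_l; rewrite Rabs_mult.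
  by apply: Rmult_le_compat_l => //; exact: Rabs_pos.
rewrite (mean_lin _ hTh _ _ _ _ _ bA b2).
rewrite (mean_lin _ hTh (fun=> _) _ _ _ _ (fun=> Rle_refl _) b1) (mean_const _ hTh).
(* Both averages take their values at the centres: [b_lam] cancels the stationary term, and [b_0]
   remains. *)
rewrite /g1 /g2 !(bser_mean N N0) // -/A (bser_real N 0 r); last by rewrite Rmult_0_l; lra.
have -> : bmaj N (0 * r) = 1.
  have := bmaj_limit N N0 (0 * r); rewrite Rmult_0_l exp_0 => /(_ (Rle_refl 0)).
  rewrite (_ : 0 ^ 2 * 1 / INR N = 0); last by rewrite /=; field; lra.
  by move=> hh; have := Rabs_pos (1 - bmaj N 0); have := Rle_abs (1 - bmaj N 0); have := Rle_abs (- (1 - bmaj N 0)); rewrite Rabs_Ropp; lra.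
by ring.
Qed.

Lemma approx_radial : radial_y approx.
Proof.
move=> A hA _ t x y; rewrite /approx; congr L; apply: functional_extensionality => o.
congr Th; apply: functional_extensionality => th; rewrite /mode /m0 /m1 /m2 /separated /sqradius.
by rewrite (mx_app_sqr N A y hA).
Qed.

(** The factor 4 comes from the constant 2 of the time factors and from adding a real and an
    imaginary part. The exponentials bound the symbols for radii up to [T]: [|z| <= lam + d0] after
    [exp (- lam T)] is absorbed, and [|z| <= 3 d0]. *)
Let K := 4 * (exp (d0 * T) + exp (3 * d0 * T)).
Let beta := d0 ^ 2 / (2 * (1 + 3 * d0)).

Let K0 : 0 <= K.
Proof. by rewrite /K; have := exp_pos (d0 * T); have := exp_pos (3 * d0 * T); lra. Qed.

Let beta0 : 0 < beta.
Proof. by apply: Rdiv_lt_0_compat; [exact: pow_lt|lra]. Qed.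

(** On the paraboloid the radius is [r = t <= T]. There [bmaj_limit] compares the stationary term
    with the heat mode, and [exp (- lam T) * exp (lam t) <= 1] leaves an error polynomial in [lam];
    the two corrections are bounded by their decay in time. *)
Lemma mode_error om (p : I -> R) t : t0 <= t <= T -> p None = t -> sqradius n N p = t ->
  Rabs (mode om p - exp (- (lam om * (T - t))) * trig (bo om) (dot n (xi om) (fun i => p (Some (inl i))))) <=
  (lam om * T) ^ 2 / INR N + K * exp (- (sqrt (INR N * beta / (1 + lam om)) * (sqrt T - sqrt t) * Rabs (sin om.2))).
Proof.
move=> ht pt pr; have l0 := lam0 om.
have tau0 : 0 <= sqrt T - sqrt t by have : sqrt t <= sqrt T by [apply: sqrt_le_1; lra]; lra.
set E := exp (- (sqrt _ * _ * _)); set ta := exp _ * _.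
have dec (g1 g2 : Om -> R -> R) (ka : C) : Cmod ka <= lam om + 3 * d0 -> d0 * Rabs (sin om.2) <= Rabs (Im ka) ->
    Cmod (g1 om t, g2 om t) <= 2 * exp (- (sqrt (INR N * (Cmod ka - Re ka)) * (sqrt T - sqrt t))) ->
    Cmod (g1 om t, g2 om t) <= 2 * E.
  move=> k1 k2 k3; apply: Rle_trans k3 _; apply: Rmult_le_compat_l; first lra.
  exact: (decay_sin N N0 d0 ka (lam om)).
have E0 : 0 < E by exact: exp_pos.
have bound (c : Om -> R) (g1 g2 : Om -> R -> R) z Bd : 0 <= Bd -> Cmod (g1 om t, g2 om t) <= 2 * E ->
    (forall cc : C, Cmod cc <= 1 -> Rabs (c om * bser N cc (z om) 0 t) <= Bd) ->
    Rabs (separated Om n N xi bo c g1 g2 z om p) <= 4 * Bd * E.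
  move=> B0 hc hB; have := separated_bound Om n N xi bo c g1 g2 z om p Bd.
  rewrite pt pr => /(_ hB) H; apply: Rle_trans H _.
  have : Cmod (g1 om t, g2 om t) * Bd <= 2 * E * Bd by exact: Rmult_le_compat_r.
  lra.
have h1 : Rabs (m1 om p) <= 4 * exp (d0 * T) * E.
  apply: bound; first by apply: Rlt_le; exact: exp_pos.
    apply: (dec e1 e2 (ka1 om)); [exact: (ka1_bound om).2| |exact: ed].
    rewrite /ka1 (_ : Im _ = d0 * sin om.2); last by rewrite /=; ring.
    by rewrite Rabs_mult (Rabs_pos_eq d0); lra.
  move=> cc hcc; apply: (symbol_exp_bound N N0 _ _ _ (lam om * T)) => //; last 1 first.
  - have := z1_bound om; have := Cmod_ge_0 (z1 om) => z0 hz.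
    apply: Rle_trans (_ : (lam om + d0) * T <= _); last lra.
    by apply: Rmult_le_compat => //; lra.
  - by rewrite /c1 Rabs_Ropp Rabs_pos_eq; [exact: Rle_refl|apply: Rlt_le; exact: exp_pos].
  - lra.
have h2 : Rabs (m2 om p) <= 4 * exp (3 * d0 * T) * E.
  apply: bound; first by apply: Rlt_le; exact: exp_pos.
    apply: (dec f1 f2 (ka2 om)); [exact: (ka2_bound om).2| |exact: fd].
    have [r1 r2] := radius_bound _ l0.
    rewrite /ka2 (_ : Im _ = radius (lam om) * sin om.2); last by rewrite /=; ring.
    rewrite Rabs_mult (Rabs_pos_eq (radius _)); last lra.
    by apply: Rmult_le_compat_r; [exact: Rabs_pos|lra].
  move=> cc hcc; apply: (symbol_exp_bound N N0 _ _ _ 0) => //.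
  - by rewrite Ropp_0 exp_0 Rabs_R1; lra.
  - lra.
  - have := z2_bound om; have := Cmod_ge_0 (z2 om) => z0 hz.
    by rewrite Rplus_0_l; apply: Rmult_le_compat => //; lra.
have h0 : Rabs (m0 om p - ta) <= (lam om * T) ^ 2 / INR N.
  rewrite /m0 /separated /ta pr /c0.
  rewrite (bser_real N (lam om) t); last by apply: Rmult_le_pos; lra.
  set tr := trig _ _; set b := bmaj _ _; set b' := bser _ _ _ _ _.
  rewrite (_ : _ - _ = exp (- (lam om * T)) * - (exp (lam om * t) - b) * tr); last first.
    have -> : exp (- (lam om * (T - t))) = exp (- (lam om * T)) * exp (lam om * t) by rewrite -exp_plus; congr exp; ring.
    by ring.
  have lt0 : 0 <= lam om * t by apply: Rmult_le_pos; lra.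
  have hb := bmaj_limit N N0 (lam om * t) lt0.
  rewrite Rabs_mult -[X in _ <= X]Rmult_1_r; apply: Rmult_le_compat; try exact: Rabs_pos; last exact: trig_bound.
  rewrite Rabs_mult Rabs_Ropp Rabs_pos_eq; last by apply: Rlt_le; exact: exp_pos.
  apply: Rle_trans (_ : exp (- (lam om * T)) * ((lam om * t) ^ 2 * exp (lam om * t) / INR N) <= _).
    by apply: Rmult_le_compat_l => //; apply: Rlt_le; exact: exp_pos.
  have ltT : lam om * t <= lam om * T by apply: Rmult_le_compat_l; lra.
  have e1' : exp (- (lam om * T)) * exp (lam om * t) <= 1 by rewrite -exp_plus -exp_0; apply: exp_le; lra.
  rewrite (_ : exp (- (lam om * T)) * _ = (lam om * t) ^ 2 * (exp (- (lam om * T)) * exp (lam om * t)) / INR N); last by field; lra.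
  apply: Rmult_le_compat_r; first by apply: Rlt_le; apply: Rinv_0_lt_compat; lra.
  apply: Rle_trans (_ : (lam om * t) ^ 2 * 1 <= _); first by apply: Rmult_le_compat_l => //; exact: pow2_ge_0.
  by rewrite Rmult_1_r; apply: pow_incr; lra.
rewrite /mode (_ : _ - _ = (m0 om p - ta) + m1 om p + m2 om p); last ring.
have := Rabs_triang (m0 om p - ta + m1 om p) (m2 om p); have := Rabs_triang (m0 om p - ta) (m1 om p).
rewrite /K; lra.
Qed.

Lemma mode_bounded om (p : I -> R) t : t0 <= t <= T -> p None = t -> sqradius n N p = t ->
  Rabs (mode om p) <= 1 + (lam om * T) ^ 2 / INR N + K.
Proof.
move=> ht pt pr; have := mode_error om p t ht pt pr.
set E := exp (- (sqrt _ * _ * _)); set ta := exp _ * _ => H.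
have E1 : E <= 1.
  apply: exp_opp_le1; apply: Rmult_le_pos; last exact: Rabs_pos.
  apply: Rmult_le_pos; first exact: sqrt_pos.
  by have : sqrt t <= sqrt T by [apply: sqrt_le_1; lra]; lra.
have t1 : Rabs ta <= 1.
  rewrite /ta Rabs_mult -[X in _ <= X]Rmult_1_r; apply: Rmult_le_compat; try exact: Rabs_pos; last exact: trig_bound.
  rewrite Rabs_pos_eq; last by apply: Rlt_le; exact: exp_pos.
  by apply: exp_opp_le1; apply: Rmult_le_pos; [exact: lam0|lra].
have KE : K * E <= K by rewrite -[X in _ <= X]Rmult_1_r; apply: Rmult_le_compat_l.
have := Rabs_triang (mode om p - ta) ta; rewrite (_ : mode om p - ta + ta = mode om p); last ring.
lra.
Qed.

(** After averaging, the errors grow in [lam] like [lam^2], like a constant, and like [1 + lam], the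
    last from [1 / B^2]. All are below [(1 + lam)^2], hence below the square of the weight, which is
    why the bound of [L] at order 2 enters. *)
Lemma approx_error Q : (forall F A, (forall o, Rabs (F o) <= A * weight o.1 ^ 2) -> Rabs (L F) <= Q * A) ->
  forall t x p, t0 <= t < T -> (0 < p)%N ->
  Rabs (on_paraboloid approx t x - heat_limit t x) <=
  Q * (T ^ 2 / INR N + K * (/ INR p + 16 * INR p ^ 2 / (INR N * beta * (sqrt T - sqrt t) ^ 2))).
Proof.
move=> hQ t x p [ht1 ht2] p0; rewrite /on_paraboloid /approx /heat_limit.
set P := fun j : I => _.
have rP : sqradius n N P = t by apply: (sqradius_paraboloid n N t N0) => //; lra.
have ht : t0 <= t <= T by lra.
pose ta o := exp (- (dot n o.1 o.1 * (T - t))) * trig o.2 (dot n o.1 x).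
have dw (o : ('I_n -> R) * bool) : 1 + dot n o.1 o.1 <= weight o.1 by exact: weight_dot.
have d0' (o : ('I_n -> R) * bool) : 0 <= dot n o.1 o.1 by exact: dot_self_ge0.
have bt o : Rabs (ta o) <= 1.
  rewrite /ta Rabs_mult -[X in _ <= X]Rmult_1_r; apply: Rmult_le_compat; try exact: Rabs_pos; last exact: trig_bound.
  rewrite Rabs_pos_eq; last by apply: Rlt_le; exact: exp_pos.
  by apply: exp_opp_le1; apply: Rmult_le_pos => //; lra.
have bF o th : Rabs (mode (o, th) P) <= 1 + (dot n o.1 o.1 * T) ^ 2 / INR N + K by apply: (mode_bounded (o, th) P t).
have iN : 0 < / INR N by apply: Rinv_0_lt_compat; lra.
have tau0 : 0 < sqrt T - sqrt t by have : sqrt t < sqrt T by [apply: sqrt_lt_1; lra]; lra.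
have ThE o : Th (fun th => mode (o, th) P) - ta o = Th (fun th => mode (o, th) P + -1 * ta o).
  rewrite (mean_lin _ hTh _ (fun=> ta o) _ _ _ (bF o) (fun=> bt o)) (mean_const _ hTh); ring.
have sw (o : ('I_n -> R) * bool) : (1 + dot n o.1 o.1) ^ 2 <= weight o.1 ^ 2 by apply: pow_incr; have := dw o; have := d0' o; lra.
have tame_ta : tame (fun om : ('I_n -> R) * bool => weight om.1) ta.
  by exists 0%N, 1 => o; rewrite /= Rmult_1_r; exact: bt.
have tame_F : tame (fun om : ('I_n -> R) * bool => weight om.1) (fun o => Th (fun th => mode (o, th) P)).
  exists 2%N, (1 + T ^ 2 / INR N + K) => o; apply: Rle_trans (mean_abs _ hTh _ _ (bF o)) _.
  have := sw o; have := d0' o; set l := dot _ _ _ => l0 hw.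
  have T2 : 0 <= T ^ 2 / INR N by apply: Rmult_le_pos; [exact: pow2_ge_0|lra].
  rewrite (_ : (l * T) ^ 2 / INR N = T ^ 2 / INR N * l ^ 2); last by field; lra.
  apply: Rle_trans (_ : (1 + T ^ 2 / INR N + K) * (1 + l) ^ 2 <= _).
    have := pow2_ge_0 l; nra.
  by apply: Rmult_le_compat_l => //; lra.
have -> : L (fun o => Th (fun th => mode (o, th) P)) - L ta = L (fun o => Th (fun th => mode (o, th) P + -1 * ta o)).
  transitivity (L (fun o => Th (fun th => mode (o, th) P)) + -1 * L ta); first ring.
  rewrite -HL.1 //; congr L; apply: functional_extensionality => o; rewrite -ThE; ring.
apply: hQ => o; have l0 := d0' o.
pose B := sqrt (INR N * beta / (1 + dot n o.1 o.1)) * (sqrt T - sqrt t).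
have Nb : 0 < INR N * beta by apply: Rmult_lt_0_compat; lra.
have ar : 0 < INR N * beta / (1 + dot n o.1 o.1) by apply: Rdiv_lt_0_compat; lra.
have B0 : 0 < B by apply: Rmult_lt_0_compat => //; exact: sqrt_lt_R0.
have := mean_error Th hTh (fun th => mode (o, th) P + -1 * ta o) ((dot n o.1 o.1 * T) ^ 2 / INR N) K B p K0 B0 p0.
move=> H; apply: Rle_trans (H _) _.
  move=> th; rewrite (_ : _ + -1 * _ = mode (o, th) P - ta o); last ring.
  exact: (mode_error (o, th) P t ht).
have B2 : B ^ 2 = INR N * beta / (1 + dot n o.1 o.1) * (sqrt T - sqrt t) ^ 2.
  by rewrite /B Rpow_mult_distr pow2_sqrt //; lra.
have P0 : 0 < INR p by apply: lt_0_INR; lia.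
have tau2 : 0 < (sqrt T - sqrt t) ^ 2 by apply: pow_lt.
rewrite B2; set l := dot n o.1 o.1 in l0 *.
have -> : (l * T) ^ 2 / INR N = T ^ 2 / INR N * l ^ 2 by field; lra.
have -> : 16 * INR p ^ 2 / (INR N * beta / (1 + l) * (sqrt T - sqrt t) ^ 2) =
    16 * INR p ^ 2 / (INR N * beta * (sqrt T - sqrt t) ^ 2) * (1 + l).
  by field; repeat split; lra.
have s0 : 0 <= 16 * INR p ^ 2 / (INR N * beta * (sqrt T - sqrt t) ^ 2).
  apply: Rdiv_le_0_compat; last exact: Rmult_lt_0_compat.
  by have := pow2_ge_0 (INR p); lra.
set S := _ / (INR N * beta * _) in s0 *.
have ip : 0 < / INR p by apply: Rinv_0_lt_compat.
have T2 : 0 <= T ^ 2 / INR N by apply: Rmult_le_pos; [exact: pow2_ge_0|lra].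
have hw := sw o; rewrite -/l in hw.
have KS : 0 <= K * S by apply: Rmult_le_pos.
have Kp : 0 <= K * / INR p by apply: Rmult_le_pos; lra.
apply: Rle_trans (_ : (T ^ 2 / INR N + K * (/ INR p + S)) * (1 + l) ^ 2 <= _).
  have l2 := pow2_ge_0 l; have -> : (1 + l) ^ 2 = 1 + 2 * l + l ^ 2 by ring.
  have g1 : 0 <= T ^ 2 / INR N * l by exact: Rmult_le_pos.
  have g2 : 0 <= K * S * l by exact: Rmult_le_pos.
  have g3 : 0 <= K * / INR p * l by exact: Rmult_le_pos.
  have g4 : 0 <= K * S * l ^ 2 by exact: Rmult_le_pos.
  have g5 : 0 <= K * / INR p * l ^ 2 by exact: Rmult_le_pos.
  lra.
by apply: Rmult_le_compat_l => //; lra.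
Qed.

End FixedN.

Lemma wave_approximant N Q : (0 < N)%N ->
  (forall F A, (forall o, Rabs (F o) <= A * weight o.1 ^ 2) -> Rabs (L F) <= Q * A) ->
  exists u : R -> ('I_n -> R) -> ('I_N -> R) -> R,
  [/\ wave_solution t0 T h u, radial_y u & forall t x p, t0 <= t < T -> (0 < p)%N ->
    Rabs (on_paraboloid u t x - heat_limit t x) <=
    Q * (T ^ 2 / INR N + 4 * (exp (d0 * T) + exp (3 * d0 * T)) *
      (/ INR p + 16 * INR p ^ 2 / (INR N * (d0 ^ 2 / (2 * (1 + 3 * d0))) * (sqrt T - sqrt t) ^ 2)))].
Proof.
move=> N0 hQ.
have T0 : 0 < T by lra.
have a0 : 0 <= 3 * d0 by lra.
have l0 := lam0.
have [e1 [e2 [We eT ed]]] : exists e1 e2 : Om -> R -> R,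
    [/\ wave_family Om w n N t0 T (separated Om n N xi bo (fun om => - exp (- (lam om * T))) e1 e2 z1),
    forall om, e1 om T = 1 /\ e2 om T = 0 & forall om t, t0 <= t <= T -> Cmod (e1 om t, e2 om t) <=
      2 * exp (- (sqrt (INR N * (Cmod (ka1 om) - Re (ka1 om))) * (sqrt T - sqrt t)))].
  apply: (decaying_family t0 T t00 t0T Om w w1 n N N0 xi bo txi lamw d0 C0 _ ka1 z1 (3 * d0)) => //.
  apply: (slow_symbol Om w lam l0 lamw N N0 T T0 _ z1 d0); [lra| |exact: z1_bound].
  by move=> om; rewrite Rabs_Ropp Rabs_pos_eq; [exact: Rle_refl|apply: Rlt_le; exact: exp_pos].
have [f1 [f2 [Wf fT fd]]] : exists e1 e2 : Om -> R -> R,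
    [/\ wave_family Om w n N t0 T (separated Om n N xi bo (fun=> 1) e1 e2 z2),
    forall om, e1 om T = 1 /\ e2 om T = 0 & forall om t, t0 <= t <= T -> Cmod (e1 om t, e2 om t) <=
      2 * exp (- (sqrt (INR N * (Cmod (ka2 om) - Re (ka2 om))) * (sqrt T - sqrt t)))].
  apply: (decaying_family t0 T t00 t0T Om w w1 n N N0 xi bo txi lamw d0 C0 _ ka2 z2 (3 * d0)) => //.
    apply: (bounded_symbol Om w N N0 _ z2 (3 * d0)); last exact: z2_bound.
    by move=> om; rewrite Rabs_R1; exact: Rle_refl.
  by move=> om; rewrite /z2 /ka2 /lam; ring.
exists (approx N e1 e2 f1 f2); split.
- exact: approx_wave.
- exact: approx_radial.
- by move=> t x p; exact: (approx_error N N0 e1 e2 f1 f2 ed fd Q hQ t x p).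
Qed.

End Approximation.

(** * Passage to the limit *)

Lemma inv_INR_small M eps : 0 <= M -> 0 < eps -> exists m, (0 < m)%N /\ forall k, (m <= k)%N -> M * / INR k < eps.
Proof.
move=> M0 e0; have [m hm] := INR_unbounded (M / eps).
exists m.+1; split=> // k hk.
have mk : INR m < INR k by apply: lt_INR; lia.
have q0 : 0 <= M / eps by exact: Rdiv_le_0_compat.
apply: (Rmult_lt_reg_r (INR k)); first lra.
rewrite (_ : M * / INR k * INR k = M); last by field; lra.
rewrite (_ : M = M / eps * eps); last by field; lra.
by nra.
Qed.

Theorem theorem4p1 (n : nat) (t0 T : R) (h : ('I_n -> R) -> R) :
  (0 < n)%N -> 0 < t0 -> t0 < T -> smooth_compact h ->
  exists (u : forall N : nat, R -> ('I_n -> R) -> ('I_N -> R) -> R)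
         (v : R -> ('I_n -> R) -> R),
    (forall N : nat, (0 < N)%N -> wave_solution t0 T h (u N) /\ radial_y (u N)) /\
    (forall t x, t0 <= t <= T ->
       Un_cv (fun N : nat => on_paraboloid (u N) t x) (v t x)) /\
    heat_solution t0 T h v.
Proof.
move=> _ t00 t0T hh.
have [L [HL hL]] := fourier_functional n h hh.
have [Th hTh] := circle_functional.
have [d0 [C0 [d00 C00 TF]]] := time_factor t0 T t00 t0T.
(* Order 2 is the growth in the weight of the error of a single mode; [Q] is independent of [N]. *)
have [Q [Q0 hQ]] := HL.2 2%N.
pose K := 4 * (exp (d0 * T) + exp (3 * d0 * T)).
pose beta := d0 ^ 2 / (2 * (1 + 3 * d0)).
have K0 : 0 <= K by rewrite /K; have := exp_pos (d0 * T); have := exp_pos (3 * d0 * T); lra.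
have beta0 : 0 < beta by apply: Rdiv_lt_0_compat; [exact: pow_lt|lra].
have hv := heat_limit_solution n t0 T h L HL hL.
have ch N : {u : R -> ('I_n -> R) -> ('I_N -> R) -> R | (0 < N)%N ->
   [/\ wave_solution t0 T h u, radial_y u & forall t x p, t0 <= t < T -> (0 < p)%N ->
    Rabs (on_paraboloid u t x - heat_limit n T L t x) <=
     Q * (T ^ 2 / INR N + K * (/ INR p + 16 * INR p ^ 2 / (INR N * beta * (sqrt T - sqrt t) ^ 2)))]}.
  (* For [N = 0] the zero function is a placeholder. *)
  apply: constructive_indefinite_description; case: (posnP N) => [->|N0]; first by exists (fun _ _ _ => 0).
  by have [u hu] := wave_approximant n t0 T h t00 t0T L Th d0 C0 HL hL hTh d00 C00 TF N Q N0 hQ; exists u.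
exists (fun N => proj1_sig (ch N)), (heat_limit n T L).
split; first by move=> N N0; case: (ch N) => u /= /(_ N0) [].
split; last exact: hv.
move=> t x ht eps e0.
(* At [t = T] the error bound degenerates, but there the prescribed trace gives the limit exactly;
   starting at index 1 avoids the placeholder at [N = 0]. *)
case: (Req_dec t T) => [->|tT].
  exists 1%N => N hN; have N0 : (0 < N)%N by lia.
  case: (ch N) => u /= /(_ N0) [[_ [_ hu]] _ _].
  by rewrite /on_paraboloid hu hv.2.2 R_dist_eq.
have tau0 : 0 < sqrt T - sqrt t by have : sqrt t < sqrt T by [apply: sqrt_lt_1; lra]; lra.
have tau2 : 0 < (sqrt T - sqrt t) ^ 2 by exact: pow_lt.
have QK : 0 <= Q * K by exact: Rmult_le_pos.
(* [p] is fixed first to make the term in [1 / p] small; [N] is taken large afterwards, because the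
   remaining error contains [p^2 / N]. *)
have [p [p0 hp]] := inv_INR_small (Q * K) (eps / 2) QK ltac:(lra).
have p2 := pow2_ge_0 (INR p).
have bt : 0 < beta * (sqrt T - sqrt t) ^ 2 by exact: Rmult_lt_0_compat.
pose M := Q * (T ^ 2 + K * (16 * INR p ^ 2 / (beta * (sqrt T - sqrt t) ^ 2))).
have M0 : 0 <= M.
  apply: Rmult_le_pos => //; apply: Rplus_le_le_0_compat; first exact: pow2_ge_0.
  by apply: Rmult_le_pos => //; apply: Rdiv_le_0_compat => //; lra.
have [m [m0 hm]] := inv_INR_small M (eps / 2) M0 ltac:(lra).
exists m => N hN; have N0 : (0 < N)%N by lia.
case: (ch N) => u /= /(_ N0) [_ _ /(_ t x p ltac:(lra) p0) H].
rewrite /R_dist; apply: Rle_lt_trans H _.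
have Np : 0 < INR N by apply: lt_0_INR; lia.
have Pp : 0 < INR p by apply: lt_0_INR; lia.
have -> : Q * (T ^ 2 / INR N + K * (/ INR p + 16 * INR p ^ 2 / (INR N * beta * (sqrt T - sqrt t) ^ 2))) =
    M * / INR N + Q * K * / INR p.
  by rewrite /M; field; repeat split; lra.
have := hm N ltac:(lia); have := hp p (leqnn p); lra.
Qed.
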